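(* Let $f:\Omega\times[0,\infty)\to\mathbb{R}$ satisfy: (f1) $f$ is a Carathéodory function; (f2) $f(\cdot,t)\in L^\infty(\Omega)$ for every $t\ge 0$; (f3) there is a constant $c_p>0$ with $|f(x,t)|\le c_p(1+t^{p-1})$ for a.e. $x\in\Omega$ and every $t\ge 0$; (f4) for a.e. $x\in\Omega$ the function $t\mapsto f(x,t)/t^{p-1}$ is strictly decreasing in $(0,\infty)$; (f5) there is $\rho_f>0$ such that $f(x,t)>0$ for a.e. $x\in\Omega$ and every $0<t<\rho_f$. Then the problem $$-H_pu+(-\Delta_p)^su=f(x,u)\ \text{in }\Omega,\qquad u\gneqq 0\ \text{in }\Omega,\qquad u=0\ \text{in }\mathbb{R}^N\setminus\Omega$$ admits at most one weak solution in $W_0^{1,p}(\Omega)$.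
   Context: $\Omega\subset\mathbb{R}^N$, $N\ge2$, is a bounded $C^1$ domain, $1<p<\infty$, $0<s<1$, and $d\mu=|x-y|^{-N-ps}\,dx\,dy$. $H:\mathbb{R}^N\to[0,\infty)$ is a Finsler–Minkowski norm: $H\in C^1(\mathbb{R}^N\setminus\{0\})$; $H(x)=0$ iff $x=0$; $H(tx)=|t|H(x)$ for all $t\in\mathbb{R}$, $x\in\mathbb{R}^N$; there are constants $C_1,C_2>0$ with $C_1|x|\le H(x)\le C_2|x|$ for all $x$; and $H$ is strictly convex as a norm, i.e. $H(x+y)<H(x)+H(y)$ for linearly independent $x,y$. The vector field $H(\xi)^{p-1}\nabla H(\xi)$ is understood as $0$ at $\xi=0$. $H_pu=\mathrm{div}(H(\nabla u)^{p-1}\nabla H(\nabla u))$ and $(-\Delta_p)^su(x)=\mathrm{P.V.}\int_{\mathbb{R}^N}|u(x)-u(y)|^{p-2}(u(x)-u(y))|x-y|^{-N-ps}\,dy$. $W_0^{1,p}(\Omega)=\{u\in W^{1,p}(\mathbb{R}^N):u=0\text{ in }\mathbb{R}^N\setminus\Omega\}$. $u\in W_0^{1,p}(\Omega)$ is a weak solution of the problem if (i) for every $\phi\in W_0^{1,p}(\Omega)$, $$\int_\Omega H(\nabla u)^{p-1}\nabla H(\nabla u)\cdot\nabla\phi\,dx+\iint_{\mathbb{R}^{2N}}|u(x)-u(y)|^{p-2}(u(x)-u(y))(\phi(x)-\phi(y))\,d\mu=\int_\Omega f(x,u)\phi\,dx,$$ and (ii) $u\ge0$ a.e. in $\Omega$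 and $|\{x\in\Omega:u(x)>0\}|>0$. *)

(* Defs.v *)
From HB Require Import structures.
From mathcomp Require Import all_boot all_order all_algebra.
From mathcomp Require Import all_classical all_reals all_analysis.

Set Implicit Arguments.
Unset Strict Implicit.
Unset Printing Implicit Defensive.

Import Order.TTheory GRing.Theory Num.Theory.
Import numFieldNormedType.Exports.

Local Open Scope classical_set_scope.
Local Open Scope ring_scope.

(* The sigma-algebra on row vectors is the one generated by the coordinates;
   for T = R it is the Borel sigma-algebra of R^n. *)

Definition measure_rV_display : measure_display -> measure_display.
Proof. exact. Qed.

Section measurable_rV.
Context {d} {T : sigmaRingType d}.
Variable n : nat.

Definition rV_coord : 'I_n -> 'rV[T]_n -> T := fun i x => x ord0 i.

Let rV_set0 : g_sigma_preimage rV_coord set0.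
Proof. exact: sigma_algebra0. Qed.

Let rV_setC A : g_sigma_preimage rV_coord A -> g_sigma_preimage rV_coord (~` A).
Proof. exact: sigma_algebraC. Qed.

Let rV_bigcup (F : _^nat) : (forall i, g_sigma_preimage rV_coord (F i)) ->
  g_sigma_preimage rV_coord (\bigcup_i (F i)).
Proof. exact: sigma_algebra_bigcup. Qed.

HB.instance Definition _ := @isMeasurable.Build (measure_rV_display d)
  'rV[T]_n (g_sigma_preimage rV_coord) rV_set0 rV_setC rV_bigcup.

End measurable_rV.

Lemma measurable_rV_coord d (T : sigmaRingType d) n (i : 'I_n) :
  measurable_fun setT (@rV_coord d T n i).
Proof.
move=> _ Y mY; rewrite setTI; apply: sub_sigma_algebra => /=.
rewrite -bigcup_seq/=; exists i => /=; first by rewrite mem_index_enum.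
by exists Y => //; rewrite setTI.
Qed.

Lemma measurable_fun_rV d1 d2 (T1 : measurableType d1) (T2 : measurableType d2)
    n (f : T1 -> 'rV[T2]_n) :
  (forall i, measurable_fun setT (fun x => f x ord0 i)) ->
  measurable_fun setT f.
Proof.
move=> mf _ A mA; rewrite setTI.
suff : (g_sigma_preimage (@rV_coord _ T2 n)) `<=` [set B | measurable (f @^-1` B)]
  by exact.
apply: smallest_sub; first split => /=.
- by rewrite preimage_set0.
- by move=> B mB; rewrite setTD preimage_setC; exact: measurableC.
- by move=> F mF; rewrite preimage_bigcup; exact: bigcup_measurable.
rewrite -bigcup_seq => B [i _ [C mC <-]] /=.
by rewrite setTI; have := mf i measurableT _ mC; rewrite setTI.
Qed.

Section lebesgue_rV_def.
Context {R : realType}.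

Definition rV_cons n (p : R * 'rV[R]_n) : 'rV[R]_n.+1 :=
  row_mx (p.1)%:M p.2.

Lemma rV_cons0 n (p : R * 'rV[R]_n) : rV_cons p ord0 ord0 = p.1.
Proof.
have := row_mxEl (p.1%:M : 'M[R]_1) p.2 ord0 ord0.
rewrite [X in _ = X]mxE eqxx mulr1n => <-.
by congr (fun_of_matrix _ _ _); exact/val_inj.
Qed.

Lemma rV_consS n (p : R * 'rV[R]_n) i :
  rV_cons p ord0 (lift ord0 i) = p.2 ord0 i.
Proof.
rewrite -[RHS](row_mxEr (p.1%:M : 'M[R]_1) p.2 ord0 i).
by congr (fun_of_matrix _ _ _); exact/val_inj.
Qed.

Lemma measurable_rV_cons n : measurable_fun setT (@rV_cons n).
Proof.
apply: measurable_fun_rV => i.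
have [j ->|->] := unliftP ord0 i; last first.
  by under eq_fun do rewrite rV_cons0; exact: measurable_fst.
under eq_fun do rewrite rV_consS.
apply: (@measurableT_comp _ _ _ _ _ _ (@rV_coord _ R n j)) => //.
exact: measurable_rV_coord.
Qed.

Definition rV_uncons n (x : 'rV[R]_n.+1) : R * 'rV[R]_n :=
  (x ord0 ord0, \row_j x ord0 (lift ord0 j)).

Lemma rV_consK n : cancel (@rV_cons n) (@rV_uncons n).
Proof.
move=> [a x]; congr pair; first by rewrite rV_cons0.
by apply/rowP => i; rewrite mxE rV_consS.
Qed.

Lemma measurable_rV_uncons n : measurable_fun setT (@rV_uncons n).
Proof.
apply: measurable_fun_pair; first exact: (measurable_rV_coord ord0).
apply: measurable_fun_rV => i; under eq_fun do rewrite mxE.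
exact: (measurable_rV_coord (lift ord0 i)).
Qed.

Section cons.
Variables (n : nat) (m : {sigma_finite_measure set 'rV[R]_n -> \bar R}).

Definition lebesgue_cons : set 'rV[R]_n.+1 -> \bar R :=
  pushforward (@lebesgue_measure R \x m)%E (@rV_cons n).

Let mcons0 : lebesgue_cons set0 = 0%E.
Proof. by rewrite /lebesgue_cons /pushforward preimage_set0 measure0. Qed.

Let mcons_ge0 A : (0 <= lebesgue_cons A)%E.
Proof. exact: (measure_ge0 (@lebesgue_measure R \x m)%E). Qed.

Let mcons_sigma_additive : semi_sigma_additive lebesgue_cons.
Proof.
move=> F mF tF mUF; rewrite /lebesgue_cons /pushforward preimage_bigcup.
have mpre (B : set 'rV[R]_n.+1) :
    measurable B -> measurable (@rV_cons n @^-1` B).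
  by move=> mB; rewrite -[X in measurable X]setTI; exact: measurable_rV_cons.
apply: measure_semi_sigma_additive.
- by move=> k; exact: mpre.
- apply/trivIsetP => /= i j _ _ ij; rewrite -preimage_setI.
  by move/trivIsetP : tF => /(_ _ _ _ _ ij) ->//; rewrite preimage_set0.
- by rewrite -preimage_bigcup; exact: mpre.
Qed.

HB.instance Definition _ := isMeasure.Build _ _ _ lebesgue_cons
  mcons0 mcons_ge0 mcons_sigma_additive.

Let mcons_sigma_finite : sigma_finite setT lebesgue_cons.
Proof.
have /sigma_finiteP[A [TA ndA Aoo]] := sigma_finiteT (@lebesgue_measure R).
have /sigma_finiteP[B [TB ndB Boo]] := sigma_finiteT m.
exists (fun k => @rV_uncons n @^-1` (A k `*` B k)).
  apply/seteqP; split => // x _.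
  have [i _ Ai] : (\bigcup_k A k) (rV_uncons x).1 by rewrite -TA.
  have [j _ Bj] : (\bigcup_k B k) (rV_uncons x).2 by rewrite -TB.
  exists (maxn i j) => //; split => /=.
    by move: Ai; exact/subsetPset/ndA/leq_maxl.
  by move: Bj; exact/subsetPset/ndB/leq_maxr.
move=> k; have [[mA muA] [mB muB]] := (Aoo k, Boo k); split.
  rewrite -[X in measurable X]setTI; apply: measurable_rV_uncons => //.
  exact: measurableX.
rewrite /lebesgue_cons /pushforward -comp_preimage (_ : _ \o _ = id).
  by rewrite preimage_id product_measure1E// lte_mul_pinfty// ge0_fin_numE.
by apply/funext => p /=; rewrite rV_consK.
Qed.

HB.instance Definition _ := Measure_isSigmaFinite.Build _ _ _ lebesgue_cons
  mcons_sigma_finite.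

End cons.

(* The n-fold product of the one-dimensional Lebesgue measure, on Borel sets;
   see lebesgue_rV_box for the volume of boxes. *)
Fixpoint lebesgue_rV (n : nat) : {sigma_finite_measure set 'rV[R]_n -> \bar R} :=
  match n with
  | 0 => [the {sigma_finite_measure set 'rV[R]_0 -> \bar R} of \d_(0 : 'rV[R]_0)]
  | n'.+1 => [the {sigma_finite_measure set 'rV[R]_n'.+1 -> \bar R} of
                lebesgue_cons (lebesgue_rV n')]
  end.

Lemma lebesgue_rV_box n (a b : 'rV[R]_n) :
  (forall i, a ord0 i <= b ord0 i) ->
  lebesgue_rV n [set x | forall i, x ord0 i \in `[a ord0 i, b ord0 i]] =
  (\prod_(i < n) (b ord0 i - a ord0 i))%:E.
Proof.
elim: n a b => [|n IHn] a b ab.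
  by rewrite big_ord0 /= diracE mem_set//= => -[].
rewrite big_ord_recl EFinM /= /lebesgue_cons /pushforward.
have -> : @rV_cons n @^-1` [set x | forall i, x ord0 i \in `[a ord0 i, b ord0 i]] =
  (`[a ord0 ord0, b ord0 ord0]%classic `*`
    [set x : 'rV[R]_n | forall i : 'I_n, x ord0 i \in
       `[(rV_uncons a).2 ord0 i, (rV_uncons b).2 ord0 i]]).
  apply/seteqP; split => -[t x] /=.
    move=> tx; split; first by have := tx ord0; rewrite rV_cons0.
    by move=> i; rewrite !mxE; have := tx (lift ord0 i); rewrite rV_consS.
  move=> [tab xab] i; have [j ->|->] := unliftP ord0 i; last by rewrite rV_cons0.
  by rewrite rV_consS; have := xab j; rewrite !mxE.
rewrite product_measure1E//; last first.
  rewrite (_ : mkset _ = \big[setI/setT]_(i < n) (@rV_coord _ R n i @^-1`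
     `[(rV_uncons a).2 ord0 i, (rV_uncons b).2 ord0 i]%classic)).
    apply: bigsetI_measurable => i _.
    by rewrite -[X in measurable X]setTI; exact: measurable_rV_coord.
  rewrite -bigcap_seq; apply/seteqP; split => x /= h i; first by move=> _; exact: h.
  by apply: h; rewrite /= mem_index_enum.
rewrite IHn; last by move=> i; rewrite !mxE.
congr (_ * _)%E; last first.
  by congr EFin; apply: eq_bigr => i _; rewrite !mxE.
rewrite -[LHS]/(lebesgue_measure `[a ord0 ord0, b ord0 ord0]%classic).
rewrite lebesgue_measure_itv /= lte_fin.
have := ab ord0; rewrite le_eqVlt => /predU1P[->|->//].
by rewrite ltxx subrr.
Qed.

End lebesgue_rV_def.

Section calculus.
Context {R : realType} {n : nat}.
Implicit Types (x y : 'rV[R]_n) (g : 'rV[R]_n -> R) (U : set 'rV[R]_n).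

Definition dotrV x y : R := \sum_(i < n) x ord0 i * y ord0 i.

(* The library norm `|x| on row vectors is the sup norm. *)
Definition enorm x : R := Num.sqrt (dotrV x x).

Definition partial (i : 'I_n) g x : R := 'D_(delta_mx ord0 i) g x.

Definition grad g x : 'rV[R]_n := \row_i partial i g x.

Definition C1_on U g :=
  forall x, U x -> differentiable g x /\ {for x, continuous (grad g)}.

Definition smooth g :=
  forall (l : seq 'I_n) x, differentiable (foldr partial g l) x.

Definition test_function g :=
  smooth g /\ compact (closure [set x | g x != 0]).

End calculus.

(* Near each boundary point Omega lies strictly on one side of the graph of a
   C^1 function of the other n - 1 coordinates: x_i > gamma(x') (sg = false) or
   - x_i > gamma(x') (sg = true), col' i x being x with x_i removed. *)
Definition C1_boundary (R : realType) n (Omega : set 'rV[R]_n) :=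
  forall x0 : 'rV[R]_n, (closure Omega `\` Omega) x0 ->
  exists (i : 'I_n) (sg : bool) (gamma : 'rV[R]_n.-1 -> R),
    C1_on setT gamma /\
    \forall x \near x0,
      Omega x <-> gamma (col' i x) < (-1) ^+ sg * x ord0 i.

Definition bounded_C1_domain (R : realType) n (Omega : set 'rV[R]_n) :=
  [/\ Omega !=set0, open Omega, connected Omega, bounded_set Omega
    & C1_boundary Omega].

Record finsler_minkowski_norm (R : realType) n (H : 'rV[R]_n -> R) : Prop := {
  fm_ge0 : forall x, 0 <= H x;
  fm_C1 : C1_on [set x | x != 0] H;
  fm_eq0 : forall x, H x = 0 <-> x = 0;
  fm_homogeneous : forall (t : R) x, H (t *: x) = `|t| * H x;
  fm_equivalent : exists C1 C2 : R, [/\ 0 < C1, 0 < C2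
    & forall x, C1 * enorm x <= H x /\ H x <= C2 * enorm x];
  fm_strictly_convex : forall x y : 'rV[R]_n,
    free [:: x; y] -> H (x + y) < H x + H y
}.

Section sobolev.
Context {R : realType} {n : nat}.
Implicit Types (u g : 'rV[R]_n -> R) (G : 'rV[R]_n -> 'rV[R]_n).
Local Notation mu := (@lebesgue_rV R n).

(* Measurability for the completed (Lebesgue) sigma-algebra. *)
Definition lebesgue_measurable (D : set 'rV[R]_n) g :=
  exists2 h, measurable_fun D h & {ae mu, forall x, D x -> g x = h x}.

Definition Linfty (D : set 'rV[R]_n) g :=
  lebesgue_measurable D g /\
  exists M : R, {ae mu, forall x, D x -> `|g x| <= M}.

Definition locally_integrable_rV g :=
  forall K : set 'rV[R]_n, compact K -> mu.-integrable K (EFin \o g).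

Definition weak_gradient u G :=
  (forall i, locally_integrable_rV (fun x => G x ord0 i)) /\
  forall psi, test_function psi -> forall i,
    (\int[mu]_x (u x * partial i psi x)%:E =
     - \int[mu]_x (G x ord0 i * psi x)%:E)%E.

(* Weak gradients are unique up to null sets; this picks one. *)
Definition wgrad u : 'rV[R]_n -> 'rV[R]_n := get [set G | weak_gradient u G].

(* Elements of Sobolev spaces are represented by Borel functions (each class of
   Lebesgue measurable functions contains one); equality in the space is
   equality almost everywhere. *)
Definition W1p (p : R) u :=
  u \in Lfun mu p%:E /\
  exists2 G, weak_gradient u G & forall i, (fun x => G x ord0 i) \in Lfun mu p%:E.

Definition W1p_0 (p : R) (Omega : set 'rV[R]_n) u :=
  W1p p u /\ {ae mu, forall x, ~ Omega x -> u x = 0}.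

End sobolev.

Section equation.
Context {R : realType} {n : nat}.
Local Notation mu := (@lebesgue_rV R n).

Definition caratheodory (Omega : set 'rV[R]_n) (f : 'rV[R]_n -> R -> R) :=
  (forall t : R, 0 <= t -> lebesgue_measurable Omega (f ^~ t)) /\
  {ae mu, forall x, Omega x -> {within `[0, +oo[, continuous (f x)}}.

Definition finsler_flux (p : R) (H : 'rV[R]_n -> R) (xi : 'rV[R]_n) : 'rV[R]_n :=
  if xi == 0 then 0 else (H xi `^ (p - 1)) *: grad H xi.

(* At t = 0 the value is 0 for every p, as powR is total. *)
Definition signed_pow (p t : R) : R := `|t| `^ (p - 2) * t.

(* The density of d mu with respect to dx dy. *)
Definition frac_kernel (p s : R) (z : 'rV[R]_n * 'rV[R]_n) : R :=
  enorm (z.1 - z.2) `^ (- (n%:R + p * s)).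

(* All three integrals converge absolutely under the growth condition on f. The
   right-hand integrand need only be measurable for the completed sigma-algebra;
   on such functions the integral, a difference of suprema of integrals of
   simple functions, is the Lebesgue integral. *)
Definition weak_solution (Omega : set 'rV[R]_n) (p s : R) (H : 'rV[R]_n -> R)
    (f : 'rV[R]_n -> R -> R) (u : 'rV[R]_n -> R) :=
  [/\ W1p_0 p Omega u,
      forall phi, W1p_0 p Omega phi ->
        (\int[mu]_(x in Omega)
            (dotrV (finsler_flux p H (wgrad u x)) (wgrad phi x))%:E +
         \int[mu \x mu]_z
            (signed_pow p (u z.1 - u z.2) * (phi z.1 - phi z.2) *
             frac_kernel p s z)%:E =
         \int[mu]_(x in Omega) (f x (u x) * phi x)%:E)%E,
      {ae mu, forall x, Omega x -> 0 <= u x}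
    & (0 < mu (Omega `&` [set x | (0 < u x)%R]))%E].

End equation.

(* Main.v *)
Require Import Defs.
From HB Require Import structures.
From mathcomp Require Import all_boot all_order all_algebra.
From mathcomp Require Import all_classical all_reals all_analysis.
From mathcomp Require Import measurable_realfun.
From mathcomp Require Import ring lra.

(** The idea is that of Brezis and Oswald, and of Diaz and Saa: although the
    operator is not linear, it is monotone in the variable u^p.  Suppose that
    the equation of u could be tested with u - v^p u^(1-p), and that of v with
    v - u^p v^(1-p).  The Picone inequalities (flux_picone for the Finsler
    term, discrete_picone for the fractional term) say that the left-hand sides
    then add up to something nonnegative, whereas the right-hand sides add up
    to the integral of
      (f(x,u) / u^(p-1) - f(x,v) / v^(p-1)) (u^p - v^p),
    which is nonpositive by the monotonicity of f(x,t) / t^(p-1), and zero only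
    if u = v (picone_sign).

    These functions need not be admissible, since u may vanish and v may be
    unbounded.  For e > 0 put T(b) = b / (1 + e b) (trunc) and test with
      u + e - (T(v) + e)^p (u + e)^(1-p)          (picone_test).
    This is a Lipschitz function of (u, v) that vanishes at (0, 0), hence an
    element of the Sobolev space (picone_test_W1p_0), and both Picone
    inequalities survive because T is 1-Lipschitz.  The fractional term of each
    tested equation is a convergent integral because the other two terms are
    finite (integrable_nonlocal).  On the right-hand side, f(x,u) is negative
    only where u stays away from 0, where (u + e)^(1-p) absorbs the growth of
    f; so the reaction is bounded above by an integrable function that does
    not depend on e (reaction_sum_le).

    Then e tends to 0 and Fatou's lemma is applied twice.  The fractional
    densities are nonnegative, have bounded integrals, and tend to infinity on
    {u = 0 < v} x {u > 0}; as {u > 0} has positive measure, {u = 0 < v} is a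
    null set (null_zero_set), and so is {v = 0 < u}.  Applied to the
    majorant minus the reaction, Fatou's lemma then shows that the nonpositive
    function displayed above has integral at least 0, so it vanishes
    (picone_deficit_ae0).

    Two facts about Sobolev functions carry the rest.  The chain rule
    (weak_partial_chain) comes from difference quotients: a function with weak
    partial derivative G satisfies
      u(x + h e_i) - u(x) = int_0^h G(x + r e_i) dr   for almost every x
    (line_increment), by the fundamental lemma of the calculus of variations;
    the Lebesgue differentiation theorem on lines then makes the quotients
    converge to G almost everywhere, and integrals of averages of |G| dominate
    them.  And x -> f(x, u(x)) agrees almost everywhere with a Borel function
    (superposition_measurable), while the integral does not see null sets,
    whether the integrands are measurable or not (eq_ae_integral). *)

Set Implicit Arguments.
Unset Strict Implicit.
Unset Printing Implicit Defensive.

Import Order.TTheory GRing.Theory Num.Theory.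
Import numFieldNormedType.Exports.

Local Open Scope classical_set_scope.
Local Open Scope ring_scope.

(** * Lebesgue measure on row vectors: boxes, open sets, translations *)

(* The measure is used through its values on boxes, never through its recursive definition. *)
Opaque lebesgue_rV.

Section boxes.
Context {R : realType} {n : nat}.
Implicit Types (x y a b : 'rV[R]_n).
Local Notation mu := (@lebesgue_rV R n).

Lemma le_coord_norm x i : `|x ord0 i| <= `|x|.
Proof.
rewrite [leRHS]/Num.Def.normr /= mx_normrE.
by apply/bigmax_geP; right => /=; exists (ord0, i).
Qed.

Definition box a b : set 'rV[R]_n :=
  [set x | forall i, x ord0 i \in `[a ord0 i, b ord0 i]].

Definition boxes : set (set 'rV[R]_n) := [set A | exists a b, A = box a b].

Lemma coord_bigcap (A : 'I_n -> set R) :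
  [set x : 'rV[R]_n | forall i, A i (x ord0 i)] =
  \big[setI/setT]_(i < n) (@rV_coord _ R n i @^-1` A i).
Proof.
rewrite -bigcap_seq; apply/seteqP; split => x /= h i; first by move=> _; exact: h.
by apply: h; rewrite /= mem_index_enum.
Qed.

Lemma measurable_coord_prod (A : 'I_n -> set R) : (forall i, measurable (A i)) ->
  measurable [set x : 'rV[R]_n | forall i, A i (x ord0 i)].
Proof.
move=> mA; rewrite coord_bigcap; apply: bigsetI_measurable => i _.
by rewrite -[X in measurable X]setTI; exact: measurable_rV_coord.
Qed.

Lemma measurable_box a b : measurable (box a b).
Proof. exact: (measurable_coord_prod (A := fun i => `[a ord0 i, b ord0 i]%classic)). Qed.

Lemma compact_box a b : compact (box a b).
Proof.
apply: (rV_compact (A := fun i => `[a ord0 i, b ord0 i]%classic)) => i.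
exact: segment_compact.
Qed.

Lemma boxes_setI : setI_closed boxes.
Proof.
move=> _ _ [a [b ->]] [c [d ->]].
exists (\row_i Num.max (a ord0 i) (c ord0 i)), (\row_i Num.min (b ord0 i) (d ord0 i)).
apply/seteqP; split => x /=.
  move=> [xab xcd] i; rewrite !mxE; move: (xab i) (xcd i).
  by rewrite !in_itv/= ge_max le_min => /andP[-> ->] /andP[-> ->].
by move=> h; split => i; move: (h i); rewrite !mxE !in_itv/= ge_max le_min;
  case/andP => /andP[? ?] /andP[? ?]; apply/andP.
Qed.

Lemma box_cover : \bigcup_k box (const_mx (- k%:R)) (const_mx k%:R) = setT.
Proof.
apply/seteqP; split => // x _; exists (Num.truncn `|x|).+1 => // i.
rewrite !mxE in_itv/= -ler_norml (le_trans (le_coord_norm x i))//.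
exact/ltW/truncnS_gt.
Qed.

Lemma box_lt_pinfty a b : (mu (box a b) < +oo)%E.
Proof.
have [ab|nab] := pselect (forall i, a ord0 i <= b ord0 i).
  by rewrite lebesgue_rV_box// ltry.
rewrite (_ : box a b = set0) ?measure0//; apply/seteqP; split => // x /= xab.
apply: nab => i; have := xab i; rewrite in_itv/= => /andP[]; exact: le_trans.
Qed.

(** Half-spaces given by a lower bound on one coordinate generate the sigma-
    algebra, and each is an increasing union of boxes. *)
Lemma sigma_boxes : measurable = <<s boxes >>.
Proof.
apply/seteqP; split; last first.
  apply: smallest_sub; first exact: sigma_algebra_measurable.
  by move=> _ [a [b ->]]; exact: measurable_box.
apply: smallest_sub; first exact: smallest_sigma_algebra.
rewrite -bigcup_seq => B [i _ [C mC <-]] /=; rewrite setTI.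
suff : measurable `<=` [set D : set R | <<s boxes >> (@rV_coord _ R n i @^-1` D)] by exact.
rewrite [X in X `<=` _](RGenCInfty.measurableE R); apply: smallest_sub; first split => /=.
- by rewrite preimage_set0; exact: sigma_algebra0.
- by move=> D mD; rewrite setTD preimage_setC -setTD; exact: sigma_algebraCD.
- by move=> F mF; rewrite preimage_bigcup; exact: sigma_algebra_bigcup.
move=> _ [x ->] /=.
rewrite (_ : _ @^-1` _ = \bigcup_k box
   (\row_j if j == i then x else - k%:R) (const_mx k%:R)).
  by apply: sigma_algebra_bigcup => k; apply: sub_gen_smallest; do 2 eexists.
apply/seteqP; split => y /=.
  rewrite in_itv/= andbT => xy; exists (Num.truncn `|y|).+1 => // j.
  have := le_coord_norm y j => /le_trans/(_ (ltW (truncnS_gt `|y|))).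
  by rewrite ler_norml !mxE in_itv/= => /andP[? ->]; case: eqP => [->|]; rewrite andbT.
by move=> [k _ /(_ i)]; rewrite !mxE eqxx !in_itv/= => /andP[->].
Qed.

(** Boxes form a pi-system that generates the sigma-algebra and contains an
    exhausting sequence of finite measure. *)
Lemma box_measure_unique (m1 m2 : {measure set 'rV[R]_n -> \bar R}) :
  (forall a b, m1 (box a b) = m2 (box a b)) ->
  (forall a b, m1 (box a b) < +oo)%E ->
  forall A, measurable A -> m1 A = m2 A.
Proof.
move=> m12 m1oo; apply: (measure_unique boxes
  (fun k => box (const_mx (- k%:R)) (const_mx k%:R))).
- exact: sigma_boxes.
- exact: boxes_setI.
- by move=> k; do 2 eexists.
- exact: box_cover.
- by move=> _ [a [b ->]].
- by move=> k; exact: m1oo.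
Qed.

(** An open set is the union of the countably many rational cubes that it
    contains; the sigma-algebra itself is generated by coordinates and knows
    nothing of the topology. *)
Lemma open_measurable_rV (U : set 'rV[R]_n) : open U -> measurable U.
Proof.
move=> oU.
(* cubes with rational centre and half-width 1 / (k + 1) *)
pose B (z : 'rV[rat]_n * nat) := box (\row_i (ratr (z.1 ord0 i) - z.2.+1%:R^-1))
                                     (\row_i (ratr (z.1 ord0 i) + z.2.+1%:R^-1)).
rewrite (_ : U = \bigcup_(z in [set z | B z `<=` U]) B z).
  rewrite bigcup_mkcond; apply: countable_bigcupT_measurable => // z.
  by case: ifP => // _; exact: measurable_box.
apply/seteqP; split => [x Ux|x [z zU Bzx]]; last exact: zU.
have /nbhs_ballP[e /= e0 xeU] := open_nbhs_nbhs (conj oU Ux).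
(* a cube of half-width 1 / (k + 1) around x has diameter less than e *)
pose k := Num.truncn (2 / e).
have k0 : 0 < k.+1%:R^-1 :> R by rewrite invr_gt0.
have ke : k.+1%:R^-1 *+ 2 < e.
  rewrite -[_ *+ 2]mulr_natl ltr_pdivrMr ?ltr0n// mulrC -ltr_pdivrMr//.
  exact: truncnS_gt.
have /choice[q qx] : forall i, exists q : rat, ratr q \in `](x ord0 i - k.+1%:R^-1), (x ord0 i + k.+1%:R^-1)[.
  by move=> i; apply: rat_in_itvoo; rewrite ltrD2l gtrN.
have Bx : B (\row_i q i, k) x.
  move=> i; rewrite /= !mxE in_itv/=; move: (qx i); rewrite in_itv/=.
  move: (ratr (q i)) (x ord0 i) (k.+1%:R^-1) => t y z.
  by move=> /andP[? ?]; apply/andP; split; lra.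
exists (\row_i q i, k) => // y By; apply: xeU; split => // i j; rewrite (ord1 i : i = ord0) /ball/=.
move: (By j) (qx j); rewrite /= !mxE !in_itv/=; rewrite mulr2n in ke.
move: (ratr (q j)) (x ord0 j) (y ord0 j) (k.+1%:R^-1) ke => t a b c ke /andP[? ?] /andP[? ?].
by rewrite ltr_distlC; apply/andP; split; lra.
Qed.

Lemma closed_measurable_rV (U : set 'rV[R]_n) : closed U -> measurable U.
Proof. by move=> cU; rewrite -[U]setCK; apply: measurableC; apply: open_measurable_rV; exact: closed_openC. Qed.

Lemma compact_measurable_rV (K : set 'rV[R]_n) : compact K -> measurable K.
Proof. move=> cK; apply: closed_measurable_rV; exact: compact_closed. Qed.

Lemma bounded_sub_box (K : set 'rV[R]_n) : bounded_set K ->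
  exists r : R, 0 < r /\ forall x, K x -> forall i, `|x ord0 i| <= r.
Proof.
move=> [M [Mr KM]]; exists (Num.max 0 M + 1); split.
  by rewrite ltr_pwDr// le_max lexx.
move=> x Kx i; apply: (le_trans (le_coord_norm x i)); apply: KM => //.
by rewrite ltr_pwDr// le_max lexx orbT.
Qed.

Lemma open_continuous_measurable_rV (U : set 'rV[R]_n) (g : 'rV[R]_n -> R) : open U ->
  {in U, continuous g} -> measurable_fun U g.
Proof.
move=> oU /(continuous_inP _ oU) gc.
apply: (measurability _ (RGenOInfty.measurableE R)) => _ [_ [x ->] <-].
apply: open_measurable_rV; apply: gc.
exact: rray_open.
Qed.

Lemma continuous_measurable_rV (g : 'rV[R]_n -> R) :
  continuous g -> measurable_fun setT g.
Proof.
move=> gc; apply: open_continuous_measurable_rV; first exact: openT.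
by move=> x _; exact: gc.
Qed.

Definition shift_rV (c x : 'rV[R]_n) : 'rV[R]_n := x + c.

Lemma measurable_shift_rV c : measurable_fun setT (shift_rV c).
Proof.
apply: measurable_fun_rV => i; under eq_fun do rewrite mxE.
by apply: measurable_funD => //; exact: measurable_rV_coord.
Qed.

HB.instance Definition _ c := isMeasurableFun.Build _ _ _ _ _ (measurable_shift_rV c).

(** A translate of Lebesgue measure gives boxes the same volume. *)
Lemma lebesgue_rV_shift c A : measurable A ->
  pushforward mu (shift_rV c) A = mu A.
Proof.
move=> mA; apply/esym; move: A mA; apply: box_measure_unique => a b; last first.
  exact: box_lt_pinfty.
change (mu (box a b) = mu (shift_rV c @^-1` box a b)).
rewrite (_ : _ @^-1` _ = box (a - c) (b - c)); last first.
  apply/seteqP; split=> x /= h i; have := h i; rewrite !mxE !in_itv/=.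
    by rewrite lerBlDr lerBrDr.
  by rewrite lerBlDr lerBrDr.
have [ab|nab] := pselect (forall i, a ord0 i <= b ord0 i).
  rewrite !lebesgue_rV_box//; last by move=> i; rewrite !mxE lerD2r.
  by congr EFin; apply: eq_bigr => i _; rewrite !mxE opprB addrA subrK.
rewrite (_ : box a b = set0) ?measure0; last first.
  apply/seteqP; split => // x /= xab; apply: nab => i; have := xab i.
  by rewrite in_itv/= => /andP[]; exact: le_trans.
rewrite (_ : box _ _ = set0) ?measure0//.
apply/seteqP; split => // x /= xab; apply: nab => i; have := xab i.
by rewrite in_itv/= !mxE => /andP[+ +] => /le_trans /[apply]; rewrite lerD2r.
Qed.

Lemma ge0_integral_shift c (g : 'rV[R]_n -> \bar R) : measurable_fun setT g ->
  (forall x, 0 <= g x)%E -> (\int[mu]_x g (x + c)%R = \int[mu]_x g x)%E.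
Proof.
move=> mg g0.
transitivity (\int[pushforward mu (shift_rV c)]_x g x)%E.
  by rewrite ge0_integral_pushforward.
by apply: eq_measure_integral => A mA _; exact: lebesgue_rV_shift.
Qed.

Lemma integral_shift c (g : 'rV[R]_n -> \bar R) : measurable_fun setT g ->
  (\int[mu]_x g (x + c)%R = \int[mu]_x g x)%E.
Proof.
move=> mg; rewrite integralE [RHS]integralE.
rewrite -(ge0_integral_shift c (g := g^\+%E))//; last exact: measurable_funepos.
rewrite -(ge0_integral_shift c (g := g^\-%E))//; last exact: measurable_funeneg.
by congr (_ - _)%E; apply: eq_integral => x _; rewrite ?funeposE ?funenegE.
Qed.

End boxes.

Section real_dominated_convergence.
Context d (T : measurableType d) {R : realType} (mu : {measure set T -> \bar R}).

Lemma real_dominated_convergence (D : set T) (f_ : nat -> T -> R) (f g : T -> R) :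
  measurable D -> (forall m, measurable_fun D (f_ m)) -> measurable_fun D f ->
  {ae mu, forall x, D x -> f_ ^~ x @ \oo --> f x} ->
  mu.-integrable D (EFin \o g) ->
  {ae mu, forall x m, D x -> `|f_ m x| <= g x} ->
  mu.-integrable D (EFin \o f) /\
  (fun m => \int[mu]_(x in D) (f_ m x)%:E)%E @ \oo --> (\int[mu]_(x in D) (f x)%:E)%E.
Proof.
move=> mD mf_ mf cf ig fg.
have [] := @dominated_convergence _ _ _ mu D mD (fun m => EFin \o f_ m) (EFin \o f) (EFin \o g).
- by move=> m; exact/measurable_EFinP.
- exact/measurable_EFinP.
- apply: filterS cf => x + Dx => /(_ Dx) h; apply: cvg_EFin => //; exact: nearW.
- exact: ig.
- by apply: filterS fg => x h m Dx; rewrite /= lee_fin h.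
by move=> *; split.
Qed.

End real_dominated_convergence.

(** * Smooth bump functions and the fundamental lemma of the calculus of variations *)

Section flat.
Context {R : realType}.
Implicit Types (t : R) (k : nat).

(** The functions t^(-k) exp(-1/t), extended by 0, are closed under
    differentiation up to linear combinations, so that smoothness follows by
    induction from a first derivative. *)
Definition flat k t : R := if 0 < t then t^-1 ^+ k * expR (- t^-1) else 0.

Lemma flat_ge0 k t : 0 <= flat k t.
Proof.
rewrite /flat; case: ifPn => // t0.
by rewrite mulr_ge0 ?expR_ge0// exprn_ge0// invr_ge0 ltW.
Qed.

(** From exp(z) >= z^(k+2) / (k+2)! with z = 1/t. The quadratic bound gives the
    derivative at 0. *)
Lemma flat_le_sqr k t : flat k t <= (k.+2)`!%:R * t ^+ 2.
Proof.
rewrite /flat; case: ifPn => [t0|_]; last first.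
  by rewrite mulr_ge0// ?sqr_ge0.
have z0 : 0 < t^-1 by rewrite invr_gt0.
have := expR_ge1Dxn k.+1 (ltW z0).
move=> h; rewrite expRN -ler_pdivlMr ?invr_gt0 ?expR_gt0// invrK.
apply: le_trans (ler_wpM2l _ h); last by rewrite mulr_ge0// sqr_ge0.
have -> : t^-1 ^+ k = (k.+2)`!%:R * t ^+ 2 * (t^-1 ^+ k.+2 / (k.+2)`!%:R).
  rewrite -(addn2 k) exprD; set c := _ `!%:R.
  have c0 : c != 0 by rewrite pnatr_eq0 -lt0n fact_gt0.
  have t0' : t != 0 by rewrite gt_eqF.
  by move: (t^-1 ^+ k) => z; field; rewrite t0' c0.
by rewrite mulrDr lerDr mulr1 mulr_ge0// sqr_ge0.
Qed.

Lemma is_derive0_sqr (f : R -> R) (C : R) :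
  (forall h, `|f h - f 0| <= C * h ^+ 2) -> is_derive (0 : R) (1 : R) f 0.
Proof.
move=> fC.
have C0 : 0 <= C by have := fC 1; rewrite expr1n mulr1; exact: le_trans.
suff h : (fun h => h^-1 *: ((f \o shift 0) (h *: 1) - f 0)) @ 0^' --> (0 : R).
  apply: DeriveDef; first by apply/cvg_ex; exists 0.
  exact: cvg_lim.
apply/cvgr0Pnorm_le => e e0; near=> h; rewrite /= addr0 [h *: 1]mulr1.
rewrite normrZ normfV.
have h0 : h != 0 by near: h; exact: nbhs_dnbhs_neq.
rewrite ler_pdivrMl ?normr_gt0// (le_trans (fC h))//.
rewrite -real_normK ?num_real// expr2 mulrCA ler_wpM2l//.
rewrite (@le_trans _ _ ((C + 1) * `|h|))//; first by rewrite ler_wpM2r// lerDl.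
by rewrite mulrC -ler_pdivlMr ?ltr_wpDl//; near: h; apply: dnbhs0_le; rewrite divr_gt0// ltr_wpDl.
Unshelve. all: by end_near. Qed.

Lemma is_derive_flat k t : is_derive t 1 (flat k) (flat k.+2 t - k%:R * flat k.+1 t).
Proof.
have [t0|t0|->] := ltgtP t 0.
- apply: (@near_eq_is_derive _ _ _ (cst 0)) => //.
    near=> s; rewrite /flat ltNge; suff -> : s <= 0 by [].
    by apply/ltW; near: s; exact: lt_nbhsl.
  rewrite /flat ltNge (ltW t0)/= mulr0 subr0; exact: is_derive_cst.
- apply: (@near_eq_is_derive _ _ _ (fun s : R => s^-1 ^+ k * expR (- s^-1) : R)) => //.
    near=> s; rewrite /flat; suff -> : 0 < s by [].
    by near: s; exact: lt_nbhsr.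
  rewrite /flat t0.
  have d1 : is_derive t 1 (fun s : R => s^-1) (- t ^- 2).
    apply: DeriveDef; first by apply: derivableV => //; rewrite gt_eqF.
    by rewrite deriveV ?gt_eqF// derive_id [_ *: _]mulr1.
  have d2 : is_derive t 1 (fun s : R => expR (- s^-1)) (t ^- 2 * expR (- t^-1)).
    have := @is_derive1_comp _ expR (fun s => - s^-1) t _ _ (is_derive_expR _) (is_deriveN d1).
    by rewrite opprK mulrC.
  rewrite (_ : (fun s : R => _) = ((fun s : R => s^-1) ^+ k) * (fun s : R => expR (- s^-1))); last first.
    by apply/funext => s; rewrite !fctE.
  apply: (is_derive_eq (is_deriveM (is_deriveX k d1) d2)); rewrite !fctE.
  rewrite -!exprVn !exprS.
  case: k => [|k]; first by rewrite !mul0r /GRing.scale/=; ring.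
  by rewrite /GRing.scale/= exprS; ring.
- rewrite /flat ltxx mulr0 subr0; apply: (@is_derive0_sqr _ (k.+2)`!%:R) => h.
  rewrite -/(flat k h) -/(flat k 0) [flat k 0]/flat ltxx.
  by rewrite subr0 ger0_norm ?flat_ge0// flat_le_sqr.
Unshelve. all: by end_near. Qed.

Lemma flat_le1 t : flat 0 t <= 1.
Proof.
rewrite /flat; case: ifPn => // t0.
by rewrite mul1r expR_le1 oppr_le0 invr_ge0 ltW.
Qed.

Lemma flat_gt0 t : (0 < flat 0 t) = (0 < t).
Proof. by rewrite /flat; case: ifPn => t0; rewrite ?ltxx// mul1r expR_gt0. Qed.

End flat.

Section test_algebra.
Context {R : realType} {n : nat}.
Local Notation V := 'rV[R]_n.

(** An algebra of functions that is visibly stable under partial derivatives; its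
    members are therefore smooth. *)
Inductive flat_algebra : (V -> R) -> Prop :=
| flat_algebra_cst c : flat_algebra (fun=> c)
| flat_algebra_coord k i a s : flat_algebra (fun x => flat k (a + s * x ord0 i))
| flat_algebraD f g : flat_algebra f -> flat_algebra g -> flat_algebra (f \+ g)
| flat_algebraM f g : flat_algebra f -> flat_algebra g -> flat_algebra (f \* g).

Lemma is_diff_flat_coord k i (a s : R) (x : V) :
  differentiable (fun x : V => flat k (a + s * x ord0 i)) x /\
  forall v, 'D_v (fun x : V => flat k (a + s * x ord0 i)) x =
    s * v ord0 i * (flat k.+2 (a + s * x ord0 i) - k%:R * flat k.+1 (a + s * x ord0 i)).
Proof.
have dL : differentiable (fun x : V => a + s * x ord0 i) x.
  apply: differentiableD => //; apply: differentiableZ; exact: differentiable_coord.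
have dd : differentiable (fun x : V => flat k (a + s * x ord0 i)) x.
  apply: (differentiable_comp (f := fun x : V => a + s * x ord0 i) (g := flat k)) => //.
  by apply/derivable1_diffP; apply: ex_derive; exact: is_derive_flat.
split=> // v; set c := a + s * x ord0 i; set w := s * v ord0 i.
transitivity ('D_1 (fun t : R => flat k (c + t * w)) 0).
  rewrite /derive; set F := (X in X @ _); set G := (X in _ = lim (X @ _)).
  suff -> : F = G by [].
  apply/funext => t; rewrite /F /G /=.
  rewrite !mxE addr0 [t *: 1]mulr1 mul0r addr0; congr (_ *: (flat k _ - _)).
  by rewrite /c /w; ring.
have d1 : is_derive (0 : R) (1 : R) (fun t : R => c + t * w) w.
  have := is_deriveD (is_derive_cst c (0 : R) (1 : R))
    (is_deriveM (is_derive_id (0 : R) (1 : R)) (is_derive_cst w (0 : R) (1 : R))).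
  by rewrite add0r scaler0 add0r [_ *: 1]mulr1.
have d2 : is_derive (c + 0 * w) (1 : R) (flat k) (flat k.+2 c - k%:R * flat k.+1 c).
  by rewrite mul0r addr0; exact: is_derive_flat.
by have := @is_derive1_comp _ (flat k) (fun t => c + t * w) 0 _ _ d2 d1; rewrite mulrC => -[].
Qed.

Lemma flat_algebra_diff (f : V -> R) : flat_algebra f ->
  (forall x, differentiable f x) /\ forall i, flat_algebra (partial i f).
Proof.
elim=> {f} [c|k i a s|f g _ [df pf] _ [dg pg]|f g af [df pf] ag [dg pg]].
- split=> // i; rewrite (_ : partial i _ = fun=> 0); first exact: flat_algebra_cst.
  by apply/funext => x; rewrite /partial derive_cst.
- split=> [x|j]; first by case: (is_diff_flat_coord k i a s x).
  rewrite (_ : partial j _ = (fun=> s * (j == i)%:R) \*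
     ((fun x => flat k.+2 (a + s * x ord0 i)) \+ ((fun=> - k%:R) \*
       (fun x => flat k.+1 (a + s * x ord0 i))))).
    apply: flat_algebraM; first exact: flat_algebra_cst.
    apply: flat_algebraD; first exact: flat_algebra_coord.
    apply: flat_algebraM; first exact: flat_algebra_cst.
    exact: flat_algebra_coord.
  apply/funext => x; rewrite /partial (is_diff_flat_coord k i a s x).2 /=.
  by rewrite mxE eqxx/= mulNr (eq_sym i).
- split=> [x|i]; first exact: differentiableD.
  rewrite (_ : partial i _ = partial i f \+ partial i g); first exact: flat_algebraD.
  by apply/funext => x; rewrite /partial deriveD//; exact: diff_derivable.
- split=> [x|i]; first exact: differentiableM.
  rewrite (_ : partial i _ = (f \* partial i g) \+ (g \* partial i f)).
    by apply: flat_algebraD; apply: flat_algebraM.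
  by apply/funext => x; rewrite /partial deriveM//; exact: diff_derivable.
Qed.

Lemma flat_algebra_smooth (f : V -> R) : flat_algebra f -> smooth f.
Proof.
move=> af l; have : flat_algebra (foldr partial f l).
  elim: l => //= i l IH; exact: (flat_algebra_diff IH).2.
by move/flat_algebra_diff => [].
Qed.

Lemma flat_algebra_prod m (F : 'I_m -> V -> R) : (forall i, flat_algebra (F i)) ->
  flat_algebra (fun x => \prod_(i < m) F i x).
Proof.
elim: m F => [|m IH] F aF.
  under eq_fun do rewrite big_ord0; exact: flat_algebra_cst.
under eq_fun do rewrite big_ord_recl.
exact: (flat_algebraM (aF _) (IH _ (fun i => aF _))).
Qed.

Lemma flat_algebraX f m : flat_algebra f -> flat_algebra (fun x => f x ^+ m).
Proof.
move=> af; elim: m => [|m IH]; first exact: flat_algebra_cst.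
under eq_fun do rewrite exprS; exact: flat_algebraM.
Qed.

Definition open_box (a b : V) : set V :=
  [set x | forall i, a ord0 i < x ord0 i < b ord0 i].

(** The factors 1 * and -1 * put the product in the form required by
    flat_algebra_coord. *)
Definition bump (a b x : V) : R :=
  \prod_(i < n) (flat 0 (- a ord0 i + 1 * x ord0 i) * flat 0 (b ord0 i + -1 * x ord0 i)).

Lemma bump_ge0 a b x : 0 <= bump a b x.
Proof. by apply: prodr_ge0 => i _; rewrite mulr_ge0// flat_ge0. Qed.

Lemma bump_le1 a b x : bump a b x <= 1.
Proof.
suff /andP[] : 0 <= bump a b x <= 1 by [].
rewrite /bump; apply: (big_ind (fun y => 0 <= y <= 1)) => [|y z /andP[? ?] /andP[? ?]|i _].
- by rewrite ler01 lexx.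
- by rewrite mulr_ge0// mulr_ile1.
- by rewrite mulr_ge0 ?flat_ge0//= mulr_ile1 ?flat_ge0 ?flat_le1.
Qed.

Lemma bump_gt0 a b x : 0 < bump a b x <-> open_box a b x.
Proof.
have E i : (0 < flat 0 (- a ord0 i + 1 * x ord0 i) * flat 0 (b ord0 i + -1 * x ord0 i)) =
   (a ord0 i < x ord0 i < b ord0 i).
  rewrite -(subr_gt0 (a _ _)) -(subr_gt0 (x _ _)) mul1r mulN1r (addrC (- _)).
  rewrite -(flat_gt0 (x _ _ - _)) -(flat_gt0 (b _ _ - _)).
  by rewrite !lt_def !mulr_ge0 ?flat_ge0// !andbT mulf_eq0 negb_or.
split => [|h]; last by apply: prodr_gt0 => i _; rewrite E; exact: h.
move=> + i; rewrite -E /bump lt_def (bigD1 i)//= mulf_eq0 negb_or.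
by move=> /andP[/andP[h _] _]; rewrite lt_def h mulr_ge0 ?flat_ge0.
Qed.

Lemma bump_out a b x : ~ open_box a b x -> bump a b x = 0.
Proof.
by move=> h; apply/eqP; rewrite eq_le bump_ge0 andbT leNgt; apply/negP => /bump_gt0.
Qed.

(** As m grows, 1 - (1 - bump)^m increases to the indicator of the open box where
    the bump is positive. *)
Definition plateau (a b : V) (m : nat) (x : V) : R := 1 - (1 - bump a b x) ^+ m.

Lemma plateau_out a b m x : ~ open_box a b x -> plateau a b m x = 0.
Proof. by move=> /bump_out h; rewrite /plateau h subr0 expr1n subrr. Qed.

Lemma plateau_itv a b m x : 0 <= plateau a b m x <= 1.
Proof.
have h0 := bump_ge0 a b x; have h1 := bump_le1 a b x.
rewrite /plateau subr_ge0 exprn_ile1 ?subr_ge0//=; last by rewrite gerBl.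
by rewrite gerBl exprn_ge0// subr_ge0.
Qed.

Lemma test_plateau a b m : test_function (plateau a b m).
Proof.
split.
  apply: flat_algebra_smooth.
  rewrite (_ : plateau a b m = (fun=> 1) \+ (fun=> -1) \*
     (fun x => ((fun=> 1) \+ (fun=> -1) \* bump a b) x ^+ m)); last first.
    by apply/funext => x; rewrite /= /plateau !mulN1r.
  apply: flat_algebraD; first exact: flat_algebra_cst.
  apply: flat_algebraM; first exact: flat_algebra_cst.
  apply: flat_algebraX; apply: flat_algebraD; first exact: flat_algebra_cst.
  apply: flat_algebraM; first exact: flat_algebra_cst.
  by apply: flat_algebra_prod => i; apply: flat_algebraM; exact: flat_algebra_coord.
have cb : closed (box a b).
  by apply: compact_closed => //; exact: compact_box.
apply: (subclosed_compact _ (compact_box (a := a) (b := b))); first exact: closed_closure.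
rewrite closureE; apply: smallest_sub => // x /= xn i.
have : open_box a b x.
  by apply: contrapT => /(plateau_out m) h; rewrite h eqxx in xn.
by move=> /(_ i) /andP[/ltW h1 /ltW h2]; rewrite in_itv/= h1.
Qed.

Lemma plateau_cvg a b x : plateau a b ^~ x @ \oo --> (\1_(open_box a b) x : R).
Proof.
rewrite indicE; have [xb|xb] := boolP (x \in open_box a b); last first.
  rewrite notin_setE in xb.
  under eq_fun do rewrite plateau_out//.
  exact: cvg_cst.
rewrite inE in xb; rewrite /plateau.
rewrite -[X in _ --> X]subr0; apply: cvgB; first exact: cvg_cst.
apply: cvg_expr; move/bump_gt0 : xb => x0.
by rewrite ger0_norm ?subr_ge0 ?bump_le1// gtrBl.
Qed.

End test_algebra.

Section density_measure.
Context d (T : measurableType d) {R : realType} (mu : {measure set T -> \bar R}).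
Variables (g : T -> \bar R) (mg : measurable_fun setT g) (g0 : forall x, (0 <= g x)%E).

(** The local definition makes the measurability and the sign of g parameters of
    the set function, as its measure structure needs them. *)
Definition density_measure (A : set T) : \bar R :=
  let _ := (mg, g0) in (\int[mu]_(x in A) g x)%E.

Let density0 : density_measure set0 = 0%E.
Proof. exact: integral_set0. Qed.

Let density_ge0 A : (0 <= density_measure A)%E.
Proof. by apply: integral_ge0 => x _; exact: g0. Qed.

Let density_sigma_additive : semi_sigma_additive density_measure.
Proof. exact: semi_sigma_additive_nng_induced. Qed.

HB.instance Definition _ := isMeasure.Build _ _ _ density_measure
  density0 density_ge0 density_sigma_additive.

End density_measure.

Section fundamental_lemma.
Context {R : realType} {n : nat}.
Local Notation V := 'rV[R]_n.
Local Notation mu := (@lebesgue_rV R n).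

Lemma test_function_continuous (psi : V -> R) : test_function psi -> continuous psi.
Proof. by move=> [sm _] x; apply: differentiable_continuous; exact: (sm [::]). Qed.

Lemma test_function_measurable (psi : V -> R) : test_function psi -> measurable_fun setT psi.
Proof. by move=> /test_function_continuous/continuous_measurable_rV. Qed.

Lemma measurable_open_box (a b : V) : measurable (open_box a b).
Proof.
rewrite (_ : open_box a b = [set x : V | forall i, `]a ord0 i, b ord0 i[%classic (x ord0 i)]).
  by apply: (measurable_coord_prod (A := fun i => `]a ord0 i, b ord0 i[%classic)).
by apply/seteqP; split => x h i; have := h i; rewrite /= in_itv/=.
Qed.

Lemma measurable_fun_boxes (g : V -> R) :
  (forall a b, mu.-integrable (box a b) (EFin \o g)) -> measurable_fun setT g.
Proof.
move=> gi; rewrite -(@box_cover R n); apply/measurable_fun_bigcup => k.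
  exact: measurable_box.
by apply/measurable_EFinP; exact: measurable_int (gi _ _).
Qed.

Variable g : V -> R.
Hypothesis gi : forall a b, mu.-integrable (box a b) (EFin \o g).
Hypothesis g_test : forall psi, test_function psi -> (\int[mu]_x (g x * psi x)%:E = 0)%E.

Let mg : measurable_fun setT g.
Proof. exact: measurable_fun_boxes. Qed.

Let integral_open_box (a b : V) : (\int[mu]_(x in box a b) (g x * \1_(open_box a b) x)%:E = 0)%E.
Proof.
have [] := @real_dominated_convergence _ _ _ mu (box a b)
  (fun m x => g x * plateau a b m x) (fun x => g x * \1_(open_box a b) x) (Num.norm \o g).
- exact: measurable_box.
- move=> m; apply: measurable_funM; first exact: measurable_funTS.
  by apply: measurable_funTS; apply: test_function_measurable; exact: test_plateau.
- apply: measurable_funM; first exact: measurable_funTS.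
  by apply: measurable_funTS; apply: measurable_indic; exact: measurable_open_box.
- by apply: aeW => x _; apply: cvgM; [exact: cvg_cst|exact: plateau_cvg].
- exact: integrable_abse (gi a b).
- apply: aeW => x m _ /=; rewrite normrM ler_piMr//.
  by have /andP[p0 p1] := plateau_itv a b m x; rewrite ger0_norm.
move=> _; set u := (X in X @ \oo --> _ -> _) => h.
have u0 : u = cst 0%E.
  apply/funext => m; rewrite /u /= -(g_test (test_plateau a b m)).
  rewrite integral_mkcond; apply: eq_integral => x _; rewrite patchE.
  case: ifPn => // /negP; rewrite inE => xab.
  rewrite plateau_out ?mulr0// => xo; apply: xab => i; rewrite in_itv/=.
  by have /andP[/ltW -> /ltW ->] := xo i.
have := h; rewrite u0 => /(cvg_unique _ (cvg_cst _)) <- //.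
Qed.

Let enlarge (a : V) (c : R) : V := a + const_mx c.

Let indic_enlarge_cvg (a b x : V) :
  (fun k => \1_(open_box (enlarge a (- k.+1%:R^-1)) (enlarge b k.+1%:R^-1)) x : R) @ \oo
    --> (\1_(box a b) x : R).
Proof.
apply: cvg_near_cst; rewrite indicE; have [xb|xb] := boolP (x \in box a b).
  near=> k; rewrite indicE mem_set//= => i; rewrite !mxE.
  move: xb; rewrite inE => /(_ i); rewrite in_itv/= => /andP[ax xb].
  by rewrite ltrBlDr (le_lt_trans ax) ?ltrDl//= (le_lt_trans xb) ?ltrDl.
rewrite notin_setE in xb.
have [i] : exists i, ~ (x ord0 i \in `[a ord0 i, b ord0 i]) by exact/existsNP.
rewrite in_itv/= => /negP; rewrite negb_and -!ltNge => xab.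
move: xab => /orP[xa|bx].
  have e0 : 0 < a ord0 i - x ord0 i by rewrite subr_gt0.
  near=> k; rewrite indicE memNset//= => /(_ i); rewrite !mxE.
  apply/negP; rewrite negb_and -!leNgt; apply/orP; left.
  rewrite lerBrDl -lerBrDr; apply/ltW; near: k.
  exact: (near_infty_natSinv_lt (PosNum e0)).
have e0 : 0 < x ord0 i - b ord0 i by rewrite subr_gt0.
near=> k; rewrite indicE memNset//= => /(_ i); rewrite !mxE.
apply/negP; rewrite negb_and -!leNgt; apply/orP; right.
rewrite -lerBrDl; apply/ltW; near: k.
exact: (near_infty_natSinv_lt (PosNum e0)).
Unshelve. all: by end_near. Qed.

Let integral_box (a b : V) : (\int[mu]_(x in box a b) (g x)%:E = 0)%E.
Proof.
pose D := box (enlarge a (-1)) (enlarge b 1).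
pose A k := open_box (enlarge a (- k.+1%:R^-1)) (enlarge b k.+1%:R^-1).
have AD k : A k `<=` D.
  move=> x Ax i; have := Ax i; rewrite !mxE in_itv/= => /andP[/ltW h1 /ltW h2].
  have k1 : k.+1%:R^-1 <= 1 :> R by rewrite invf_le1// ler1n.
  rewrite (le_trans _ h1) ?lerD2l ?lerN2//= (le_trans h2)// ?lerD2l//.
have bD : box a b `<=` D.
  move=> x xb i; have := xb i; rewrite !mxE !in_itv/= => /andP[h1 h2].
  by rewrite lerBlDr (le_trans h1) ?lerDl//= (le_trans h2) ?lerDl.
have [] := @real_dominated_convergence _ _ _ mu D
  (fun k x => g x * \1_(A k) x) (fun x => g x * \1_(box a b) x) (Num.norm \o g).
- exact: measurable_box.
- move=> m; apply: measurable_funM; first exact: measurable_funTS.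
  by apply: measurable_funTS; apply: measurable_indic; exact: measurable_open_box.
- apply: measurable_funM; first exact: measurable_funTS.
  by apply: measurable_funTS; apply: measurable_indic; exact: measurable_box.
- by apply: aeW => x _; apply: cvgM; [exact: cvg_cst|exact: indic_enlarge_cvg].
- exact: integrable_abse (gi _ _).
- apply: aeW => x m _ /=; rewrite normrM ler_piMr//.
  by rewrite indicE; case: (_ \in _); rewrite ?normr1 ?normr0.
move=> _; set u := (X in X @ \oo --> _ -> _) => h.
have u0 : u = cst 0%E.
  apply/funext => k; rewrite /u /= -(integral_open_box (enlarge a (- k.+1%:R^-1)) (enlarge b k.+1%:R^-1)).
  rewrite integral_mkcond [RHS]integral_mkcond; apply: eq_integral => x _; rewrite !patchE -/(A k).
  have [xA|xA] := pselect (A k x).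
    rewrite !mem_set//; last exact: AD.
    by move=> i; have /andP[/ltW h1 /ltW h2] := xA i; rewrite in_itv/= h1.
  have -> : \1_(A k) x = 0 :> R by rewrite indicE memNset.
  by rewrite mulr0; do 2 case: ifP.
have {h} h : (\int[mu]_(x in D) (g x * \1_(box a b) x)%:E = 0)%E.
  by move: h; rewrite u0 => /(cvg_unique _ (cvg_cst _)) <-.
rewrite -h integral_mkcond [RHS]integral_mkcond.
apply: eq_integral => x _; rewrite !patchE.
have [xA|xA] := pselect (box a b x).
  by rewrite !mem_set//; [rewrite indicE mem_set// mulr1|exact: bD].
have -> : \1_(box a b) x = 0 :> R by rewrite indicE memNset.
by rewrite (memNset xA) mulr0; case: ifP.
Qed.

(** Plateau functions show that g has integral 0 over every open box, and enlarged
    open boxes shrink to closed ones. Hence the measures with densities g^+ and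
    g^- agree on boxes. *)
Lemma fundamental_lemma : {ae mu, forall x, g x = 0}.
Proof.
have mgp : measurable_fun setT ((EFin \o g)^\+)%E by apply/measurable_funepos/measurable_EFinP.
have mgn : measurable_fun setT ((EFin \o g)^\-)%E by apply/measurable_funeneg/measurable_EFinP.
pose m1 := density_measure mu mgp (funepos_ge0 _).
pose m2 := density_measure mu mgn (funeneg_ge0 _).
have m12 : forall A, measurable A -> m1 A = m2 A.
  apply: (@box_measure_unique R n m1 m2) => a b.
    have := integral_box a b; rewrite integralE.
    have h1 := integrable_fin_num (measurable_box a b) (integrable_funepos (measurable_box a b) (gi a b)).
    have h2 := integrable_fin_num (measurable_box a b) (integrable_funeneg (measurable_box a b) (gi a b)).
    by move=> /eqP; rewrite sube_eq ?add0e => [/eqP|//|]; rewrite ?fin_num_adde_defl.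
  by apply: integrable_lty; [exact: measurable_box|apply: integrable_funepos => //; exact: measurable_box].
have gk k : {ae mu, forall x, box (const_mx (- k%:R)) (const_mx k%:R) x -> g x = 0}.
  have := @integral_ae_eq _ _ _ mu (box (const_mx (- k%:R)) (const_mx k%:R)) (measurable_box _ _)
    (cst 0%E) (EFin \o g) (gi _ _) (measurable_cst _).
  have H : forall E, E `<=` box (const_mx (- k%:R)) (const_mx k%:R) -> measurable E ->
      (\int[mu]_(x in E) (EFin \o g) x = \int[mu]_(x in E) cst 0 x)%E.
    move=> E EB mE; rewrite integral0 integralE -[X in (X - _)%E]/(m1 E) m12// subee//.
    apply: integrable_fin_num => //; apply: integrable_funeneg => //.
    by apply: (integrableS (measurable_box (const_mx (- k%:R)) (const_mx k%:R))).
  by move=> /(_ H); apply: filterS => x + xB => /(_ xB) [].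
have := (ae_foralln gk); apply: filterS => x h.
have : [set: V] x by []. rewrite -(@box_cover R n) => -[k _ xk]; exact: h xk.
Qed.

End fundamental_lemma.

(** * Integration: comparison almost everywhere, generalized dominated convergence, Fubini *)

Section cvg_real.
Context {R : realType}.
Implicit Types (a b e : nat -> R) (l : R).

Lemma cvg_of_dist a e l : (forall m, `|a m - l| <= e m) -> e @ \oo --> 0 -> a @ \oo --> l.
Proof.
move=> ae e0; apply/cvgrPdist_le => eps eps0.
move/cvgrPdist_le : e0 => /(_ _ eps0); apply: filterS => m.
rewrite sub0r normrN distrC => h; rewrite (le_trans (ae m))//.
exact: le_trans (ler_norm _) h.
Qed.

Lemma cvg_maxr a b (l l' : R) : a @ \oo --> l -> b @ \oo --> l' ->
  (fun m => Num.max (a m) (b m)) @ \oo --> Num.max l l'.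
Proof.
move=> al bl; rewrite maxr_absE; under eq_fun do rewrite maxr_absE.
by apply: cvgM; [|exact: cvg_cst]; apply: cvgD; [exact: cvgD|apply: cvg_norm; exact: cvgB].
Qed.

Lemma cvg_minr a b (l l' : R) : a @ \oo --> l -> b @ \oo --> l' ->
  (fun m => Num.min (a m) (b m)) @ \oo --> Num.min l l'.
Proof.
move=> al bl; rewrite minr_absE; under eq_fun do rewrite minr_absE.
by apply: cvgM; [|exact: cvg_cst]; apply: cvgB; [exact: cvgD|apply: cvg_norm; exact: cvgB].
Qed.

(** Clamping f to [-g, g] moves it by at most the excess of the bound G over g;
    the last summand corrects for the case G < g. *)
Lemma clamp_dist (f g G : R) : 0 <= g -> `|f| <= G ->
  `|f - Num.max (- g) (Num.min f g)| <= G - g + Num.max 0 (g - G).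
Proof.
move=> g0; rewrite ler_norml => /andP[f1 f2].
have [h1|h1] := lerP f g; have [h3|h3] := lerP 0 (g - G).
- by have [h2|h2] := lerP (- g) f; rewrite ler_norml; apply/andP; split; lra.
- by have [h2|h2] := lerP (- g) f; rewrite ler_norml; apply/andP; split; lra.
- by have [h2|h2] := lerP (- g) g; rewrite ler_norml; apply/andP; split; lra.
- by have [h2|h2] := lerP (- g) g; rewrite ler_norml; apply/andP; split; lra.
Qed.

End cvg_real.

Section ae_monotone.
Context d (T : measurableType d) {R : realType} (mu : {measure set T -> \bar R}).
Variables (D : set T) (mD : measurable D).

Lemma ae_le_integrable (f g : T -> R) : measurable_fun D f ->
  mu.-integrable D (EFin \o g) -> {ae mu, forall x, D x -> `|f x| <= g x} ->
  mu.-integrable D (EFin \o f).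
Proof.
move=> mf ig fg; apply/integrableP; split; first exact/measurable_EFinP.
have /integrableP[mg] := integrable_abse ig.
apply: le_lt_trans; rewrite -[X in (X <= _)%E]/(\int[mu]_(x in D) `|(f x)%:E|)%E.
apply: ae_ge0_le_integral => //.
- by apply/measurable_EFinP; apply: measurableT_comp.
- exact: measurableT_comp mg.
- by apply: filterS fg => x h Dx /=; rewrite lee_fin normr_id (le_trans (h Dx))// ler_norm.
Qed.

Lemma ae_integral_ge0 (f : T -> R) : measurable_fun D f ->
  {ae mu, forall x, D x -> 0 <= f x} -> (0 <= \int[mu]_(x in D) (f x)%:E)%E.
Proof.
move=> mf f0; have -> : (\int[mu]_(x in D) (f x)%:E = \int[mu]_(x in D) `|f x|%:E)%E.
  apply: ae_eq_integral => //; first exact/measurable_EFinP.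
    by apply/measurable_EFinP; exact: measurableT_comp.
  by apply: filterS f0 => x h Dx; rewrite ger0_norm ?h.
by apply: integral_ge0 => x _; rewrite lee_fin.
Qed.

Lemma ae_le_Rintegral (f g : T -> R) : mu.-integrable D (EFin \o f) ->
  mu.-integrable D (EFin \o g) -> {ae mu, forall x, D x -> f x <= g x} ->
  (\int[mu]_(x in D) f x <= \int[mu]_(x in D) g x)%R.
Proof.
move=> fi gi fg; rewrite -subr_ge0 -RintegralB// fine_ge0//.
apply: ae_integral_ge0; last by apply: filterS fg => x h Dx; rewrite subr_ge0 h.
apply: measurable_funB; apply/measurable_EFinP; [exact: measurable_int gi|exact: measurable_int fi].
Qed.

End ae_monotone.

Section generalized_dominated_convergence.
Context d (T : measurableType d) {R : realType} (mu : {measure set T -> \bar R}).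

(** Dominated convergence with a convergent sequence of bounds. The functions f_m
    clamped to [-g, g] are dominated by g, and the clamping error is at most g_m -
    g plus the positive part of g - g_m, which is itself dominated by g; the
    integral of g_m - g is controlled by c_m. *)
Lemma generalized_dominated_convergence (f_ g_ : nat -> T -> R) (f g : T -> R) (c : nat -> R) :
  (forall m, measurable_fun setT (f_ m)) -> measurable_fun setT f ->
  (forall m, mu.-integrable setT (EFin \o g_ m)) -> mu.-integrable setT (EFin \o g) ->
  {ae mu, forall x m, `|f_ m x| <= g_ m x} ->
  {ae mu, forall x, f_ ^~ x @ \oo --> f x} ->
  {ae mu, forall x, g_ ^~ x @ \oo --> g x} ->
  (forall m, (\int[mu]_x g_ m x)%R <= (\int[mu]_x g x)%R + c m) -> c @ \oo --> 0 ->
  (fun m => \int[mu]_x f_ m x)%R @ \oo --> (\int[mu]_x f x)%R.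
Proof.
move=> mf_ mf ig_ ig fg cf cg gc c0.
have g0 : {ae mu, forall x, 0 <= g x}.
  apply: filterS2 fg cg => x fgx cgx.
  rewrite -(cvg_lim (@Rhausdorff R) cgx); apply: limr_ge; first by apply/cvg_ex; exists (g x).
  by apply: nearW => m; exact: le_trans (fgx m).
have if_ m : mu.-integrable setT (EFin \o f_ m).
  by apply: ae_le_integrable (ig_ m) _ => //; apply: filterS fg => x h _; exact: h.
(* f_m clamped to [-g, g] *)
pose h_ m x := Num.max (- g x) (Num.min (f_ m x) (g x)).
have mg : measurable_fun setT g by apply/measurable_EFinP; exact: measurable_int ig.
have mg_ m : measurable_fun setT (g_ m) by apply/measurable_EFinP; exact: measurable_int (ig_ m).
have mh_ m : measurable_fun setT (h_ m).
  by apply: measurable_maxr; [exact: measurableT_comp|exact: measurable_minr].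
have hg : {ae mu, forall x m, `|h_ m x| <= g x}.
  apply: filterS g0 => x gx m; rewrite ler_norml /h_ le_max lexx/= ge_max.
  by rewrite ge_min lexx orbT andbT; lra.
have ih_ m : mu.-integrable setT (EFin \o h_ m).
  by apply: ae_le_integrable ig _ => //; apply: filterS hg => x h _; exact: h.
have fle : {ae mu, forall x, `|f x| <= g x}.
  apply: filterS3 cf fg cg => x cfx fgx cgx.
  apply: (ler_cvg_to (cvg_norm cfx) cgx).
  by apply: nearW => m; exact: fgx.
have ch : {ae mu, forall x, h_ ^~ x @ \oo --> f x}.
  apply: filterS3 cf fle g0 => x cfx fgx gx.
  have -> : f x = Num.max (- g x) (Num.min (f x) (g x)).
    by move: fgx; rewrite ler_norml => /andP[h1 h2]; rewrite (min_idPl h2) (max_idPr h1).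
  by apply: cvg_maxr; [exact: cvg_cst|apply: cvg_minr => //; exact: cvg_cst].
have [intf lim1] := @real_dominated_convergence _ _ _ mu setT h_ f g measurableT
  mh_ mf (filterS (fun x h _ => h) ch) ig (filterS (fun x h m _ => h m) hg).
(* the amount by which the bound g_m may fall below g *)
pose k_ m x := Num.max 0 (g x - g_ m x).
have mk_ m : measurable_fun setT (k_ m).
  by apply: measurable_maxr => //; exact: measurable_funB.
have kg : {ae mu, forall x m, `|k_ m x| <= g x}.
  apply: filterS2 fg g0 => x fgx gx m.
  rewrite ger0_norm ?le_max ?lexx// ge_max gx/= gerBl.
  exact: le_trans (fgx m).
have ik_ m : mu.-integrable setT (EFin \o k_ m).
  by apply: ae_le_integrable ig _ => //; apply: filterS kg => x h _; exact: h.
have ck : {ae mu, forall x, k_ ^~ x @ \oo --> (cst 0 x : R)}.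
  apply: filterS cg => x cgx.
  have -> : cst 0 x = Num.max 0 (g x - g x) :> R by rewrite subrr maxxx.
  by apply: cvg_maxr; [exact: cvg_cst|apply: cvgB => //; exact: cvg_cst].
have [_ lim2] := @real_dominated_convergence _ _ _ mu setT k_ (cst 0) g measurableT
  mk_ (measurable_cst _) (filterS (fun x h _ => h) ck) ig (filterS (fun x h m _ => h m) kg).
have lim1' : (fun m => \int[mu]_x h_ m x)%R @ \oo --> (\int[mu]_x f x)%R.
  by move: lim1; rewrite -(fineK (integrable_fin_num measurableT intf)) => /fine_cvg.
have lim2' : (fun m => \int[mu]_x k_ m x)%R @ \oo --> (0 : R).
  by move: lim2; rewrite integral0_eq// => /fine_cvg.
have dfh m : (\int[mu]_x `|f_ m x - h_ m x|)%R <= c m + (\int[mu]_x k_ m x)%R.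
  have i1 : mu.-integrable setT (EFin \o (fun x => g_ m x - g x + k_ m x)).
    exact: (integrableD measurableT (integrableB measurableT (ig_ m) ig) (ik_ m)).
  have -> : c m + (\int[mu]_x k_ m x)%R =
      (\int[mu]_x g x)%R + c m - (\int[mu]_x g x)%R + (\int[mu]_x k_ m x)%R by ring.
  apply: (@le_trans _ _ (\int[mu]_x (g_ m x - g x + k_ m x))%R); last first.
    rewrite RintegralD//; last exact: (integrableB measurableT (ig_ m) ig).
    by rewrite RintegralB// lerD2r lerD2r.
  apply: ae_le_Rintegral => //.
    exact: (integrable_abse (integrableB measurableT (if_ m) (ih_ m))).
  apply: filterS2 fg g0 => x fgx gx _; rewrite /h_ /k_.
  exact: clamp_dist.
apply: (@cvg_of_dist _ _ (fun m => (`|(\int[mu]_x h_ m x)%R - (\int[mu]_x f x)%R| + (c m + (\int[mu]_x k_ m x)%R)))).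
  move=> m; rewrite (le_trans _ (lerD (lexx _) (dfh m)))//.
  have -> : (\int[mu]_x f_ m x)%R - (\int[mu]_x f x)%R =
    ((\int[mu]_x h_ m x)%R - (\int[mu]_x f x)%R) + ((\int[mu]_x f_ m x)%R - (\int[mu]_x h_ m x)%R) by ring.
  rewrite (le_trans (ler_normD _ _))// lerD2l -RintegralB//.
  by apply: le_normr_Rintegral => //; exact: (integrableB measurableT (if_ m) (ih_ m)).
rewrite -[X in _ --> X]addr0; apply: cvgD.
  have -> : 0 = `|(\int[mu]_x f x)%R - (\int[mu]_x f x)%R| :> R by rewrite subrr normr0.
  by apply: cvg_norm; apply: cvgB => //; exact: cvg_cst.
by rewrite -[X in _ --> X]addr0; exact: cvgD.
Qed.

End generalized_dominated_convergence.

Section fubini_extra.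
Context d1 d2 (T1 : measurableType d1) (T2 : measurableType d2) {R : realType}.
Variables (m1 : {sigma_finite_measure set T1 -> \bar R}) (m2 : {sigma_finite_measure set T2 -> \bar R}).

Lemma measurable_fun_integral2 (f : T1 * T2 -> \bar R) : measurable_fun setT f ->
  measurable_fun setT (fun x => \int[m2]_y f (x, y))%E.
Proof.
move=> mf; under eq_fun do rewrite integralE.
apply: emeasurable_funB.
  rewrite (_ : (fun _ => _) = fubini_F m2 (f^\+)%E); last first.
    by apply/funext => x; apply: eq_integral => y _; rewrite !funeposE.
  by apply: measurable_fun_fubini_tonelli_F => //; exact: measurable_funepos.
rewrite (_ : (fun _ => _) = fubini_F m2 (f^\-)%E); last first.
  by apply/funext => x; apply: eq_integral => y _; rewrite !funenegE.
by apply: measurable_fun_fubini_tonelli_F => //; exact: measurable_funeneg.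
Qed.

Lemma integrable_prod_bound (a : T1 -> R) (b : T2 -> R) (f : T1 * T2 -> R) :
  measurable_fun setT f -> m1.-integrable setT (EFin \o a) -> m2.-integrable setT (EFin \o b) ->
  (forall x y, `|f (x, y)| <= a x * b y) -> (forall y, 0 <= b y) ->
  (m1 \x m2)%E.-integrable setT (EFin \o f).
Proof.
move=> mf ia ib fab b0; apply/integrable12ltyP; first exact/measurable_EFinP.
have mb : measurable_fun setT (EFin \o b) := measurable_int _ ib.
have ma : measurable_fun setT (EFin \o a) := measurable_int _ ia.
apply: (@le_lt_trans _ _ (\int[m1]_x (`|(a x)%:E| * \int[m2]_y (b y)%:E))%E).
  apply: ge0_le_integral => //=.
  - by move=> x _; apply: integral_ge0.
  - apply: (@measurable_fun_fubini_tonelli_F _ _ T1 T2 R m2 (fun z => `|(f z)%:E|%E)) => //.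
    by apply: measurableT_comp => //; exact/measurable_EFinP.
  - by apply: emeasurable_funM => //; apply/measurable_EFinP; apply: measurableT_comp => //; apply/measurable_EFinP.
  move=> x _; rewrite -ge0_integralZl//; last by move=> y _; rewrite lee_fin.
  apply: ge0_le_integral => //.
  - apply/measurable_EFinP; apply: measurableT_comp => //.
    apply: (measurableT_comp mf); exact: measurable_pair1.
  - exact: emeasurable_funM.
  by move=> y _; rewrite -EFinM lee_fin (le_trans (fab x y))// ler_wpM2r// ler_norm.
have [_ fia] := integrableP _ _ _ ia; have [_ fib] := integrableP _ _ _ ib.
have Ib : (\int[m2]_y (b y)%:E < +oo)%E.
  by under eq_integral do rewrite -[b _]ger0_norm//; exact: fib.
have Ib0 : (0 <= \int[m2]_y (b y)%:E)%E by apply: integral_ge0 => y _; rewrite lee_fin.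
rewrite ge0_integralZr//; last exact: measurableT_comp.
by apply: lte_mul_pinfty => //; rewrite ?ge0_fin_numE//; apply: integral_ge0.
Qed.

End fubini_extra.

Section shift_R.
Context {R : realType}.
Local Notation leb := (@lebesgue_measure R).

Definition shift_R (t : R) : measurableTypeR R -> measurableTypeR R := fun r => r + t.

Lemma measurable_shift_R t : measurable_fun setT (shift_R t).
Proof. exact: measurable_funD. Qed.

HB.instance Definition _ t := isMeasurableFun.Build _ _ _ _ _ (measurable_shift_R t).

Lemma lebesgue_shift_R t A : measurable A -> pushforward leb (shift_R t) A = leb A.
Proof.
move=> mA; apply/esym; move: A mA.
apply: (@lebesgue_measure_unique R (pushforward leb (shift_R t))) => _ [[a b] _ <-] /=.
rewrite /pushforward /= [X in _ = leb X](_ : _ = `](a - t), (b - t)]%classic); last first.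
  by apply/seteqP; split => x /=; rewrite !in_itv/= /shift_R ltrBlDr lerBrDr.
rewrite !lebesgue_measure_itv/= !lte_fin ltrD2r.
by case: ifPn => // _; rewrite -!EFinD opprB addrA subrK.
Qed.

Lemma integral_shift_R (t h : R) (g : R -> \bar R) : measurable_fun setT g ->
  (\int[leb]_(r in `[0%R, h]) g (r + t)%R = \int[leb]_(r in `[t, (t + h)%R]) g r)%E.
Proof.
have ge0 (k : R -> \bar R) : measurable_fun setT k -> (forall x, 0 <= k x)%E ->
    (\int[leb]_(r in `[0%R, h]) k (r + t)%R = \int[leb]_(r in `[t, (t + h)%R]) k r)%E.
  move=> mk k0; transitivity (\int[pushforward leb (shift_R t)]_(r in `[t, (t + h)%R]) k r)%E.
    rewrite ge0_integral_pushforward//; last exact: measurable_funTS.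
    rewrite (_ : _ @^-1` _ = `[0%R, h]%classic)//.
    by apply/seteqP; split => r /=; rewrite !in_itv/= /shift_R lerDr addrC lerD2l.
  by apply: eq_measure_integral => A mA _; exact: lebesgue_shift_R.
move=> mg; rewrite integralE [RHS]integralE; congr (_ - _)%E.
  rewrite -ge0//; last exact/measurable_funepos.
  by apply: eq_integral => r _; rewrite !funeposE.
rewrite -ge0//; last exact/measurable_funeneg.
by apply: eq_integral => r _; rewrite !funenegE.
Qed.

End shift_R.

(** * Functions with integrable p-th power and test functions *)

Section powR_inequalities.
Context {R : realType}.
Implicit Types (x y p : R).

Lemma le1D_powR p x : 1 <= p -> 0 <= x -> x <= 1 + x `^ p.
Proof.
move=> p1 x0; have [x1|/ltW x1] := lerP x 1; first by rewrite (le_trans x1)// lerDl powR_ge0.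
by rewrite (le_trans (le1r_powR x1 p1))// lerDr.
Qed.

Lemma powRD_le p x y : 0 <= p -> 0 <= x -> 0 <= y ->
  (x + y) `^ p <= 2 `^ p * (x `^ p + y `^ p).
Proof.
move=> p0 x0 y0; wlog xy : x y x0 y0 / x <= y.
  move=> H; have [/H|/ltW/H] := lerP x y; first exact.
  by rewrite addrC [X in _ -> _ <= _ * X]addrC; apply.
apply: (@le_trans _ _ ((2 * y) `^ p)).
  by apply: ge0_ler_powR; rewrite ?nnegrE ?addr_ge0 ?mulr_ge0//; lra.
by rewrite powRM// ler_wpM2l ?powR_ge0// lerDr powR_ge0.
Qed.

End powR_inequalities.

Section Lp.
Context d (T : measurableType d) {R : realType} (mu : {measure set T -> \bar R}).
Variable p : R.
Hypothesis p1 : 1 <= p.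

(** Borel functions whose p-th power is integrable, free of the norm on the
    quotient space. *)
Definition Lp (g : T -> R) :=
  measurable_fun setT g /\ mu.-integrable setT (EFin \o (fun x => `|g x| `^ p)).

Lemma measurable_norm_powR (g : T -> R) : measurable_fun setT g ->
  measurable_fun setT (fun x => `|g x| `^ p).
Proof.
move=> mg; apply: (measurableT_comp (measurable_powR p)); exact: measurableT_comp.
Qed.

Lemma LfunP_Lp (g : T -> R) : g \in Lfun mu p%:E <-> Lp g.
Proof.
have p0 : p != 0 by rewrite gt_eqF// (lt_le_trans _ p1).
have E : (\int[mu]_x `|(`|g x| `^ p)%:E| = \int[mu]_x (`|(g x)%:E| `^ p))%E.
  by apply: eq_integral => x _; rewrite /= -poweR_EFin ger0_norm ?powR_ge0.
split.
  rewrite inE => /andP[/[!inE]/= mg]; rewrite /finite_norm unlock => fg; split=> //.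
  apply/integrableP; split; first by apply/measurable_EFinP; exact: measurable_norm_powR.
  by rewrite /= E; apply: (@lty_poweRy _ _ p^-1) => //; rewrite invr_eq0.
move=> [mg /integrableP[_ fg]]; rewrite inE; apply/andP; split; rewrite inE//=.
rewrite /finite_norm unlock; apply: poweR_lty; by rewrite -E.
Qed.

Lemma Lp_dominated (L : R) (a b w : T -> R) : 0 <= L -> measurable_fun setT w ->
  Lp a -> Lp b -> {ae mu, forall x, `|w x| <= L * (`|a x| + `|b x|)} -> Lp w.
Proof.
move=> L0 mw [ma ia] [mb ib] wab; split => //.
have i1 : mu.-integrable setT (EFin \o (fun x => (L `^ p * 2 `^ p) * (`|a x| `^ p + `|b x| `^ p))).
  exact: (integrableZl measurableT _ (integrableD measurableT ia ib)).
apply: ae_le_integrable i1 _ => //; first exact: measurable_norm_powR.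
have p0 : 0 <= p by rewrite (le_trans _ p1).
apply: filterS wab => x wx _; rewrite ger0_norm ?powR_ge0//.
apply: (@le_trans _ _ ((L * (`|a x| + `|b x|)) `^ p)).
  by apply: ge0_ler_powR; rewrite // nnegrE ?mulr_ge0 ?addr_ge0.
by rewrite powRM ?addr_ge0// -mulrA ler_wpM2l ?powR_ge0// powRD_le.
Qed.

Lemma Lp_integrable (D : set T) (g : T -> R) : measurable D -> (mu D < +oo)%E -> Lp g ->
  mu.-integrable D (EFin \o g).
Proof.
move=> mD Doo [mg ig].
have i1 : mu.-integrable D (EFin \o (fun x => 1 + `|g x| `^ p)).
  have ic : mu.-integrable D (EFin \o cst 1).
    apply/integrableP; split; first exact/measurable_EFinP.
    by rewrite /= normr1 integral_cst// mul1e.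
  exact: (integrableD mD ic (integrableS measurableT mD (@subsetT _ _) ig)).
apply: ae_le_integrable i1 _ => //; first exact: measurable_funTS.
by apply: aeW => x _; exact: le1D_powR.
Qed.

End Lp.

Section Lp_rV.
Context {R : realType} {n : nat}.
Local Notation V := 'rV[R]_n.
Local Notation mu := (@lebesgue_rV R n).
Variable p : R.
Hypothesis p1 : 1 <= p.
Implicit Types (g u G psi : V -> R) (x y : V).

Definition cube (r : R) : set V := box (const_mx (- r)) (const_mx r).

Lemma cubeP r x : cube r x <-> forall i, `|x ord0 i| <= r.
Proof.
split=> h i; have := h i; first by rewrite !mxE in_itv/= ler_norml.
by rewrite !mxE in_itv/= ler_norml.
Qed.

Lemma compact_lt_pinfty (K : set V) : compact K -> (mu K < +oo)%E.
Proof.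
move=> cK; have [r [r0 Kr]] := bounded_sub_box (compact_bounded cK).
apply: le_lt_trans (box_lt_pinfty (const_mx (- r)) (const_mx r)).
apply: le_measure; rewrite ?inE; [exact: compact_measurable_rV|exact: measurable_box|].
by move=> x Kx; apply/cubeP; exact: Kr.
Qed.

Lemma Lp_locally_integrable g : Lp mu p g -> locally_integrable_rV g.
Proof.
by move=> Lg K cK; apply: (Lp_integrable p1 _ _ Lg); [exact: compact_measurable_rV|exact: compact_lt_pinfty].
Qed.

Lemma locally_integrable_box g a b : locally_integrable_rV g -> mu.-integrable (box a b) (EFin \o g).
Proof. by apply; exact: compact_box. Qed.

Lemma locally_integrable_measurable g : locally_integrable_rV g -> measurable_fun setT g.
Proof. by move=> lg; apply: measurable_fun_boxes => a b; exact: locally_integrable_box. Qed.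

Lemma integrable_mul_cube g psi r M : locally_integrable_rV g -> measurable_fun setT psi ->
  (forall x, `|psi x| <= M) -> (forall x, ~ cube r x -> psi x = 0) ->
  mu.-integrable setT (EFin \o (fun x => g x * psi x)).
Proof.
move=> lg mpsi pM p0; have mg := locally_integrable_measurable lg.
have mc : measurable (cube r) by exact: measurable_box.
have M0 : 0 <= M by rewrite (le_trans _ (pM 0)).
suff : mu.-integrable setT (EFin \o (fun x => M * `|(g \_ (cube r)) x|)).
  move=> /ae_le_integrable; apply => //; first exact: measurable_funM.
  apply: aeW => x _; rewrite patchE; case: ifPn => xc.
    by rewrite normrM mulrC ler_wpM2r.
  rewrite p0; last by move/negP: xc; rewrite inE.
  by rewrite mulr0 normr0 mulr_ge0.
have ir : mu.-integrable setT (EFin \o (g \_ (cube r))).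
  have := (integrable_mkcond (EFin \o g) mc).1 (locally_integrable_box _ _ lg).
  by rewrite restrict_EFin.
exact: (integrableZl measurableT M (integrable_abse ir)).
Qed.

Lemma smooth_partial i psi : smooth psi -> smooth (partial i psi).
Proof. by move=> sm l x; have := sm (rcons l i) x; rewrite foldr_rcons. Qed.

Lemma smooth_continuous psi : smooth psi -> continuous psi.
Proof. by move=> sm x; apply: differentiable_continuous; exact: (sm [::]). Qed.

(** A test function is more handily described by a cube outside which it vanishes. *)
Lemma test_functionP psi : test_function psi <->
  smooth psi /\ exists2 r, 0 < r & forall x, ~ cube r x -> psi x = 0.
Proof.
split=> -[sm].
  move=> /compact_bounded/bounded_sub_box[r [r0 cr]]; split=> //; exists r => // x xr.
  apply: contra_notP xr => /eqP xr; apply/cubeP; apply: cr; exact: subset_closure.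
move=> [r r0 pr]; split=> //.
apply: (subclosed_compact _ (@compact_box _ _ (const_mx (- r)) (const_mx r))).
  exact: closed_closure.
rewrite closureE; apply: smallest_sub.
  by apply: compact_closed => //; exact: compact_box.
by move=> x /= xn; apply: contrapT => /pr h; rewrite h eqxx in xn.
Qed.

Lemma partial_out psi r i x : (forall x, ~ cube r x -> psi x = 0) -> ~ cube r x ->
  partial i psi x = 0.
Proof.
move=> pr xr; rewrite /partial (@near_eq_derive _ _ _ _ (cst 0)) ?derive_cst//.
have oC : open (~` cube r).
  by apply: closed_openC; apply: compact_closed => //; exact: compact_box.
by have := open_nbhs_nbhs (conj oC xr); apply: filterS => y; exact: pr.
Qed.

(** One constant bounds the function and all its first derivatives, and one cube
    carries them. *)
Lemma test_function_bounds psi : test_function psi -> exists r M, [/\ 0 < r, 0 <= M,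
  forall x, `|psi x| <= M, forall i x, `|partial i psi x| <= M &
  forall x, ~ cube r x -> psi x = 0 /\ forall i, partial i psi x = 0].
Proof.
move=> /test_functionP[sm [r r0 pr]].
have bdd (g : V -> R) : continuous g -> (forall x, ~ cube r x -> g x = 0) ->
    exists2 M, 0 <= M & forall x, `|g x| <= M.
  move=> cg gr.
  have : compact (g @` cube r).
    by apply: continuous_compact; [exact: continuous_subspaceT|exact: compact_box].
  move=> /compact_bounded[M [Mr MM]]; exists (Num.max 0 M + 1).
    by rewrite addr_ge0// le_max lexx.
  move=> x; have [xr|/gr ->] := pselect (cube r x); last first.
    by rewrite normr0 addr_ge0// le_max lexx.
  by apply: MM; [rewrite ltr_pwDr// le_max lexx orbT|exists x].
have [M0 M00 HM0] := bdd _ (smooth_continuous sm) pr.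
have /choice[Mi HMi] : forall i, exists M, 0 <= M /\ forall x, `|partial i psi x| <= M.
  move=> i; have [|M M0' HM] := bdd _ (smooth_continuous (smooth_partial i sm)).
    by move=> x; exact: partial_out.
  by exists M.
exists r, (M0 + \sum_i Mi i); split => //.
- by rewrite addr_ge0// sumr_ge0// => i _; exact: (HMi i).1.
- by move=> x; rewrite (le_trans (HM0 x))// lerDl sumr_ge0// => i _; exact: (HMi i).1.
- move=> i x; rewrite (le_trans ((HMi i).2 x))// (bigD1 i)//= addrCA lerDl addr_ge0//.
  by rewrite sumr_ge0// => j _; exact: (HMi j).1.
- by move=> x xr; split; [exact: pr|move=> i; exact: partial_out pr xr].
Qed.

Lemma partial_shift psi c i : partial i (fun x => psi (x + c)) = fun x => partial i psi (x + c).
Proof.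
apply/funext => x; rewrite /partial /derive; set F := (X in X @ _); set G := (X in _ = lim (X @ _)).
by suff -> : F = G by []; apply/funext => t; rewrite /F /G /= addrA.
Qed.

Lemma test_function_shift psi c : test_function psi -> test_function (fun x => psi (x + c)).
Proof.
move=> /test_functionP[sm [r r0 pr]]; apply/test_functionP; split.
  move=> l x; have -> : foldr partial (fun x => psi (x + c)) l = fun x => foldr partial psi l (x + c).
    by elim: l => //= i l ->; exact: partial_shift.
  apply: (differentiable_comp (f := fun x => x + c) (g := foldr partial psi l)) => //.
exists (r + `|c|); first by rewrite ltr_wpDr.
move=> x xr; apply: pr => /cubeP h; apply: xr; apply/cubeP => i.
have -> : x ord0 i = (x + c) ord0 i - c ord0 i by rewrite mxE addrK.
by rewrite (le_trans (ler_normB _ _))// lerD// le_coord_norm.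
Qed.

Lemma is_derive_line psi y i (t : R) : smooth psi ->
  is_derive t 1 (fun t => psi (y + t *: delta_mx ord0 i)) (partial i psi (y + t *: delta_mx ord0 i)).
Proof.
move=> sm; have := diff_derivable (v := delta_mx ord0 i) (sm [::] (y + t *: delta_mx ord0 i)).
rewrite /= /derivable => dd.
have E : (fun h => h^-1 *: (((fun t => psi (y + t *: delta_mx ord0 i)) \o shift t) (h *: (1:R)) -
   psi (y + t *: delta_mx ord0 i))) =
   (fun h => h^-1 *: ((psi \o shift (y + t *: delta_mx ord0 i)) (h *: delta_mx ord0 i) -
   psi (y + t *: delta_mx ord0 i))).
  apply/funext => h /=; congr (_ *: (psi _ - _)).
  by rewrite [h *: 1]mulr1 scalerDl addrCA.
by apply: DeriveDef; [rewrite /derivable E|rewrite /partial /derive E].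
Qed.

End Lp_rV.

(** * Integrating along a direction *)

Section shear.
Context {R : realType} {n : nat}.
Local Notation V := 'rV[R]_n.
Local Notation mu := (@lebesgue_rV R n).
Local Notation leb := (@lebesgue_measure R).
Variable e : V.
Hypothesis e1 : forall i, `|e ord0 i| <= 1.
Implicit Types (g u G psi : V -> R) (x y : V).

Lemma measurable_line (c : R) :
  measurable_fun setT (fun z : V * measurableTypeR R => z.1 + (c * z.2) *: e).
Proof.
apply: measurable_fun_rV => i; under eq_fun do rewrite !mxE.
apply: measurable_funD.
  by apply: (@measurableT_comp _ _ _ _ _ _ (@rV_coord _ R n i)) => //; exact: measurable_rV_coord.
by apply: measurable_funM => //; apply: measurable_funM.
Qed.

Variables (E : set (measurableTypeR R)) (rho : R).
Hypotheses (mE : measurable E) (EB : forall r, E r -> `|r| <= rho).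

Definition line_mean g y : R := (\int[leb]_r (g (y + r *: e) * \1_E r))%R.

Definition line_mean_back g y : R := (\int[leb]_r (g (y + (- r) *: e) * \1_E r))%R.

(** Both integrands below describe the mean of g along the direction e, tested
    against psi; the shear (y, r) -> (y + r e, r) preserves the measure and
    exchanges them. *)
Definition shear_back g psi (z : V * measurableTypeR R) : R :=
  g z.1 * psi (z.1 + (- z.2) *: e) * \1_E z.2.

Definition shear_forth g psi (z : V * measurableTypeR R) : R :=
  g (z.1 + z.2 *: e) * psi z.1 * \1_E z.2.

Lemma lebesgue_bounded_lt : (leb E < +oo)%E.
Proof.
apply: (@le_lt_trans _ _ (leb `[- rho, rho]%classic)).
  by apply: le_measure; rewrite ?inE//= => r /EB; rewrite /= in_itv/= ler_norml.
by rewrite lebesgue_measure_itv/=; case: ifP => // _; rewrite ltry.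
Qed.

Lemma integrable_indicE : leb.-integrable setT (EFin \o (\1_E : R -> R)).
Proof.
apply/integrableP; split; first exact/measurable_EFinP.
under eq_integral do rewrite /= ger0_norm//.
by rewrite integral_indic// setIT; exact: lebesgue_bounded_lt.
Qed.

Section kernel.
Variables (g psi : V -> R) (M r0 : R).
Hypotheses (lg : locally_integrable_rV g) (mpsi : measurable_fun setT psi).
Hypotheses (psiM : forall x, `|psi x| <= M) (psi0 : forall x, ~ cube r0 x -> psi x = 0).

Let mg : measurable_fun setT g.
Proof. exact: locally_integrable_measurable. Qed.

Let M0 : 0 <= M. Proof. exact: le_trans (psiM 0). Qed.

Let mline : measurable_fun setT (fun z : V * measurableTypeR R => z.1 + z.2 *: e).
Proof. by have := measurable_line 1; under eq_fun do rewrite mul1r. Qed.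

Let mlineN : measurable_fun setT (fun z : V * measurableTypeR R => z.1 + (- z.2) *: e).
Proof. by have := measurable_line (- 1); under eq_fun do rewrite mulN1r. Qed.

Let mind : measurable_fun setT (fun z : V * measurableTypeR R => \1_E z.2 : R).
Proof. have H := measurableT_comp (@measurable_indic _ (measurableTypeR R) R setT E mE) (@measurable_snd _ _ V (measurableTypeR R)).
exact: H. Qed.

Let mback : measurable_fun setT (shear_back g psi).
Proof.
rewrite /shear_back; apply: measurable_funM => //; apply: measurable_funM.
  exact: (measurableT_comp mg).
exact: (measurableT_comp mpsi).
Qed.

Let mforth : measurable_fun setT (shear_forth g psi).
Proof.
rewrite /shear_forth; apply: measurable_funM => //; apply: measurable_funM.
  exact: (measurableT_comp mg).
exact: (measurableT_comp mpsi).
Qed.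

Lemma integrable_shear_back : (mu \x leb)%E.-integrable setT (EFin \o shear_back g psi).
Proof.
have ic : mu.-integrable setT (EFin \o (fun x => `|g x * (M * \1_(cube (r0 + rho)) x)|)).
  apply: (@integrable_abse _ _ _ mu setT (EFin \o (fun x => g x * (M * \1_(cube (r0 + rho)) x)))).
  apply: (integrable_mul_cube (r := r0 + rho) (M := M)) => //.
  - by apply: measurable_funM => //; apply: measurable_indic; exact: measurable_box.
  - move=> x; rewrite normrM (ger0_norm M0) ler_piMr// indicE.
    by case: (_ \in _); rewrite ?normr1 ?normr0.
  - by move=> x xc; rewrite indicE memNset ?mulr0.
apply: (integrable_prod_bound mback ic integrable_indicE) => // y r.
rewrite /shear_back !normrM (ger0_norm M0) !(ger0_norm (_ : 0 <= \1_ _ _))// -!mulrA ler_wpM2l//=.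
have [rE|rE] := pselect (E r); last by rewrite [\1_E r]indicE memNset// !mulr0.
rewrite [\1_E r]indicE mem_set// !mulr1.
have [yc|yc] := pselect (cube (r0 + rho) y).
  by rewrite indicE mem_set// mulr1.
rewrite psi0 ?normr0 ?mulr_ge0// => /cubeP yc'; apply: yc; apply/cubeP => i.
have -> : y ord0 i = (y + - r *: e) ord0 i + r * e ord0 i by rewrite !mxE; ring.
rewrite (le_trans (ler_normD _ _))// lerD// normrM (le_trans _ (EB rE))// ler_piMr//.
Qed.

Lemma shear_forthE y r : shear_forth g psi (y, r) = shear_back g psi (shift_rV (r *: e) y, r).
Proof. by rewrite /shear_forth /shear_back /shift_rV /= -addrA -scalerDl subrr scale0r addr0. Qed.

Let mx (r : R) (f : V * measurableTypeR R -> R) : measurable_fun setT f ->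
  measurable_fun setT (fun y : V => f (y, r)).
Proof. by move=> mf; apply: (measurableT_comp mf); exact: measurable_pair2. Qed.

Lemma integral_shear_forth (r : R) :
  (\int[mu]_y (shear_forth g psi (y, r))%:E = \int[mu]_y (shear_back g psi (y, r))%:E)%E.
Proof.
under eq_integral do rewrite shear_forthE.
apply: (@integral_shift _ _ (r *: e) (fun y => (shear_back g psi (y, r))%:E)).
by apply/measurable_EFinP; exact: (mx r mback).
Qed.

Lemma integrable_shear_forth : (mu \x leb)%E.-integrable setT (EFin \o shear_forth g psi).
Proof.
apply/integrable21ltyP; first exact/measurable_EFinP.
have /integrable21ltyP := integrable_shear_back => /(_ _).
move=> /(_ ((measurable_EFinP _ _).2 mback)); congr (_ < _)%E.
apply: eq_integral => r _ /=; under [RHS]eq_integral do rewrite shear_forthE.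
apply/esym; apply: (@integral_shift _ _ (r *: e) (fun y => `|shear_back g psi (y, r)|%:E)).
apply/measurable_EFinP; apply: measurableT_comp => //; exact: (mx r mback).
Qed.

(** Together with integral_line_mean, this moves the averaging from g to psi. *)
Lemma integral_line_mean_back :
  (\int[mu]_y (g y * line_mean_back psi y)%:E = \int[leb]_r \int[mu]_y (shear_back g psi (y, r))%:E)%E.
Proof.
rewrite -(Fubini integrable_shear_back); apply: eq_integral => y _ /=.
have iy : leb.-integrable setT (EFin \o (fun r => psi (y + - r *: e) * \1_E r)).
  apply: (@ae_le_integrable _ _ _ leb setT measurableT _ (fun r => M * \1_E r)).
  - apply: measurable_funM => //; apply: (measurableT_comp mpsi).
    apply: measurable_fun_rV => i; under eq_fun do rewrite !mxE.
    by apply: measurable_funD => //; apply: measurable_funM => //; exact: measurableT_comp.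
  - exact: (integrableZl measurableT M integrable_indicE).
  - by apply: aeW => r _; rewrite normrM [X in _ * X]ger0_norm// ler_wpM2r.
rewrite /line_mean_back EFinM fineK; last exact: integrable_fin_num.
rewrite -integralZl//; apply: eq_integral => r _.
by rewrite /shear_back /= -EFinM mulrA.
Qed.

(** Fubini gives integrability along almost every line only where psi does not
    vanish, which is where it matters. *)
Lemma line_mean_mul : {ae mu, forall y,
  leb.-integrable setT (fun r => (shear_forth g psi (y, r))%:E) /\
  (line_mean g y * psi y)%:E = (\int[leb]_r (shear_forth g psi (y, r))%:E)%E}.
Proof.
have := ae_integrable1 integrable_shear_forth; apply: filterS => y /= iy; split => //.
have [p0|p0] := eqVneq (psi y) 0.
  by rewrite p0 mulr0 integral0_eq// => r _; rewrite /shear_forth /= p0 mulr0 mul0r.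
have i1 : leb.-integrable setT (EFin \o (fun r => g (y + r *: e) * \1_E r)).
  have := integrableZl measurableT (psi y)^-1 iy; congr (is_true (integrable _ _ _)).
  by apply/funext => r; rewrite /shear_forth /= -EFinM; congr EFin; field.
rewrite /line_mean EFinM fineK; last exact: integrable_fin_num.
rewrite -integralZr//; apply: eq_integral => r _.
by rewrite /shear_forth /= -EFinM; congr EFin; ring.
Qed.

Lemma measurable_line_mean : measurable_fun setT (line_mean g).
Proof.
apply: measurableT_comp => //.
apply: (@measurable_fun_integral2 _ _ V (measurableTypeR R) R leb
  (fun z => (g (z.1 + z.2 *: e) * \1_E z.2)%:E)).
by apply/measurable_EFinP; apply: measurable_funM => //; exact: (measurableT_comp mg).
Qed.

Lemma integrable_line_mean : mu.-integrable setT (EFin \o (fun y => line_mean g y * psi y)).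
Proof.
have := integrable_fubini_F integrable_shear_forth.
move=> /integrableP[_ fy]; apply/integrableP; split.
  by apply/measurable_EFinP; apply: measurable_funM => //; exact: measurable_line_mean.
apply: le_lt_trans fy; rewrite le_eqVlt; apply/orP; left; apply/eqP.
apply: ae_eq_integral => //.
- apply: measurableT_comp => //; apply/measurable_EFinP; apply: measurable_funM => //.
  exact: measurable_line_mean.
- apply: measurableT_comp => //; exact: measurable_fubini_F integrable_shear_forth.
- by apply: filterS line_mean_mul => y [_ h] _; congr abse; exact: h.
Qed.

Lemma integral_line_mean :
  (\int[mu]_y (line_mean g y * psi y)%:E = \int[leb]_r \int[mu]_y (shear_back g psi (y, r))%:E)%E.
Proof.
transitivity (\int[mu]_y \int[leb]_r (shear_forth g psi (y, r))%:E)%E.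
  apply: ae_eq_integral => //.
  - by apply/measurable_EFinP; apply: measurable_funM => //; exact: measurable_line_mean.
  - exact: measurable_fubini_F integrable_shear_forth.
  - by apply: filterS line_mean_mul => y [_ +] _.
rewrite (Fubini integrable_shear_forth); apply: eq_integral => r _.
exact: integral_shear_forth.
Qed.

End kernel.

Lemma line_meanE g y : line_mean g y = (\int[leb]_(r in E) g (y + r *: e))%R.
Proof.
rewrite Rintegral_mkcond; apply: eq_Rintegral => r _; rewrite patchE indicE.
by case: (r \in E); rewrite ?mulr1 ?mulr0.
Qed.

Lemma line_mean_backE g y : line_mean_back g y = (\int[leb]_(r in E) g (y + (- r) *: e))%R.
Proof.
rewrite Rintegral_mkcond; apply: eq_Rintegral => r _; rewrite patchE indicE.
by case: (r \in E); rewrite ?mulr1 ?mulr0.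
Qed.

End shear.

(** * Weak partial derivatives along lines *)

Section restriction.
Context d (T : measurableType d) {R : realType} (mu : {measure set T -> \bar R}).

Lemma mul_indicE (D : set T) (g : T -> R) :
  (EFin \o (fun x => g x * \1_D x)) = (EFin \o g) \_ D.
Proof.
by apply/funext => x; rewrite patchE /= indicE; case: (x \in D); rewrite ?mulr1 ?mulr0.
Qed.

Lemma integrable_mul_indic (D : set T) (g : T -> R) : measurable D ->
  mu.-integrable setT (EFin \o (fun x => g x * \1_D x)) <-> mu.-integrable D (EFin \o g).
Proof. by move=> mD; rewrite mul_indicE; split=> /(integrable_mkcond _ mD). Qed.

End restriction.

Section integrable_shift.
Context {R : realType} {n : nat}.
Local Notation mu := (@lebesgue_rV R n).

Lemma measurable_fun_shift (c : 'rV[R]_n) (g : 'rV[R]_n -> R) : measurable_fun setT g ->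
  measurable_fun setT (fun x : 'rV[R]_n => g (x + c)).
Proof. by move=> mg; exact: (measurableT_comp mg (measurable_shift_rV c)). Qed.

Lemma integrable_shift (c : 'rV[R]_n) (g : 'rV[R]_n -> R) : mu.-integrable setT (EFin \o g) ->
  mu.-integrable setT (EFin \o (fun x : 'rV[R]_n => g (x + c))).
Proof.
move=> /integrableP[/measurable_EFinP mg ig]; apply/integrableP; split.
  by apply/measurable_EFinP; exact: measurable_fun_shift.
rewrite [X in (X < _)%E](@integral_shift _ _ c (fun x => `|(g x)%:E|)%E)//.
by apply: measurableT_comp => //; exact/measurable_EFinP.
Qed.

End integrable_shift.

Section lines.
Context {R : realType} {n : nat}.
Local Notation V := 'rV[R]_n.
Local Notation mu := (@lebesgue_rV R n).
Local Notation leb := (@lebesgue_measure R).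
Implicit Types (g u G psi : V -> R) (x y : V).

Definition weak_partial (i : 'I_n) u G := forall psi, test_function psi ->
  (\int[mu]_x (u x * partial i psi x)%:E = - \int[mu]_x (G x * psi x)%:E)%E.

Lemma delta_le1 (i j : 'I_n) : `|(delta_mx ord0 i : V) ord0 j| <= 1.
Proof. by rewrite mxE eqxx /=; case: (j == i); rewrite ?normr1 ?normr0. Qed.

Lemma segment_bound (a r : R) : `[0, a]%classic r -> `|r| <= a.
Proof. by rewrite /= in_itv/= => /andP[r0 ra]; rewrite ger0_norm. Qed.

Lemma integrable_mul_test g psi : locally_integrable_rV g -> test_function psi ->
  mu.-integrable setT (EFin \o (fun x => g x * psi x)).
Proof.
move=> lg tpsi; have [r [M [_ _ pM _ out]]] := test_function_bounds tpsi.
by apply: (integrable_mul_cube lg (test_function_measurable tpsi) pM) => x /out[].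
Qed.

(** Translation invariance moves a translation from u to the test function. *)
Lemma shift_test u psi (h : R) (e : V) : locally_integrable_rV u -> test_function psi ->
  [/\ mu.-integrable setT (EFin \o (fun x => u x * psi (x + (- h) *: e))),
    mu.-integrable setT (EFin \o (fun x => u (x + h *: e) * psi x)) &
    (\int[mu]_x (u (x + h *: e) * psi x)%:E = \int[mu]_x (u x * psi (x + (- h) *: e))%:E)%E].
Proof.
move=> lu tpsi; have tsh := test_function_shift ((- h) *: e) tpsi.
have i1 := integrable_mul_test lu tsh.
have E : (fun x => u (x + h *: e) * psi x) =
    (fun x => (fun x => u x * psi (x + (- h) *: e)) (x + h *: e)).
  by apply/funext => x; rewrite -addrA -scalerDl subrr scale0r addr0.
split=> //.
  by rewrite E; exact: (@integrable_shift _ _ (h *: e) (fun x => u x * psi (x + (- h) *: e))).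
rewrite -(@integral_shift _ _ (h *: e) (fun x => (u x * psi (x + (- h) *: e))%:E)).
  by apply: eq_integral => x _; rewrite -addrA -scalerDl subrr scale0r addr0.
exact: measurable_int i1.
Qed.

Lemma continuous_back_line psi y i : smooth psi ->
  continuous (fun r : R => psi (y + (- r) *: delta_mx ord0 i)).
Proof.
move=> sm r; apply/differentiable_continuous/derivable1_diffP; apply: ex_derive.
have d1 : is_derive r (1 : R) (fun r : R => - r) (- 1 : R) by exact: is_deriveNid.
exact: (@is_derive1_comp _ (fun t => psi (y + t *: delta_mx ord0 i)) (fun r => - r) r _ _
  (is_derive_line y i (- r) sm) d1).
Qed.

Lemma line_FTC psi y i (h : R) : smooth psi -> 0 < h ->
  (\int[leb]_(r in `[0, h]) partial i psi (y + (- r) *: delta_mx ord0 i))%R =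
  psi y - psi (y + (- h) *: delta_mx ord0 i).
Proof.
move=> sm h0; pose F (r : R) := - psi (y + (- r) *: delta_mx ord0 i).
pose f (r : R) := partial i psi (y + (- r) *: delta_mx ord0 i).
have dF (r : R) : is_derive r 1 F (f r).
  have d1 : is_derive r (1 : R) (fun r : R => - r) (- 1 : R) by exact: is_deriveNid.
  have := is_deriveN (@is_derive1_comp _ (fun t => psi (y + t *: delta_mx ord0 i)) (fun r => - r) r _ _
    (is_derive_line y i (- r) sm) d1).
  by rewrite mulrN1 opprK.
have cF : continuous F.
  by move=> r; apply/differentiable_continuous/derivable1_diffP; apply: ex_derive; exact: dF.
have cf : continuous f := @continuous_back_line (partial i psi) y i (smooth_partial i sm).
rewrite /Rintegral (@continuous_FTC2 R f F 0 h) //.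
- by rewrite /F oppr0 scale0r addr0 /=; ring.
- exact: continuous_subspaceT.
- split=> [r _||]; first by apply: ex_derive; exact: dF.
    by apply: cvg_at_right_filter; exact: cF.
  by apply: cvg_at_left_filter; exact: cF.
- by move=> r _; rewrite derive1E; apply: derive_val; exact: dF.
Qed.

(** Both sides have the same integral against every test function psi: shifting
    moves the increment to psi, the fundamental theorem of calculus writes the
    increment of psi as a line mean of its derivative, and the definition of G
    moves the derivative back. *)
Lemma line_increment u G i (h : R) : locally_integrable_rV u -> locally_integrable_rV G ->
  weak_partial i u G -> 0 < h ->
  {ae mu, forall x, u (x + h *: delta_mx ord0 i) - u x =
    line_mean (delta_mx ord0 i) `[0, h] G x}.
Proof.
move=> lu lG uG h0; set e : V := delta_mx ord0 i.
have mu_ := locally_integrable_measurable lu.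
have mE : measurable (`[0, h]%classic : set (measurableTypeR R)) by exact: measurable_itv.
have EB := @segment_bound h.
pose g x := u (x + h *: e) - u x - line_mean e `[0, h] G x.
suff : {ae mu, forall x, g x = 0}.
  by apply: filterS => x /eqP; rewrite subr_eq0 => /eqP.
have box_cube (a b : V) : exists2 r, 0 < r & box a b `<=` cube r.
  have [r [r0 Hr]] := bounded_sub_box (compact_bounded (@compact_box R n a b)).
  by exists r => // x xb; apply/cubeP; exact: Hr.
have indic1 (A : set V) x : `|\1_A x : R| <= 1.
  by rewrite indicE; case: (_ \in _); rewrite ?normr1 ?normr0.
have ush_box a b : mu.-integrable (box a b) (EFin \o (fun x => u (x + h *: e))).
  apply/integrable_mul_indic; first exact: measurable_box.
  have [r r0 br] := box_cube a b.
  have -> : (fun x => u (x + h *: e) * \1_(box a b) x) =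
      (fun x => (fun x => u x * \1_(box a b) (x - h *: e)) (x + h *: e)).
    by apply/funext => x; rewrite addrK.
  apply: (@integrable_shift _ _ (h *: e) (fun x => u x * \1_(box a b) (x - h *: e))).
  apply: (integrable_mul_cube (r := r + `|h *: e|) (M := 1)) => //.
    by apply: measurable_fun_shift; apply: measurable_indic; exact: measurable_box.
  move=> x xr; rewrite indicE memNset// => xb; apply: xr; apply/cubeP => j.
  have -> : x ord0 j = (x - h *: e) ord0 j + (h *: e) ord0 j by rewrite !mxE subrK.
  rewrite (le_trans (ler_normD _ _))// lerD//; last exact: le_coord_norm.
  by have /cubeP := br _ xb.
have W_box a b : mu.-integrable (box a b) (EFin \o line_mean e `[0, h] G).
  apply/integrable_mul_indic; first exact: measurable_box.
  have [r r0 br] := box_cube a b.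
  apply: (integrable_line_mean (delta_le1 i) mE EB (M := 1) (r0 := r) lG) => //.
    by apply: measurable_indic; exact: measurable_box.
  by move=> x xr; rewrite indicE memNset// => /br.
apply: fundamental_lemma => [a b|psi tpsi].
  apply: (integrableB _ (integrableB _ (ush_box a b) (locally_integrable_box a b lu)) (W_box a b));
  exact: measurable_box.
have [r [M [r0 M0 pM dpM out]]] := test_function_bounds tpsi.
have [sm _] := (test_functionP _).1 tpsi.
have mpsi := test_function_measurable tpsi.
have pout x : ~ cube r x -> psi x = 0 by move=> /out[].
have dout x : ~ cube r x -> partial i psi x = 0 by move=> /out[].
have mdpsi : measurable_fun setT (partial i psi).
  by apply: continuous_measurable_rV; apply: smooth_continuous; exact: smooth_partial.
have i1 := integrable_mul_test lu tpsi.
have [i2 i2' e2] := shift_test h e lu tpsi.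
have i3 := integrable_line_mean (delta_le1 i) mE EB lG mpsi pM pout.
have key : (\int[mu]_x (line_mean e `[0, h] G x * psi x)%:E =
    - \int[mu]_x (u x * line_mean_back e `[0, h] (partial i psi) x)%:E)%E.
  rewrite (integral_line_mean (delta_le1 i) mE EB lG mpsi pM pout).
  rewrite (integral_line_mean_back (delta_le1 i) mE EB lu mdpsi (dpM i) dout).
  have E rho : (\int[mu]_y (shear_back e `[0%R, h]%classic u (partial i psi) (y, rho))%:E =
     - \int[mu]_y (shear_back e `[0%R, h]%classic G psi (y, rho))%:E)%E.
    rewrite /shear_back /=; have [rE|rE] := pselect (`[0, h]%classic rho); last first.
      rewrite !integral0_eq ?oppe0// => x _; rewrite indicE memNset// mulr0//.
    under eq_integral do rewrite indicE mem_set// mulr1.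
    under [in RHS]eq_integral do rewrite indicE mem_set// mulr1.
    have := uG _ (test_function_shift (- rho *: e) tpsi); rewrite partial_shift; exact.
  under [X in (_ = - X)%E]eq_integral do rewrite E.
  have iG := integrable_shear_back (delta_le1 i) mE EB lG mpsi pM pout.
  rewrite integralN ?oppeK//.
  have := integrable_fin_num measurableT iG; rewrite -(integral21_prod_meas1 iG) /fubini_G /=.
  by rewrite integralE fin_numB => /andP[? ?]; apply: fin_num_adde_defl; rewrite fin_numN.
have i4 : mu.-integrable setT (EFin \o (fun x => line_mean e `[0, h] G x * psi x)) := i3.
have E1 : (\int[mu]_x (u x * line_mean_back e `[0, h] (partial i psi) x)%:E =
   \int[mu]_x (u x * psi x)%:E - \int[mu]_x (u x * psi (x + - h *: e))%:E)%E.
  rewrite -integralB_EFin//; apply: eq_integral => x _.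
  by rewrite line_mean_backE line_FTC// mulrBr.
have -> : (\int[mu]_x (g x * psi x)%:E = \int[mu]_x (u (x + h *: e) * psi x)%:E -
  \int[mu]_x (u x * psi x)%:E - \int[mu]_x (line_mean e `[0%R, h] G x * psi x)%:E)%E.
  rewrite -integralB_EFin// -integralB_EFin//; last exact: (integrableB _ i2' i1).
  by apply: eq_integral => x _; rewrite /g !mulrBl.
rewrite key E1 e2.
move: (integrable_fin_num measurableT i1) (integrable_fin_num measurableT i2) => /=.
move=> /fineK <- /fineK <-; rewrite -!EFinB; congr EFin; ring.
Qed.

Definition line_avg e g (m : nat) y : R := m.+1%:R * line_mean e `[0, m.+1%:R^-1] g y.

Let shrinking (x : R) : nicely_shrinking x (fun m => `[x, x + m.+1%:R^-1]%classic).
Proof.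
split=> [m|]; first exact: measurable_itv.
have pos m : 0 < 2 * m.+1%:R^-1 :> R by rewrite mulr_gt0// invr_gt0.
exists (4, fun m => PosNum (pos m)); split => //=.
- rewrite -[X in _ --> X](mulr0 2); apply: cvgM; first exact: cvg_cst.
  exact: cvg_harmonic.
- move=> m y; rewrite /= in_itv/= /ball/= => /andP[xy yx].
  have m0 : 0 < m.+1%:R^-1 :> R by rewrite invr_gt0.
  by move: (m.+1%:R^-1) m0 yx => z m0 yx; rewrite ltr_distlC; apply/andP; split; lra.
- move=> m; rewrite lebesgue_measure_ball ?(ltW (pos m))// lebesgue_measure_itv/= lte_fin ltrDl invr_gt0 ltr0n/=.
  by rewrite -EFinB -EFinM lee_fin -mulr_natr; move: (m.+1%:R^-1) => z; lra.
Qed.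

Section avg.
Variables (e : V) (g : V -> R).
Hypotheses (e1 : forall i, `|e ord0 i| <= 1) (lg : locally_integrable_rV g).

Let mg : measurable_fun setT g := locally_integrable_measurable lg.

Let mline y : measurable_fun setT (fun r : measurableTypeR R => g (y + r *: e)).
Proof.
apply: (measurableT_comp mg); apply: measurable_fun_rV => i; under eq_fun do rewrite !mxE.
by apply: measurable_funD => //; exact: measurable_funM.
Qed.

Lemma measurable_line_avg m : measurable_fun setT (line_avg e g m).
Proof.
by apply: measurable_funM => //; apply: measurable_line_mean lg; exact: measurable_itv.
Qed.

Lemma ae_line_locally_integrable : {ae mu, forall y, locally_integrable setT (fun r : R => g (y + r *: e))}.
Proof.
pose E (k : nat) := `[- k%:R, k%:R : R]%classic.
have mE k : measurable (E k : set (measurableTypeR R)) by exact: measurable_itv.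
have EB k (r : R) : E k r -> `|r| <= k%:R by rewrite /E /= in_itv/= ler_norml.
have H k : {ae mu, forall y, cube k%:R y -> leb.-integrable (E k) (EFin \o (fun r => g (y + r *: e)))}.
  have m1 : measurable_fun setT (\1_(cube k%:R) : V -> R).
    by apply: measurable_indic; exact: measurable_box.
  have b1 x : `|\1_(cube k%:R) x : R| <= 1.
    by rewrite indicE; case: (_ \in _); rewrite ?normr1 ?normr0.
  have o1 x : ~ cube k%:R x -> \1_(cube k%:R) x = 0 :> R by move=> xc; rewrite indicE memNset.
  have := line_mean_mul e1 (mE k) (@EB k) lg m1 b1 o1; apply: filterS => y [iy _] yc.
  apply/integrable_mul_indic => //; move: iy; congr (is_true (integrable _ _ _)).
  by apply/funext => r; rewrite /shear_forth /= [\1_(cube _) y]indicE mem_set// mulr1.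
have := ae_foralln H; apply: filterS => y Hy; split; [exact: mline|exact: openT|].
move=> K _ cK.
have [M [Mr KM]] := compact_bounded cK.
pose k := (Num.truncn (Num.max `|y| (Num.max 0 M + 1))).+1.
have kb : Num.max `|y| (Num.max 0 M + 1) <= k%:R by exact/ltW/truncnS_gt.
have ck : cube k%:R y.
  apply/cubeP => i; rewrite (le_trans (le_coord_norm y i))// (le_trans _ kb)// le_max lexx//.
have KE : K `<=` E k.
  move=> r Kr; rewrite /E /= in_itv/= -ler_norml (le_trans _ kb)// le_max; apply/orP; right.
  by apply: KM => //; rewrite ltr_pwDr// le_max lexx orbT.
have /integrableP[_] := Hy k ck; apply: le_lt_trans.
apply: ge0_subset_integral => //; first exact: compact_measurable.
by apply/measurable_EFinP; apply: measurableT_comp => //; apply: measurable_funTS; exact: mline.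
Qed.

(** On almost every line the one-dimensional differentiation theorem gives
    convergence at almost every point; by Tonelli, the measurable set of bad
    points is null. Translation invariance identifies its measure with the
    integral of its sections by segments of unit length. *)
Lemma line_avg_cvg : {ae mu, forall y, line_avg e g ^~ y @ \oo --> g y}.
Proof.
(* the limsup is measurable, so that the set of bad points is too *)
pose d y := limn_esup (fun m => (`|line_avg e g m y - g y|)%:E).
have md : measurable_fun setT d.
  apply: (measurable_fun_limn_esup (f := fun m y => (`|line_avg e g m y - g y|)%:E)) => m.
  apply/measurable_EFinP; apply: measurableT_comp => //; apply: measurable_funB => //.
  exact: measurable_line_avg.
suff : {ae mu, forall y, d y = 0%E}.
  apply: filterS => y dy0.
  have : (fun m => (`|line_avg e g m y - g y|)%:E) @ \oo --> 0%E.
    by apply: limn_esup_le_cvg; [rewrite -/(d y) dy0|move=> m; rewrite lee_fin].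
  move=> /fine_cvg /= h; apply/subr_cvg0; apply/norm_cvg0P; exact: h.
have good y : locally_integrable setT (fun r : R => g (y + r *: e)) ->
    {ae leb, forall t, d (y + t *: e) = 0%E}.
  move=> ly; have := lebesgue_differentiation ly.
  apply: (@filterS _ _ (ae_filter_ringOfSetsType leb)) => t Lt.
  have h := nice_lebesgue_differentiation shrinking ly Lt.
  suff h' : line_avg e g ^~ (y + t *: e) @ \oo --> g (y + t *: e).
    have h2 : (fun m => (`|line_avg e g m (y + t *: e) - g (y + t *: e)|)%:E) @ \oo --> 0%E.
      apply: cvg_EFin; first exact: nearW.
      by move/subr_cvg0/cvg_norm : h'; rewrite normr0.
    by rewrite /d is_cvg_limn_esupE; [apply/cvg_lim|apply/cvg_ex; exists 0%E].
  have -> : line_avg e g ^~ (y + t *: e) = fine \o (fun m => (leb `[t, (t + m.+1%:R^-1)%R]%classic)^-1 *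
     \int[leb]_(r in `[t, (t + m.+1%:R^-1)%R]) (g (y + r *: e))%:E)%E.
    apply/funext => m; rewrite /line_avg line_meanE /Rintegral /=.
    have m0 : 0 < m.+1%:R^-1 :> R by rewrite invr_gt0.
    rewrite lebesgue_measure_itv/= lte_fin ltrDl m0 -EFinB addrAC subrr add0r.
    rewrite inver gt_eqF// invrK fineM//; last first.
      apply: integrable_fin_num; first exact: measurable_itv.
      apply/integrableP; split; first by apply/measurable_EFinP; apply: measurable_funTS; exact: mline.
      by case: ly => _ _; apply => //; exact: segment_compact.
    congr (_ * fine _); rewrite -(integral_shift_R t _ (g := fun r => (g (y + r *: e))%:E)).
      by apply: eq_integral => r _; rewrite scalerDl addrA addrAC.
    by apply/measurable_EFinP; exact: mline.
  exact: fine_cvg.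
pose S := [set y | d y != 0%E].
have mS : measurable S.
  by have /(_ 0%E) := emeasurable_neq measurableT md; rewrite setTI.
suff S0 : mu S = 0%E by exists S; split => // y /= /eqP.
(* integrating over y first gives the measure of S, over z.2 first gives 0 *)
pose f (z : V * measurableTypeR R) : \bar R := (\1_S (z.1 + z.2 *: e) * \1_(`[0, 1]%classic) z.2)%:E.
have mf : measurable_fun setT f.
  apply/measurable_EFinP; apply: measurable_funM.
    have ml : measurable_fun setT (fun z : V * measurableTypeR R => z.1 + z.2 *: e).
      by have := measurable_line e 1; under eq_fun do rewrite mul1r.
    have mSi : measurable_fun setT (\1_S : V -> R) by exact: measurable_indic.
    exact: (measurableT_comp mSi ml).
  have H := measurableT_comp (@measurable_indic _ (measurableTypeR R) R setT _ (measurable_itv `[0 : R, 1])) (@measurable_snd _ _ V (measurableTypeR R)).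
  exact: H.
have f0 z : (0 <= f z)%E by rewrite lee_fin mulr_ge0.
have FT := @fubini_tonelli _ _ V (measurableTypeR R) R mu leb f mf f0.
have L0 : (\int[mu]_x \int[leb]_y f (x, y) = 0)%E.
  have mF : measurable_fun setT (fun x => \int[leb]_y f (x, y))%E.
    exact: measurable_fun_fubini_tonelli_F.
  rewrite -(integral0 mu setT); apply: ae_eq_integral => //.
  have := ae_line_locally_integrable; apply: filterS => x /good gx _.
  rewrite -(integral0 leb setT); apply: ae_eq_integral => //.
    by apply: (measurableT_comp mf); exact: measurable_pair1.
  move: gx; apply: (@filterS _ _ (ae_filter_ringOfSetsType leb)) => t dt _.
  by rewrite /f /= [\1_S _]indicE memNset ?mul0r//= /S /= dt eqxx.
have R0 : (\int[leb]_y \int[mu]_x f (x, y) = mu S)%E.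
  transitivity (\int[leb]_r ((\1_`[0%R, 1%R]%classic r : R)%:E * mu S))%E.
    apply: eq_integral => r _; rewrite /f /=.
    under eq_integral do rewrite mulrC EFinM.
    rewrite ge0_integralZl//.
    - congr (_ * _)%E.
      rewrite (@ge0_integral_shift _ _ (r *: e) (fun x => (\1_S x)%:E)).
      + by rewrite integral_indic// setIT.
      + by apply/measurable_EFinP; exact: measurable_indic.
      + by move=> x; rewrite lee_fin.
    - by apply/measurable_EFinP; apply: measurable_fun_shift; exact: measurable_indic.
  rewrite ge0_integralZr//; last by apply/measurable_EFinP; exact: measurable_indic.
  have -> : (\int[leb]_x (\1_`[0%R, 1%R]%classic x : R)%:E = 1)%E.
    transitivity (leb `[0, 1]%classic); last by rewrite lebesgue_measure_itv/= lte_fin ltr01 sube0.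
    by have := integral_indic leb measurableT (measurable_itv `[0 : R, 1]); rewrite setIT.
  by rewrite mul1e.
by rewrite -R0 -FT L0.
Qed.

End avg.
End lines.

(** * The chain rule for weak partial derivatives *)

Section chain_rule.
Context {R : realType} {n : nat}.
Local Notation V := 'rV[R]_n.
Local Notation mu := (@lebesgue_rV R n).
Local Notation leb := (@lebesgue_measure R).
Implicit Types (u v w g G psi : V -> R) (x y : V).

Lemma continuous_norm_back_line psi y i : smooth psi ->
  continuous (fun r : R => `|psi (y + (- r) *: delta_mx ord0 i)|).
Proof. by move=> sm r; exact: (cvg_norm (@continuous_back_line R n psi y i sm r)). Qed.

Lemma test_function_lipschitz psi i M (h : R) x : test_function psi -> 0 <= h ->
  (forall x, `|partial i psi x| <= M) -> `|psi (x + (- h) *: delta_mx ord0 i) - psi x| <= M * h.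
Proof.
move=> /test_functionP[sm _] h0 dM.
have d t := is_derive_line x i t sm.
have c : {within `[- h, 0]%classic, continuous (fun t => psi (x + t *: delta_mx ord0 i))}.
  apply: continuous_subspaceT => t; apply/differentiable_continuous/derivable1_diffP.
  by apply: ex_derive; exact: d.
have [|t _] := MVT_segment _ (fun t _ => d t) c; first by rewrite oppr_le0.
rewrite scale0r addr0 sub0r opprK => E; rewrite distrC E normrM (ger0_norm h0).
by rewrite ler_wpM2r.
Qed.

Lemma locally_integrable_norm g : locally_integrable_rV g -> locally_integrable_rV (fun x => `|g x|).
Proof. by move=> lg K cK; exact: integrable_norm (lg K cK). Qed.

Lemma bounded_locally_integrable g M : measurable_fun setT g -> (forall x, `|g x| <= M) ->
  locally_integrable_rV g.
Proof.
move=> mg gM K cK; have mK := compact_measurable_rV cK.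
apply: (@ae_le_integrable _ _ _ mu K mK g (cst M)).
- exact: measurable_funTS.
- apply/integrableP; split; first exact/measurable_EFinP.
  rewrite /=.
  by rewrite integral_cst// lte_mul_pinfty//; exact: compact_lt_pinfty.
- exact: nearW.
Qed.

(** Moving the averages from G to |psi| and using that psi is Lipschitz, the
    average of |psi| exceeds |psi| by at most M / (m + 1), and only on a slightly
    larger cube. *)
Lemma line_avg_integral_le i G psi M r0 m : (forall x, 0 <= G x) -> locally_integrable_rV G ->
  test_function psi -> (forall x, `|psi x| <= M) -> (forall x, `|partial i psi x| <= M) ->
  (forall x, ~ cube r0 x -> psi x = 0) ->
  (\int[mu]_x (line_avg (delta_mx ord0 i) G m x * `|psi x|) <=
   \int[mu]_x (G x * `|psi x|) + m.+1%:R^-1 * (M * \int[mu]_x (G x * \1_(cube (r0 + 1)) x)))%R.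
Proof.
move=> G0 lG tpsi pM dM pout; set e : V := delta_mx ord0 i; set h : R := m.+1%:R^-1.
have h0 : 0 < h by rewrite invr_gt0.
have h1 : h <= 1 by rewrite invf_le1 ?ler1n.
have M0 : 0 <= M by exact: le_trans (pM 0).
have mE : measurable (`[0, h]%classic : set (measurableTypeR R)) by exact: measurable_itv.
have EB := @segment_bound _ h.
have mpsi : measurable_fun setT (fun x => `|psi x|).
  by apply: measurableT_comp => //; exact: test_function_measurable.
have npM x : `| `|psi x| | <= M by rewrite normr_id.
have npout x : ~ cube r0 x -> `|psi x| = 0 by move=> /pout ->; rewrite normr0.
pose b y := line_mean_back e `[0, h] (fun x => `|psi x|) y.
have b_le y : 0 <= b y <= h * (`|psi y| + h * (M * \1_(cube (r0 + 1)) y)).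
  rewrite /b line_mean_backE.
  have -> : h * (`|psi y| + h * (M * \1_(cube (r0 + 1)) y)) =
      (\int[leb]_(r in `[0, h]) (`|psi y| + h * (M * \1_(cube (r0 + 1)) y)))%R.
    rewrite (Rintegral_cst leb mE); have -> : fine (leb `[0, h]%classic) = h; last by rewrite mulrC.
    by rewrite lebesgue_measure_itv/= lte_fin h0 sube0.
  have cont : {within `[0, h]%classic, continuous (fun r => `|psi (y + (- r) *: e)|)}.
    apply: continuous_subspaceT; exact: continuous_norm_back_line ((test_functionP _).1 tpsi).1.
  apply/andP; split; first by apply: Rintegral_ge0.
  apply: le_Rintegral => //.
  - apply: continuous_compact_integrable => //; exact: segment_compact.
  - apply: continuous_compact_integrable; first exact: segment_compact.
    by move=> ?; exact: cst_continuous.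
  - move=> r rE; have [yc|yc] := pselect (cube (r0 + 1) y).
      rewrite indicE mem_set// mulr1 -lerBlDl; apply: (le_trans (lerB_dist _ _)).
      move: rE; rewrite /= in_itv/= => /andP[r00 rh].
      by rewrite (le_trans (test_function_lipschitz _ tpsi r00 dM))// mulrC ler_wpM2r.
    rewrite pout ?normr0; first by rewrite addr_ge0// !mulr_ge0// ltW.
    move=> /cubeP yr; apply: yc; apply/cubeP => j.
    have -> : y ord0 j = (y + (- r) *: e) ord0 j + r * e ord0 j by rewrite !mxE; ring.
    rewrite (le_trans (ler_normD _ _))// lerD// normrM -[leRHS]mulr1 ler_pM//; last exact: delta_le1.
    exact: le_trans (EB r rE) h1.
have mb : measurable_fun setT b.
  have -> : b = line_mean (- e) `[0, h] (fun x => `|psi x|).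
    apply/funext => y; rewrite /b /line_mean_back /line_mean; apply: eq_Rintegral => r _.
    by rewrite scaleNr scalerN.
  apply: (measurable_line_mean (- e) mE); exact: bounded_locally_integrable mpsi npM.
have lin := integrable_line_mean (delta_le1 i) mE EB lG mpsi npM npout.
have ib : mu.-integrable setT (EFin \o (fun x => G x * b x)).
  apply: (integrable_mul_cube (r := r0 + 1) (M := M + M) lG mb) => x.
    have /andP[bx0 bx] := b_le x; rewrite ger0_norm// (le_trans bx)//.
    have : `|psi x| + h * (M * \1_(cube (r0 + 1)) x) <= M + M.
      by rewrite lerD// -[leRHS]mul1r ler_pM ?mulr_ge0// ?(ltW h0)// ler_piMr// indicE lern1; case: (_ \in _).
    apply: le_trans; rewrite ler_piMl// addr_ge0// !mulr_ge0// ltW//.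
  move=> xr; have /andP[bx0 bx] := b_le x; apply/eqP; rewrite eq_le bx0 andbT (le_trans bx)//.
  rewrite indicE memNset// !mulr0 addr0 npout ?mulr0// => /cubeP xr0; apply: xr; apply/cubeP => j.
  by rewrite (le_trans (xr0 j))// lerDl.
have E : (\int[mu]_x (line_mean e `[0, h] G x * `|psi x|) = \int[mu]_x (G x * b x))%R.
  rewrite /Rintegral (integral_line_mean (delta_le1 i) mE EB lG mpsi npM npout).
  by rewrite (integral_line_mean_back (delta_le1 i) mE EB lG mpsi npM npout).
have iG1 : mu.-integrable setT (EFin \o (fun x => G x * \1_(cube (r0 + 1)) x)).
  by apply/integrable_mul_indic; [exact: measurable_box|apply: lG; exact: compact_box].
have iGp : mu.-integrable setT (EFin \o (fun x => G x * `|psi x|)).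
  exact: integrable_mul_cube lG mpsi npM npout.
have iGc := integrableZl measurableT (h * M) iG1.
have -> : (\int[mu]_x (line_avg e G m x * `|psi x|) = m.+1%:R * \int[mu]_x (line_mean e `[0, h] G x * `|psi x|))%R.
  by rewrite -RintegralZl//; apply: eq_Rintegral => x _; rewrite mulrA.
have -> : h * (M * \int[mu]_x (G x * \1_(cube (r0 + 1)) x))%R =
    (\int[mu]_x ((h * M) * (G x * \1_(cube (r0 + 1)) x)))%R by rewrite RintegralZl// mulrA.
rewrite E -RintegralD// -RintegralZl//; apply: le_Rintegral => //.
- exact: (integrableZl measurableT (m.+1%:R) ib).
- exact: (integrableD measurableT iGp iGc).
move=> x _; have /andP[_ bx] := b_le x.
rewrite [leRHS](_ : _ = m.+1%:R * (G x * (h * (`|psi x| + h * (M * \1_(cube (r0 + 1)) x))))).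
  by rewrite ler_wpM2l// ler_wpM2l.
have mh : m.+1%:R * h = 1 by rewrite /h divff.
rewrite (_ : m.+1%:R * (G x * (h * (`|psi x| + h * (M * \1_(cube (r0 + 1)) x)))) =
  (m.+1%:R * h) * (G x * (`|psi x| + h * (M * \1_(cube (r0 + 1)) x)))); last by ring.
by rewrite mh; ring.
Qed.

Definition diff_quotient i u (m : nat) x : R :=
  m.+1%:R * (u (x + m.+1%:R^-1 *: delta_mx ord0 i) - u x).

(** The difference quotient is an average of G along the line. *)
Lemma diff_quotient_ae i u G : locally_integrable_rV u -> locally_integrable_rV G ->
  weak_partial i u G -> {ae mu, forall x,
    (forall m, `|diff_quotient i u m x| <= line_avg (delta_mx ord0 i) (fun x => `|G x|) m x) /\
    diff_quotient i u ^~ x @ \oo --> G x}.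
Proof.
move=> lu lG uG; set e : V := delta_mx ord0 i.
have m0 m : 0 < m.+1%:R^-1 :> R by rewrite invr_gt0.
have A := ae_foralln (fun m => line_increment lu lG uG (m0 m)).
apply: filterS3 A (ae_line_locally_integrable (delta_le1 i) lG) (line_avg_cvg (delta_le1 i) lG).
move=> x Ax lx cx.
have E m : diff_quotient i u m x = line_avg e G m x by rewrite /diff_quotient Ax.
have [mx _ ix] := lx; split=> [m|]; last by rewrite (_ : diff_quotient i u ^~ x = line_avg e G ^~ x)//; exact/funext.
rewrite E /line_avg normrM ger0_norm// ler_wpM2l// !line_meanE.
apply: le_normr_Rintegral; first exact: measurable_itv.
apply/integrableP; split; first by apply/measurable_EFinP; exact: measurable_funTS mx.
by apply: ix => //; exact: segment_compact.
Qed.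

(** The difference quotients of w are bounded by averages of |Gu| and |Gv|, which
    converge together with their integrals against |psi|; so the generalized
    dominated convergence theorem applies. The pointwise limit is asked along
    steps 1 / (m + 1), as these are the steps of the difference quotients. *)
Lemma weak_partial_chain i u v w Gu Gv Gw L : 0 <= L ->
  locally_integrable_rV u -> locally_integrable_rV v -> locally_integrable_rV w ->
  locally_integrable_rV Gu -> locally_integrable_rV Gv -> locally_integrable_rV Gw ->
  weak_partial i u Gu -> weak_partial i v Gv ->
  (forall x y, `|w x - w y| <= L * (`|u x - u y| + `|v x - v y|)) ->
  {ae mu, forall x (y : nat -> V),
     (fun m => m.+1%:R * (u (y m) - u x)) @ \oo --> Gu x ->
     (fun m => m.+1%:R * (v (y m) - v x)) @ \oo --> Gv x ->
     (fun m => m.+1%:R * (w (y m) - w x)) @ \oo --> Gw x} ->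
  weak_partial i w Gw.
Proof.
move=> L0 lu lv lw lGu lGv lGw uGu vGv wL chain psi tpsi; set e : V := delta_mx ord0 i.
have [r [M [r0 M0 pM dM out]]] := test_function_bounds tpsi.
have [sm _] := (test_functionP _).1 tpsi.
have mpsi := test_function_measurable tpsi.
have pout x : ~ cube r x -> psi x = 0 by move=> /out[].
have lnGu := locally_integrable_norm lGu; have lnGv := locally_integrable_norm lGv.
have mw := locally_integrable_measurable lw.
have mnpsi : measurable_fun setT (fun x => `|psi x|) by exact: measurableT_comp.
have npM x : `| `|psi x| | <= M by rewrite normr_id.
have npout x : ~ cube r x -> `|psi x| = 0 by move=> /pout ->; rewrite normr0.
pose h (m : nat) : R := m.+1%:R^-1.
have h0 m : 0 < h m by rewrite invr_gt0.
have kh m : m.+1%:R * h m = 1 by rewrite /h divff.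
have mE m : measurable (`[0, h m]%classic : set (measurableTypeR R)) by exact: measurable_itv.
have iavg G m : locally_integrable_rV G -> mu.-integrable setT (EFin \o (fun x => line_avg e G m x * `|psi x|)).
  move=> lG; have := integrableZl measurableT (m.+1%:R)
    (integrable_line_mean (delta_le1 i) (mE m) (@segment_bound _ _) lG mnpsi npM npout).
  by congr (is_true (integrable _ _ _)); apply/funext => x /=; rewrite /line_avg -EFinM mulrA.
have inorm G : locally_integrable_rV G -> mu.-integrable setT (EFin \o (fun x => G x * `|psi x|)).
  by move=> lG; exact: integrable_mul_cube lG mnpsi npM npout.
pose g_ m x := L * (line_avg e (fun x => `|Gu x|) m x * `|psi x| + line_avg e (fun x => `|Gv x|) m x * `|psi x|).
pose g x := L * (`|Gu x| * `|psi x| + `|Gv x| * `|psi x|).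
pose I G := (M * \int[mu]_x (`|G x| * \1_(cube (r + 1)) x))%R.
have H1 : (fun m => \int[mu]_x (diff_quotient i w m x * psi x))%R @ \oo --> (\int[mu]_x (Gw x * psi x))%R.
  apply: (@generalized_dominated_convergence _ _ _ mu _ g_ _ g (fun m => h m * (L * (I Gu + I Gv)))).
  - move=> m; apply: measurable_funM => //; apply: measurable_funM => //; apply: measurable_funB => //.
    exact: measurable_fun_shift.
  - by apply: measurable_funM => //; exact: locally_integrable_measurable.
  - by move=> m; exact: (integrableZl measurableT L (integrableD measurableT (iavg _ m lnGu) (iavg _ m lnGv))).
  - exact: (integrableZl measurableT L (integrableD measurableT (inorm _ lnGu) (inorm _ lnGv))).
  - apply: filterS2 (diff_quotient_ae lu lGu uGu) (diff_quotient_ae lv lGv vGv) => x [Bu _] [Bv _] m.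
    rewrite normrM /g_ -mulrDl mulrA ler_wpM2r// (le_trans _ (ler_wpM2l L0 (lerD (Bu m) (Bv m))))//.
    rewrite /diff_quotient !normrM -mulrDr mulrCA ler_wpM2l//.
  - apply: filterS3 (diff_quotient_ae lu lGu uGu) (diff_quotient_ae lv lGv vGv) chain => x [_ cu] [_ cv].
    by move=> /(_ _ cu cv) cw; apply: cvgM => //; exact: cvg_cst.
  - apply: filterS2 (line_avg_cvg (delta_le1 i) lnGu) (line_avg_cvg (delta_le1 i) lnGv) => x cu cv.
    by apply: cvgM; [exact: cvg_cst|apply: cvgD; apply: cvgM => //; exact: cvg_cst].
  - move=> m; rewrite /g_ /g !RintegralZl//; last 2 first.
    + exact: (integrableD measurableT (inorm _ lnGu) (inorm _ lnGv)).
    + exact: (integrableD measurableT (iavg _ m lnGu) (iavg _ m lnGv)).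
    rewrite !RintegralD//; try exact: iavg; try exact: inorm.
    have bu := line_avg_integral_le m (fun x => normr_ge0 (Gu x)) lnGu tpsi pM (dM i) pout.
    have bv := line_avg_integral_le m (fun x => normr_ge0 (Gv x)) lnGv tpsi pM (dM i) pout.
    apply: (le_trans (ler_wpM2l L0 (lerD bu bv))); by rewrite [h m * (L * _)]mulrCA -mulrDr [h m * (I Gu + I Gv)]mulrDr addrACA.
  - rewrite -[X in _ --> X](mul0r (L * (I Gu + I Gv))); apply: cvgM; last exact: cvg_cst.
    exact: cvg_harmonic.
have mdpsi : measurable_fun setT (partial i psi).
  by apply: continuous_measurable_rV; apply: smooth_continuous; exact: smooth_partial.
(* the difference quotient of psi that arises by shifting the one of w *)
pose q m x := m.+1%:R * (psi (x + (- h m) *: e) - psi x).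
have mq m : measurable_fun setT (q m).
  by apply: measurable_funM => //; apply: measurable_funB => //; exact: measurable_fun_shift.
have qM m x : `|q m x| <= M * \1_(cube (r + 1)) x.
  have h1 : h m <= 1 by rewrite invf_le1 ?ler1n.
  have [xc|xc] := pselect (cube (r + 1) x).
    rewrite indicE mem_set// mulr1 /q normrM ger0_norm// -[leRHS]mul1r -[X in _ <= X * _](kh m) -mulrA ler_wpM2l//.
    by rewrite mulrC; exact: test_function_lipschitz tpsi (ltW (h0 m)) (dM i).
  rewrite /q !pout ?subrr ?mulr0 ?normr0 ?mulr_ge0// => /cubeP xr; apply: xc; apply/cubeP => j.
    by rewrite (le_trans (xr j))// lerDl.
  have -> : x ord0 j = (x + (- h m) *: e) ord0 j + h m * e ord0 j by rewrite !mxE; ring.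
  rewrite (le_trans (ler_normD _ _))// lerD// normrM -[leRHS]mulr1 ler_pM//; last exact: delta_le1.
  by rewrite ger0_norm// ltW.
have qc x : q ^~ x @ \oo --> - partial i psi x.
  pose F (t : R) := psi (x + (- t) *: e).
  have d1 : is_derive (0 : R) (1 : R) (fun r : R => - r) (- 1 : R) by exact: is_deriveNid.
  have dF : is_derive (0 : R) 1 F (- partial i psi x).
    have := @is_derive1_comp _ (fun t => psi (x + t *: e)) (fun r => - r) 0 _ _
      (is_derive_line x i (- 0) sm) d1.
    by rewrite oppr0 scale0r addr0 mulrN1.
  have dF0 : derivable F (0 : R) 1 by exact: ex_derive.
  have cF : (fun t => t^-1 *: (F (t *: (1 : R) + 0) - F 0)) @ (0 : R)^' --> - partial i psi x.
    by have := dF0; rewrite /derivable => /cvg_ex[l cl]; have := cl; rewrite -(cvg_lim _ cl)// -/(derive F 0 1) (@derive_val _ _ _ _ _ _ _ dF).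
  have := (cvgr_dnbhsP _ _ _).1 cF h; rewrite /=.
  have -> : (fun m => (h m)^-1 *: (F (h m *: (1 : R) + 0) - F 0)) = q ^~ x.
    by apply/funext => m; rewrite /F /q /h invrK oppr0 scale0r !addr0 [_ *: 1]mulr1.
  apply; split; first by move=> m; rewrite gt_eqF.
  exact: cvg_harmonic.
have mc : measurable_fun setT (\1_(cube (r + 1)) : V -> R) by apply: measurable_indic; exact: measurable_box.
have [iw H2] : mu.-integrable setT (EFin \o (fun x => w x * - partial i psi x)) /\
    (fun m => \int[mu]_x (w x * q m x)%:E)%E @ \oo --> (\int[mu]_x (w x * - partial i psi x)%:E)%E.
  apply: (real_dominated_convergence (g := fun x => `|w x| * (M * \1_(cube (r + 1)) x))) => //.
  - by move=> m; exact: measurable_funM.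
  - by apply: measurable_funM => //; exact: measurableT_comp.
  - by apply: nearW => x _; apply: cvgM; [exact: cvg_cst|exact: qc].
  - apply: (integrable_mul_cube (r := r + 1) (M := M) (locally_integrable_norm lw)).
    + exact: measurable_funM.
    + move=> x; rewrite indicE; case: (_ \in _); rewrite ?mulr1 ?mulr0 ?normr0//.
      by rewrite ger0_norm.
    + by move=> x xc; rewrite indicE memNset ?mulr0.
  - by apply: nearW => x m _; rewrite normrM ler_wpM2l.
have iwp := integrable_mul_test lw tpsi.
have iwd : mu.-integrable setT (EFin \o (fun x => w x * partial i psi x)).
  by apply: (integrable_mul_cube lw mdpsi (dM i)) => x /out[].
have E m : (\int[mu]_x (diff_quotient i w m x * psi x) = \int[mu]_x (w x * q m x))%R.
  have [i2 i2' E2] := shift_test (h m) e lw tpsi.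
  have e2 : (\int[mu]_x (w (x + h m *: e) * psi x) = \int[mu]_x (w x * psi (x + - h m *: e)))%R.
    by congr fine; exact: E2.
  transitivity (m.+1%:R * (\int[mu]_x (w (x + h m *: e) * psi x) - \int[mu]_x (w x * psi x)))%R.
    rewrite -RintegralB// -RintegralZl//; last exact: (integrableB measurableT i2' iwp).
    by apply: eq_Rintegral => x _; rewrite /diff_quotient; ring.
  rewrite e2 -RintegralB// -RintegralZl//; last exact: (integrableB measurableT i2 iwp).
  by apply: eq_Rintegral => x _; rewrite /q; ring.
have H3 : (fun m => \int[mu]_x (w x * q m x))%R @ \oo --> (\int[mu]_x (w x * - partial i psi x))%R.
  by apply: fine_cvg; rewrite fineK//; exact: integrable_fin_num iw.
have : (\int[mu]_x (Gw x * psi x) = \int[mu]_x (w x * - partial i psi x))%R.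
  apply: (cvg_unique _ H1) => //=.
  by rewrite (_ : (fun m => _) = (fun m => \int[mu]_x (w x * q m x))%R)//; apply/funext.
have iGw := integrable_mul_test lGw tpsi.
have -> : (\int[mu]_x (w x * - partial i psi x) = - \int[mu]_x (w x * partial i psi x))%R.
  rewrite -mulN1r -RintegralZl//; apply: eq_Rintegral => x _; ring.
move=> /eqP; rewrite -eqr_oppLR => /eqP EE.
rewrite -(fineK (integrable_fin_num measurableT iwd)) -(fineK (integrable_fin_num measurableT iGw)).
by rewrite -EFinN; congr EFin; exact/esym.
Qed.

End chain_rule.

(** * Sobolev functions *)

Section sobolev_functions.
Context {R : realType} {n : nat}.
Local Notation V := 'rV[R]_n.
Local Notation mu := (@lebesgue_rV R n).
Variable p : R.
Hypothesis p1 : 1 <= p.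
Implicit Types (u v w g G psi : V -> R) (x y : V).

Lemma weak_partial_unique i u G G' : locally_integrable_rV G -> locally_integrable_rV G' ->
  weak_partial i u G -> weak_partial i u G' -> {ae mu, forall x, G x = G' x}.
Proof.
move=> lG lG' uG uG'.
suff : {ae mu, forall x, (G x - G' x) = 0}.
  by apply: filterS => x /eqP; rewrite subr_eq0 => /eqP.
apply: (fundamental_lemma (g := fun x => G x - G' x)) => [a b|psi tpsi].
  by apply: (integrableB _ (locally_integrable_box a b lG) (locally_integrable_box a b lG')); exact: measurable_box.
have iG := integrable_mul_test lG tpsi; have iG' := integrable_mul_test lG' tpsi.
transitivity (\int[mu]_x (G x * psi x)%:E - \int[mu]_x (G' x * psi x)%:E)%E.
  by rewrite -integralB_EFin//; apply: eq_integral => x _; rewrite mulrBl.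
have E : (\int[mu]_x (G x * psi x)%:E = \int[mu]_x (G' x * psi x)%:E)%E.
  by apply: oppe_inj; rewrite -uG// -uG'.
by rewrite E subee//; exact: (integrable_fin_num measurableT iG').
Qed.

Lemma weak_partial_ae i u u' G : measurable_fun setT u -> measurable_fun setT u' ->
  {ae mu, forall x, u x = u' x} -> weak_partial i u G -> weak_partial i u' G.
Proof.
move=> mu_ mu' uu' uG psi tpsi; rewrite -uG//.
have mdpsi : measurable_fun setT (partial i psi).
  apply: continuous_measurable_rV; apply: smooth_continuous; apply: smooth_partial.
  exact: ((test_functionP _).1 tpsi).1.
apply: ae_eq_integral => //; try by apply/measurable_EFinP; exact: measurable_funM.
by apply: filterS uu' => x -> _.
Qed.

(** The chosen weak gradient has the integrability of any other, by uniqueness. *)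
Lemma W1p_wgrad u : W1p p u -> [/\ Lp mu p u,
  forall i, Lp mu p (fun x => wgrad u x ord0 i) &
  forall i, weak_partial i u (fun x => wgrad u x ord0 i)].
Proof.
move=> [/(LfunP_Lp mu p1) Lu [G uG LG]].
have wG : weak_gradient u (wgrad u) by apply: getPex; exists G.
have LpG i := (LfunP_Lp mu p1 _).1 (LG i).
have pw i : weak_partial i u (fun x => wgrad u x ord0 i) by move=> psi tpsi; exact: wG.2.
split=> // i.
have mw := locally_integrable_measurable (wG.1 i).
apply: (@Lp_dominated _ _ _ mu p p1 1 _ _ (fun x => wgrad u x ord0 i) ler01 mw (LpG i) (LpG i)).
have := weak_partial_unique (wG.1 i) (uG.1 i) (pw i) (fun psi t => uG.2 psi t i).
by apply: filterS => x ->; rewrite mul1r lerDl.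
Qed.

Lemma W1p_intro w (Gw : V -> V) : Lp mu p w -> (forall i, Lp mu p (fun x => Gw x ord0 i)) ->
  (forall i, weak_partial i w (fun x => Gw x ord0 i)) ->
  W1p p w /\ {ae mu, forall x, wgrad w x = Gw x}.
Proof.
move=> Lw LG wG; have lG i := Lp_locally_integrable p1 (LG i).
have gG : weak_gradient w Gw by split=> // psi tpsi i; exact: wG.
have W : W1p p w.
  split; first exact/(LfunP_Lp mu p1).
  by exists Gw => // i; exact/(LfunP_Lp mu p1).
split=> //; have [_ Lg wg] := W1p_wgrad W.
have A : forall i, {ae mu, forall x, wgrad w x ord0 i = Gw x ord0 i}.
  by move=> i; exact: weak_partial_unique (Lp_locally_integrable p1 (Lg i)) (lG i) (wg i) (wG i).
have : {ae mu, forall x, forall i, wgrad w x ord0 i = Gw x ord0 i} by exact: filter_forall A.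
by apply: filterS => x E; apply/rowP.
Qed.

Lemma W1p_0_ae Omega u u' : measurable_fun setT u' -> {ae mu, forall x, u x = u' x} ->
  W1p_0 p Omega u -> W1p_0 p Omega u' /\ {ae mu, forall x, wgrad u' x = wgrad u x}.
Proof.
move=> mu' uu' [W u0]; have [Lu LG uG] := W1p_wgrad W.
have Lu' : Lp mu p u'.
  apply: (@Lp_dominated _ _ _ mu p p1 1 _ _ u' ler01 mu' Lu Lu).
  by apply: filterS uu' => x ->; rewrite mul1r lerDl.
have [W' E] := W1p_intro Lu' LG (fun i => weak_partial_ae Lu.1 mu' uu' (uG i)).
by split=> //; split=> //; apply: filterS2 uu' u0 => x <-.
Qed.

Lemma W1p_0_chain Omega u v w (q1 q2 : V -> R) L : 0 <= L ->
  W1p_0 p Omega u -> W1p_0 p Omega v -> measurable_fun setT w ->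
  measurable_fun setT q1 -> measurable_fun setT q2 ->
  (forall x, `|q1 x| <= L) -> (forall x, `|q2 x| <= L) ->
  (forall x, `|w x| <= L * (`|u x| + `|v x|)) ->
  (forall x y, `|w x - w y| <= L * (`|u x - u y| + `|v x - v y|)) ->
  (forall x (y : nat -> V) a b,
     (fun m => m.+1%:R * (u (y m) - u x)) @ \oo --> a ->
     (fun m => m.+1%:R * (v (y m) - v x)) @ \oo --> b ->
     (fun m => m.+1%:R * (w (y m) - w x)) @ \oo --> q1 x * a + q2 x * b) ->
  W1p_0 p Omega w /\ {ae mu, forall x, wgrad w x = q1 x *: wgrad u x + q2 x *: wgrad v x}.
Proof.
move=> L0 [Wu u0] [Wv v0] mw mq1 mq2 q1L q2L w_le wL chain.
have [Lu LGu uG] := W1p_wgrad Wu; have [Lv LGv vG] := W1p_wgrad Wv.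
have Lw : Lp mu p w by apply: (Lp_dominated p1 L0 mw Lu Lv); exact: aeW.
pose Gw x := q1 x *: wgrad u x + q2 x *: wgrad v x.
have LGw i : Lp mu p (fun x => Gw x ord0 i).
  apply: (Lp_dominated p1 L0 _ (LGu i) (LGv i)).
    rewrite /Gw; under eq_fun do rewrite !mxE.
    by apply: measurable_funD; apply: measurable_funM => //; [exact: (LGu i).1|exact: (LGv i).1].
  apply: aeW => x; rewrite /Gw !mxE mulrDr (le_trans (ler_normD _ _))// lerD// normrM ler_wpM2r//.
have li g : Lp mu p g -> locally_integrable_rV g := @Lp_locally_integrable _ _ p p1 g.
have wG i : weak_partial i w (fun x => Gw x ord0 i).
  apply: (weak_partial_chain L0 (li _ Lu) (li _ Lv) (li _ Lw) (li _ (LGu i)) (li _ (LGv i)) (li _ (LGw i))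
    (uG i) (vG i) wL).
  by apply: aeW => x y cu cv; rewrite /Gw !mxE; exact: chain.
have [W E] := W1p_intro Lw LGw wG.
split=> //; split=> //; apply: filterS2 u0 v0 => x ux vx nx.
by apply/eqP; rewrite -normr_le0 (le_trans (w_le x))// ux// vx// normr0 addr0 mulr0.
Qed.

End sobolev_functions.

(** * Inequalities for real powers *)

Section powR_calculus.
Context {R : realType}.
Implicit Types (a b c d r s t p : R).

Lemma powR_continuous r t : 0 < t -> {for t, continuous (@powR R ^~ r)}.
Proof.
move=> t0; apply/differentiable_continuous/derivable1_diffP; apply: ex_derive; exact: is_derive1_powR.
Qed.

Lemma powR_lipschitz r s t M : 0 < s -> 0 < t ->
  (forall c, Num.min s t <= c -> c <= Num.max s t -> c `^ (r - 1) <= M) ->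
  `|s `^ r - t `^ r| <= `|r| * M * `|s - t|.
Proof.
wlog st : s t / s <= t.
  move=> H s0 t0 cM; have /orP[st|ts] := le_total s t; first exact: H.
  by rewrite distrC (distrC s); apply: H => // c; rewrite minC maxC; exact: cM.
move=> s0 t0; rewrite (min_idPl st) (max_idPr st) => cM.
have c1 : {within `[s, t]%classic, continuous (@powR R ^~ r)}.
  apply: continuous_in_subspaceT => x; rewrite inE/= in_itv/= => /andP[sx _].
  by apply: powR_continuous; exact: lt_le_trans sx.
have [x|c] := @MVT_segment R (@powR R ^~ r) (fun x => r * x `^ (r - 1)) s t st _ c1.
  by rewrite in_itv/= => /andP[sx _]; apply: is_derive1_powR; exact: lt_trans sx.
rewrite in_itv/= => /andP[sc ct]; rewrite distrC => ->.
rewrite (distrC s) !normrM (ger0_norm (powR_ge0 _ _)) ler_wpM2r// ler_wpM2l//; exact: cM.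
Qed.

Lemma powR_decr p s t : 0 <= p -> 0 < s -> s <= t -> t `^ (- p) <= s `^ (- p).
Proof.
move=> p0 s0 st; rewrite !powRN lef_pV2 ?posrE ?powR_gt0//; last exact: lt_le_trans st.
by rewrite ge0_ler_powR// nnegrE ltW// (lt_le_trans s0).
Qed.

(** Young's inequality for the exponents p and p / (p - 1). *)
Lemma young_powR p a b : 1 < p -> 0 <= a -> 0 <= b ->
  p * (a `^ (p - 1) * b) <= (p - 1) * a `^ p + b `^ p.
Proof.
move=> p1 a0 b0; have p0 : 0 < p by lra.
have q0 : 0 < p / (p - 1) by rewrite divr_gt0//; lra.
have pq : p^-1 + (p / (p - 1))^-1 = 1 by rewrite invf_div; field; apply/eqP; lra.
have := conjugate_powR b0 (powR_ge0 a (p - 1)) p0 q0 pq.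
rewrite -powRrM (_ : (p - 1) * (p / (p - 1)) = p); last by field; apply/eqP; lra.
rewrite -(ler_pM2l p0) invf_div [b * _]mulrC => /le_trans; apply.
by rewrite le_eqVlt; apply/orP; left; apply/eqP; field; lra.
Qed.

Lemma signed_pow_gt0 p t : 0 < t -> signed_pow p t = t `^ (p - 1).
Proof.
move=> t0; rewrite /signed_pow ger0_norm ?ltW// (_ : p - 1 = p - 2 + 1); last by ring.
by rewrite (@powRD _ t (p - 2) 1) ?powRr1 ?(ltW t0)// (gt_eqF t0) implybT.
Qed.

Lemma powR_mulN p t : 0 < t -> t `^ (p - 1) * t `^ (1 - p) = 1.
Proof. by move=> t0; rewrite -(opprB p 1) powRN divff// gt_eqF// powR_gt0. Qed.

Lemma mulr_powR1B p t : 0 < t -> t * t `^ (- p) = t `^ (1 - p).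
Proof. by move=> t0; rewrite (@powRD _ t 1 (- p)) ?powRr1 ?(ltW t0)// (gt_eqF t0) implybT. Qed.

Lemma signed_powN p t : signed_pow p (- t) = - signed_pow p t.
Proof. by rewrite /signed_pow normrN mulrN. Qed.

Lemma signed_pow0 p : signed_pow p 0 = 0.
Proof. by rewrite /signed_pow mulr0. Qed.

Lemma signed_powM p t : 0 < p -> signed_pow p t * t = `|t| `^ p.
Proof.
move=> p0; have H (x : R) : 0 < x -> signed_pow p x * x = `|x| `^ p.
  by move=> x0; rewrite signed_pow_gt0// mulrC mulr_powRB1 ?gtr0_norm// ltW.
have [t0|t0|->] := ltrgtP t 0; last by rewrite mulr0 normr0 powR0 ?gt_eqF.
  by rewrite -[t in LHS]opprK signed_powN mulrNN -normrN H ?oppr_gt0.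
exact: H.
Qed.

(** By symmetry b < a; put t = b / a. The claim becomes the convexity inequality
    for the p-th power at d / t and |c - d| / (1 - t) with weights t and 1 - t, as
    c <= d + |c - d|. *)
Lemma discrete_picone p a b c d : 1 < p -> 0 < a -> 0 < b -> 0 <= c -> 0 <= d ->
  signed_pow p (a - b) * (c `^ p * a `^ (1 - p) - d `^ p * b `^ (1 - p)) <= `|c - d| `^ p.
Proof.
move=> p1; wlog ba : a b c d / b < a.
  move=> H a0 b0 c0 d0; have [ba|ab|->] := ltrgtP b a; [exact: H| |].
    rewrite -[a - b]opprB signed_powN -[X in _ * X]opprB mulrNN (distrC c).
    exact: H.
  by rewrite subrr signed_pow0 mul0r powR_ge0.
move=> a0 b0 c0 d0; have p0 : 0 < p by lra.
have p1' : 1 <= p by exact: ltW.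
pose t := b / a; have t0 : 0 < t by rewrite divr_gt0.
have t1 : t < 1 by rewrite ltr_pdivrMr// mul1r.
have t1' : 0 < 1 - t by rewrite subr_gt0.
have bE : b = t * a by rewrite /t mulfVK// gt_eqF.
have abE : a - b = (1 - t) * a by rewrite mulrBl mul1r -bE.
clearbody t.
have Vp x y : 0 < x -> 0 <= y -> (y / x) `^ p = y `^ p * x `^ (- p).
  by move=> x0 y0; rewrite powRM ?invr_ge0 ?(ltW x0)// -powR_inv1 ?(ltW x0)// -powRrM mulN1r.
have cv : c `^ p <= t `^ (1 - p) * d `^ p + (1 - t) `^ (1 - p) * `|c - d| `^ p.
  have cd : c <= t * (d / t) + (1 - t) * (`|c - d| / (1 - t)).
    rewrite [t * _]mulrC [(1 - t) * _]mulrC !mulfVK ?gt_eqF//.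
    by have := ler_norm (c - d); lra.
  have cx : (t * (d / t) + (1 - t) * (`|c - d| / (1 - t))) `^ p <=
      t * (d / t) `^ p + (1 - t) * (`|c - d| / (1 - t)) `^ p.
    apply: (@convex_powR R p p1' (Itv01 (ltW t0) (ltW t1))).
      by rewrite inE/= in_itv/= andbT divr_ge0// ltW.
    by rewrite inE/= in_itv/= andbT divr_ge0// ltW.
  have le1 := @ge0_ler_powR R p (ltW p0) c (t * (d / t) + (1 - t) * (`|c - d| / (1 - t))).
  have : c `^ p <= (t * (d / t) + (1 - t) * (`|c - d| / (1 - t))) `^ p.
    by apply: le1; rewrite ?nnegrE// (le_trans c0).
  move=> /le_trans/(_ cx)/le_trans; apply.
  rewrite !Vp// [t * _]mulrCA [(1 - t) * _]mulrCA !mulr_powR1B//.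
  by rewrite le_eqVlt; apply/orP; left; apply/eqP; ring.
rewrite signed_pow_gt0 ?subr_gt0// abE bE !powRM ?(ltW a0) ?(ltW t0) ?(ltW t1')//.
rewrite (_ : _ * _ = (1 - t) `^ (p - 1) * (c `^ p - t `^ (1 - p) * d `^ p) * (a `^ (p - 1) * a `^ (1 - p))); last by ring.
rewrite powR_mulN// mulr1.
have : (1 - t) `^ (p - 1) * (c `^ p - t `^ (1 - p) * d `^ p) <=
    (1 - t) `^ (p - 1) * ((1 - t) `^ (1 - p) * `|c - d| `^ p).
  by rewrite ler_wpM2l ?powR_ge0// lerBlDl.
by rewrite mulrA powR_mulN// mul1r.
Qed.

End powR_calculus.

(** * The regularized Picone test function *)

Section rates.
Context {R : realType}.
Implicit Types (a b al be : R) (aa bb : nat -> R).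

(** First-order behaviour of a sequence along the steps 1 / (m + 1) of the
    difference quotients. *)
Definition rate aa a al := (fun m => m.+1%:R * (aa m - a)) @ \oo --> al.

Lemma rate_cvg aa a al : rate aa a al -> aa @ \oo --> a.
Proof.
move=> ra; have -> : aa = (fun m => a + m.+1%:R^-1 * (m.+1%:R * (aa m - a))).
  by apply/funext => m; rewrite mulKf// addrCA subrr addr0.
rewrite -[X in _ --> X]addr0 -[X in _ --> _ + X](mul0r al); apply: cvgD; first exact: cvg_cst.
by apply: cvgM => //; exact: cvg_harmonic.
Qed.

Lemma rate_cst a : rate (fun=> a) a 0.
Proof. by rewrite /rate; under eq_fun do rewrite subrr mulr0; exact: cvg_cst. Qed.

Lemma rateD aa bb a b al be : rate aa a al -> rate bb b be ->
  rate (fun m => aa m + bb m) (a + b) (al + be).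
Proof.
rewrite /rate => ra rb.
under eq_fun do rewrite opprD addrACA mulrDr.
exact: cvgD.
Qed.

Lemma rateM aa bb a b al be : rate aa a al -> rate bb b be ->
  rate (fun m => aa m * bb m) (a * b) (al * b + a * be).
Proof.
move=> ra rb; have cb := rate_cvg rb.
rewrite /rate (_ : (fun m => _) =
  (fun m => (m.+1%:R * (aa m - a)) * bb m + a * (m.+1%:R * (bb m - b)))); last first.
  by apply/funext => m; ring.
by apply: cvgD; apply: cvgM => //; exact: cvg_cst.
Qed.

(** The quotient of increments of g, completed by the derivative where the
    argument does not move, converges to the derivative. *)
Lemma rate_comp (g : R -> R) (dg : R) aa a al : is_derive a 1 g dg -> rate aa a al ->
  rate (fun m => g (aa m)) (g a) (dg * al).
Proof.
move=> [/cvg_ex[l cl] dE] ra; have {dE} El : l = dg by rewrite -dE; exact/esym/cvg_lim.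
(* the quotient of increments, with the derivative as value where it is 0 / 0 *)
pose D m := if aa m == a then dg else (g (aa m) - g a) / (aa m - a).
suff cD : D @ \oo --> dg.
  rewrite /rate (_ : (fun m => _) = (fun m => D m * (m.+1%:R * (aa m - a)))); first exact: cvgM.
  apply/funext => m; rewrite /D; case: eqVneq => [->|am]; first by rewrite !subrr !mulr0.
  by rewrite mulrCA divfK// subr_eq0.
have c0 : (fun m => aa m - a) @ \oo --> 0 by apply/subr_cvg0; exact: rate_cvg ra.
apply/cvgrPdist_le => e e0.
have /cvgrPdist_le/(_ e e0) := cl; rewrite near_withinE => H.
have := c0 _ H; rewrite /nbhs/=; apply: filterS => m /= Hm.
rewrite /D; case: eqVneq => [_|am]; first by rewrite subrr normr0 ltW.
have := Hm; rewrite subr_eq0 => /(_ am).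
by rewrite El /= [_ *: 1]mulr1 subrK [_ *: _]mulrC.
Qed.

End rates.

(* Comparing distinct powers must not unfold them into exponentials. *)
Local Opaque powR.

Section picone_test.
Context {R : realType}.
Variables (p : R) (p1 : 1 < p).
Implicit Types (a b e t : R).

Let p0 : 0 < p. Proof. exact: lt_trans ltr01 p1. Qed.

Let p10 : 0 <= p - 1. Proof. by rewrite subr_ge0 ltW. Qed.

(** The function b / (1 + e b): bounded by 1 / e, 1-Lipschitz and increasing to b
    as e tends to 0. Writing the inverse as a real power lets one rule give
    measurability and derivatives. *)
Definition trunc e b : R := b * (1 + e * b) `^ (-1).

(** The derivative (1 + e b)^(-2) of the truncation, in the form produced by the
    product rule. *)
Definition dtrunc e b : R := (1 + e * b) `^ (-1) - e * b * (1 + e * b) `^ (- 1 - 1).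

(** The Picone test function u - v^p u^(1-p), regularized so as to be a Lipschitz
    function of (u, v) that vanishes at the origin. *)
Definition picone_test e a b : R := a + e - (trunc e b + e) `^ p * (a + e) `^ (1 - p).

Definition picone_ratio e a b : R := (trunc e b + e) / (a + e).

Let picone_testB e a b a' b' : picone_test e a b - picone_test e a' b' = (a - a') -
  ((trunc e b + e) `^ p * (a + e) `^ (1 - p) - (trunc e b' + e) `^ p * (a' + e) `^ (1 - p)).
Proof.
have E (x y z A B : R) : x + z - A - (y + z - B) = (x - y) - (A - B) by ring.
exact: E.
Qed.

Section fixed.
Variables (e : R) (e0 : 0 < e).

Let den b : 0 <= b -> 0 < 1 + e * b.
Proof. by move=> b0; rewrite ltr_pwDl// mulr_ge0// ltW. Qed.

Lemma truncE b : 0 <= b -> trunc e b = b / (1 + e * b).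
Proof. by move=> /den/ltW b0; rewrite /trunc powR_inv1. Qed.

Lemma trunc_ge0 b : 0 <= b -> 0 <= trunc e b.
Proof. by move=> b0; rewrite truncE// divr_ge0// ltW// den. Qed.

Lemma trunc_le b : 0 <= b -> trunc e b <= b.
Proof.
move=> b0; rewrite truncE// ler_pdivrMr ?den// mulrDr mulr1 lerDl !mulr_ge0// ltW//.
Qed.

Lemma trunc_le_inv b : 0 <= b -> trunc e b <= e^-1.
Proof.
move=> b0; rewrite truncE// ler_pdivrMr ?den// mulrDr mulr1 mulKf ?gt_eqF// lerDr invr_ge0 ltW//.
Qed.

Lemma trunc_lipschitz b b' : 0 <= b -> 0 <= b' -> `|trunc e b - trunc e b'| <= `|b - b'|.
Proof.
move=> b0 b0'; rewrite !truncE//.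
have [d d'] := (den b0, den b0').
have -> : b / (1 + e * b) - b' / (1 + e * b') = (b - b') / ((1 + e * b) * (1 + e * b')).
  by field; rewrite !gt_eqF.
rewrite normrM ler_piMr// normfV gtr0_norm ?mulr_gt0// invf_le1 ?mulr_gt0//.
have [x0 y0] : 0 <= e * b /\ 0 <= e * b' by split; rewrite mulr_ge0// ltW.
by move: (e * b) (e * b') x0 y0 => x y x0 y0; have := mulr_ge0 x0 y0; nra.
Qed.

Lemma dtrunc_bound b : 0 <= b -> 0 <= dtrunc e b <= 1.
Proof.
move=> b0; have d := den b0; have x0 : 0 <= e * b by rewrite mulr_ge0// ltW.
have -> : dtrunc e b = (1 + e * b)^-1 ^+ 2.
  rewrite /dtrunc (@powRD _ _ (-1) (-1)) ?(gt_eqF d) ?implybT// powR_inv1 ?ltW//.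
  by field; rewrite gt_eqF.
by rewrite exprn_ge0 ?invr_ge0 ?(ltW d)//= exprn_ile1 ?invr_ge0 ?(ltW d)// invf_le1// lerDl.
Qed.

Lemma rate_trunc (b_ : nat -> R) b be : 0 <= b -> rate b_ b be ->
  rate (fun m => trunc e (b_ m)) (trunc e b) (dtrunc e b * be).
Proof.
move=> b0 rb; rewrite /trunc.
have r1 := rateD (rate_cst 1) (rateM (rate_cst e) rb).
have := rateM rb (rate_comp (is_derive1_powR (-1) (den b0)) r1).
by congr rate; rewrite /dtrunc; ring.
Qed.

Lemma rate_picone_test (a_ b_ : nat -> R) a b al be : 0 <= a -> 0 <= b ->
  rate a_ a al -> rate b_ b be ->
  rate (fun m => picone_test e (a_ m) (b_ m)) (picone_test e a b)
    ((1 + (p - 1) * picone_ratio e a b `^ p) * al +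
     (- p * picone_ratio e a b `^ (p - 1) * dtrunc e b) * be).
Proof.
move=> a0 b0 ra rb.
have ae : 0 < a + e by rewrite ltr_wpDl.
have te : 0 < trunc e b + e by rewrite ltr_wpDl// trunc_ge0.
have rA := rateD ra (rate_cst e).
have rB := rateD (rate_trunc b0 rb) (rate_cst e).
have rP := rateM (rate_comp (is_derive1_powR p te) rB) (rate_comp (is_derive1_powR (1 - p) ae) rA).
have := rateD rA (rateM (rate_cst (-1)) rP).
rewrite (_ : (fun m => _) = (fun m => picone_test e (a_ m) (b_ m))); last first.
  by apply/funext => m; rewrite /picone_test mulN1r.
rewrite (_ : a + e + -1 * _ = picone_test e a b); last by rewrite /picone_test mulN1r.
congr rate.
have X r : picone_ratio e a b `^ r = (trunc e b + e) `^ r * (a + e) `^ (- r).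
  rewrite /picone_ratio powRM ?invr_ge0 ?ltW//; congr (_ * _).
  by rewrite -powR_inv1 ?ltW// -powRrM mulN1r.
rewrite !X (_ : 1 - p - 1 = - p); last by ring.
rewrite (_ : - (p - 1) = 1 - p); last by ring.
ring.
Qed.

(** The regularized base lies in [e, 1 / e + e] for the truncated variable and in
    [e, +oo) for the other one, where the powers involved have bounded
    derivatives. *)
Lemma picone_test_bounds : exists2 L, 0 <= L &
  (forall a b a' b', 0 <= a -> 0 <= b -> 0 <= a' -> 0 <= b' ->
    `|picone_test e a b - picone_test e a' b'| <= L * (`|a - a'| + `|b - b'|)) /\
  (forall a b, 0 <= a -> 0 <= b -> `|1 + (p - 1) * picone_ratio e a b `^ p| <= L /\
    `|- p * picone_ratio e a b `^ (p - 1) * dtrunc e b| <= L).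
Proof.
have ei : 0 < e^-1 by rewrite invr_gt0.
(* K bounds the truncated variable plus e; L1 to L4 bound the contributions to the
   increments in a and in b, and the two partial derivatives *)
pose K := e^-1 + e; have K0 : 0 < K by rewrite addr_gt0.
pose L1 := K `^ p * ((p - 1) * e `^ (- p)).
pose L2 := e `^ (1 - p) * (p * K `^ (p - 1)).
pose L3 := 1 + (p - 1) * (K / e) `^ p.
pose L4 := p * (K / e) `^ (p - 1).
have [L10 L20 L30 L40] : [/\ 0 <= L1, 0 <= L2, 0 <= L3 & 0 <= L4].
  by split; rewrite ?addr_ge0// ?mulr_ge0 ?powR_ge0// ltW.
have ae a : 0 <= a -> e <= a + e by move=> ?; rewrite lerDr.
have te b : 0 <= b -> e <= trunc e b + e by move=> ?; rewrite lerDr trunc_ge0.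
have tK b : 0 <= b -> trunc e b + e <= K by move=> ?; rewrite lerD2r trunc_le_inv.
exists (1 + L1 + L2 + L3 + L4); first by do 4!(apply: addr_ge0 => //).
split=> [a b a' b' a0 b0 a0' b0'|a b a0 b0].
  have -> : picone_test e a b - picone_test e a' b' = (a - a') -
      (trunc e b + e) `^ p * ((a + e) `^ (1 - p) - (a' + e) `^ (1 - p)) -
      (a' + e) `^ (1 - p) * ((trunc e b + e) `^ p - (trunc e b' + e) `^ p).
    rewrite picone_testB.
    by move: (_ `^ p) (_ `^ p) (_ `^ (1 - p)) (_ `^ (1 - p)) => A B C D; ring.
  have pos a1 : 0 <= a1 -> 0 < a1 + e by move=> ?; exact: lt_le_trans (ae _ _).
  have pos' b1 : 0 <= b1 -> 0 < trunc e b1 + e by move=> ?; exact: lt_le_trans (te _ _).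
  have A : `|(a + e) `^ (1 - p) - (a' + e) `^ (1 - p)| <= (p - 1) * e `^ (- p) * `|a - a'|.
    have := @powR_lipschitz R (1 - p) (a + e) (a' + e) (e `^ (- p)) (pos _ a0) (pos _ a0').
    rewrite (_ : a + e - (a' + e) = a - a'); last by ring.
    rewrite (_ : `|1 - p| = p - 1); last by rewrite distrC gtr0_norm// subr_gt0.
    apply => c; rewrite ge_min => /orP[] ac _; rewrite (_ : 1 - p - 1 = - p) ?powR_decr ?(ltW p0)//; try by ring.
      exact: le_trans (ae _ _) ac.
    exact: le_trans (ae _ _) ac.
  have B : `|(trunc e b + e) `^ p - (trunc e b' + e) `^ p| <= p * K `^ (p - 1) * `|b - b'|.
    have := @powR_lipschitz R p (trunc e b + e) (trunc e b' + e) (K `^ (p - 1)) (pos' _ b0) (pos' _ b0').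
    rewrite (_ : trunc e b + e - (trunc e b' + e) = trunc e b - trunc e b'); last by ring.
    rewrite (gtr0_norm p0) => H; apply: le_trans (H _) _; last first.
      by rewrite ler_wpM2l ?mulr_ge0 ?powR_ge0 ?(ltW p0)// trunc_lipschitz.
    move=> c; rewrite le_max => lc /orP lc'.
    have c0 : 0 <= c.
      by move: lc; rewrite ge_min => /orP[] /(le_trans _)-> //; rewrite ltW// pos'.
    rewrite ge0_ler_powR ?nnegrE ?(ltW K0)//.
    by case: lc' => /le_trans->//; exact: tK.
  have hA : `|(trunc e b + e) `^ p| <= K `^ p.
    rewrite ger0_norm ?powR_ge0// ge0_ler_powR ?nnegrE ?(ltW p0) ?(ltW K0)// ?tK//.
    exact/ltW/pos'.
  have hB : `|(a' + e) `^ (1 - p)| <= e `^ (1 - p).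
    by rewrite ger0_norm ?powR_ge0// -(opprB p 1) powR_decr ?ae.
  apply: (@le_trans _ _ (`|a - a'| + L1 * `|a - a'| + L2 * `|b - b'|)).
    rewrite (le_trans (ler_normB _ _))// lerD//.
      rewrite (le_trans (ler_normB _ _))// lerD// normrM /L1 -mulrA ler_pM//.
    by rewrite normrM /L2 -mulrA ler_pM.
  move: L10 L20 L30 L40 (normr_ge0 (a - a')) (normr_ge0 (b - b')).
  move: L1 L2 L3 L4 `|a - a'| `|b - b'| => l1 l2 l3 l4 x y ????? y0.
  rewrite mulrDr lerD//; last by rewrite ler_wpM2r//; lra.
  by rewrite -[X in X + _]mul1r -mulrDl ler_wpM2r//; lra.
have X0 : 0 <= picone_ratio e a b by rewrite divr_ge0// ltW// (lt_le_trans e0) ?te ?ae.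
have XK : picone_ratio e a b <= K / e.
  rewrite /picone_ratio ler_pM ?invr_ge0 ?tK//.
  - by rewrite ltW// (lt_le_trans e0) ?te.
  - by rewrite ltW// (lt_le_trans e0) ?ae.
  - by rewrite lef_pV2 ?posrE ?ae// (lt_le_trans e0) ?ae.
have Ke0 : 0 <= K / e by rewrite (le_trans X0).
have Xp r : 0 <= r -> picone_ratio e a b `^ r <= (K / e) `^ r.
  by move=> r0; rewrite ge0_ler_powR.
split.
  rewrite ger0_norm ?addr_ge0 ?mulr_ge0 ?powR_ge0//.
  apply: (@le_trans _ _ L3); first by rewrite lerD2l ler_wpM2l// Xp// ltW.
  by move: L1 L2 L3 L4 L10 L20 L30 L40 => *; lra.
rewrite -mulrA mulNr normrN normrM (gtr0_norm p0) normrM.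
have /andP[d0 d1] := dtrunc_bound b0.
apply: (@le_trans _ _ L4); last by move: L1 L2 L3 L4 L10 L20 L30 L40 => *; lra.
rewrite ler_wpM2l ?(ltW p0)// -[leRHS]mulr1 ler_pM// ?ger0_norm ?powR_ge0//.
exact: Xp.
Qed.

Lemma picone_test00 : picone_test e 0 0 = 0.
Proof.
rewrite /picone_test /trunc mul0r !add0r -powRD ?(gt_eqF e0) ?implybT//.
by rewrite (_ : p + (1 - p) = 1) ?powRr1 ?subrr ?ltW//; ring.
Qed.

Lemma picone_test_le a b : picone_test e a b <= a + e.
Proof. by rewrite /picone_test gerBl mulr_ge0 ?powR_ge0. Qed.

Lemma picone_testN_le a b : 0 <= a -> 0 <= b ->
  - picone_test e a b <= (b + e) `^ p * (a + e) `^ (1 - p).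
Proof.
move=> a0 b0; rewrite /picone_test opprB.
have : (trunc e b + e) `^ p * (a + e) `^ (1 - p) <= (b + e) `^ p * (a + e) `^ (1 - p).
  rewrite ler_wpM2r ?powR_ge0// ge0_ler_powR ?nnegrE ?lerD2r ?trunc_le ?(ltW p0)//.
  by rewrite addr_ge0 ?trunc_ge0// ltW.
  by rewrite addr_ge0// ltW.
by apply: le_trans; rewrite gerBl addr_ge0// ltW.
Qed.

(** The discrete Picone inequality at a + e, a' + e, T(b) + e, T(b') + e, where T
    is 1-Lipschitz. Exchanging the roles of (a, a') and (b, b') changes the sign
    of the left-hand side. *)
Lemma nonlocal_picone a b a' b' : 0 <= a -> 0 <= b -> 0 <= a' -> 0 <= b' ->
  `|a - a'| `^ p - `|b - b'| `^ p <=
  signed_pow p (a - a') * (picone_test e a b - picone_test e a' b').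
Proof.
move=> a0 b0 a0' b0'.
have pos a1 : 0 <= a1 -> 0 < a1 + e by move=> ?; rewrite ltr_wpDl.
have pos' b1 : 0 <= b1 -> 0 <= trunc e b1 + e by move=> ?; rewrite addr_ge0 ?trunc_ge0// ltW.
have := discrete_picone p1 (pos _ a0) (pos _ a0') (pos' _ b0) (pos' _ b0').
have E x y : x + e - (y + e) = x - y by ring.
rewrite !E => H.
have H2 : `|trunc e b - trunc e b'| `^ p <= `|b - b'| `^ p.
  by rewrite ge0_ler_powR ?nnegrE ?(ltW p0)// trunc_lipschitz.
rewrite picone_testB.
rewrite mulrBr signed_powM//; move: H H2.
move: (signed_pow _ _ * _) => x; lra.
Qed.

End fixed.
End picone_test.

(** * Limits and bounds of the regularized test function *)

Section picone_limits.
Context {R : realType}.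
Variables (p : R) (p1 : 1 < p).
Implicit Types (a b c t : R).

Let p0 : 0 < p. Proof. exact: lt_trans ltr01 p1. Qed.

Let p10 : 0 <= p - 1. Proof. by rewrite subr_ge0 ltW. Qed.

Local Notation ep := (fun m : nat => m.+1%:R^-1 : R).

Let ep0 m : 0 < ep m. Proof. by rewrite invr_gt0. Qed.

Let ep1 m : ep m <= 1. Proof. by rewrite invf_le1 ?ler1n. Qed.

Let cep : ep @ \oo --> (0 : R). Proof. exact: cvg_harmonic. Qed.

Lemma trunc_cvg b : (fun m => trunc (ep m) b) @ \oo --> b.
Proof.
rewrite -[X in _ --> X]mulr1; apply: cvgM; first exact: cvg_cst.
have c1 : (fun m => 1 + ep m * b) @ \oo --> (1 : R).
  rewrite -[X in _ --> X]addr0 -[X in _ --> _ + X](mul0r b); apply: cvgD; first exact: cvg_cst.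
  by apply: cvgM => //; exact: cvg_cst.
have := cvg_comp _ _ c1 (@powR_continuous R (-1) 1 ltr01).
by rewrite (_ : 1 `^ (-1) = 1)// powR1.
Qed.

Lemma picone_test_cvg a b : 0 < a -> 0 < b ->
  (fun m => picone_test p (ep m) a b) @ \oo --> a - b `^ p * a `^ (1 - p).
Proof.
move=> a0 b0.
have ca : (fun m => a + ep m) @ \oo --> a.
  by rewrite -[X in _ --> X]addr0; apply: cvgD => //; exact: cvg_cst.
have cb : (fun m => trunc (ep m) b + ep m) @ \oo --> b.
  by rewrite -[X in _ --> X]addr0; apply: cvgD => //; exact: trunc_cvg.
apply: cvgB => //; apply: cvgM.
  exact: cvg_comp _ _ cb (powR_continuous b0).
exact: cvg_comp _ _ ca (powR_continuous a0).
Qed.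

Lemma ge_natr_powR_near (A k : R) : 0 < k -> \forall m \near \oo, A <= k * m.+1%:R `^ (p - 1).
Proof.
move=> k0; have q0 : 0 < p - 1 by rewrite subr_gt0.
(* the solution of k B^(p-1) = |A| *)
pose B := (`|A| / k) `^ (p - 1)^-1.
exists (Num.truncn B) => // m /= Bm.
have BB : B <= m.+1%:R.
  by rewrite (le_trans (ltW (truncnS_gt _)))// ler_nat ltnS.
have : B `^ (p - 1) <= m.+1%:R `^ (p - 1) by rewrite ge0_ler_powR ?nnegrE ?powR_ge0 ?ler0n.
rewrite /B -powRrM mulVf ?gt_eqF// powRr1 ?divr_ge0 ?(ltW k0)// ler_pdivrMr// mulrC.
by apply: le_trans; exact: ler_norm.
Qed.

(** Where the first variable vanishes, the factor e^(1-p) is not compensated. *)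
Lemma picone_test0_le m b : 0 < b ->
  picone_test p (ep m) 0 b <= 1 - (b / (1 + b)) `^ p * m.+1%:R `^ (p - 1).
Proof.
move=> b0; have b1 : 0 < 1 + b by rewrite addr_gt0.
rewrite /picone_test add0r; apply: lerB => //.
have -> : m.+1%:R^-1 `^ (1 - p) = m.+1%:R `^ (p - 1) :> R.
  by rewrite -[m.+1%:R^-1](powR_inv1 (ler0n R m.+1)) -powRrM mulN1r opprB.
rewrite ler_wpM2r ?powR_ge0// ge0_ler_powR ?nnegrE ?(ltW p0)//.
- by rewrite divr_ge0// ltW.
- by rewrite addr_ge0 ?trunc_ge0 ?ltW.
rewrite ler_wpDr ?(ltW (ep0 m))// truncE ?(ltW b0)//.
rewrite ler_wpM2l ?(ltW b0)// lef_pV2 ?posrE//; first by rewrite lerD2l ler_piMl// ltW.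
by rewrite addr_gt0// mulr_gt0.
Qed.

(** The density at a pair of points where u is 0 and t > 0 respectively, the other
    function being b > 0 and c there. *)
Lemma nonlocal_diverge t b c (A : R) : 0 < t -> 0 < b -> 0 <= c -> \forall m \near \oo,
  A <= signed_pow p (0 - t) * (picone_test p (ep m) 0 b - picone_test p (ep m) t c).
Proof.
move=> t0 b0 c0.
pose k := (b / (1 + b)) `^ p.
have k0 : 0 < k by rewrite powR_gt0// divr_gt0// addr_gt0.
have tp0 : 0 < t `^ (p - 1) by rewrite powR_gt0.
have := ge_natr_powR_near (A / t `^ (p - 1) + 1 + (c + 1) `^ p * t `^ (1 - p)) k0.
apply: filterS => m Hm.
rewrite sub0r signed_powN mulNr -mulrN opprB signed_pow_gt0//.
rewrite -ler_pdivrMl// mulrC.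
have H1 := picone_test0_le m b0; rewrite -/k in H1.
have H2 : - picone_test p (ep m) t c <= (c + 1) `^ p * t `^ (1 - p).
  apply: le_trans (picone_testN_le p1 (ep0 m) (ltW t0) c0) _.
  rewrite ler_pM ?powR_ge0//.
    rewrite ge0_ler_powR ?nnegrE ?(ltW p0) ?lerD2l//; rewrite addr_ge0// ltW//.
  by rewrite -(opprB p 1) powR_decr// lerDl ltW.
by move: H1 H2 Hm; move: (k * _) (A / _) (_ * t `^ _) => x y z; lra.
Qed.

Section growth.
Variables (cf rho : R) (cf0 : 0 < cf) (rho0 : 0 < rho).

Let growth_le a : 0 <= a -> 1 + a `^ (p - 1) <= 2 * (1 + a) `^ (p - 1).
Proof.
move=> a0; rewrite mulr_natl mulr2n lerD//.
  rewrite -[leLHS](powRr0 (1 + a)) ler_powR// lerDl//.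
by rewrite ge0_ler_powR// ?nnegrE ?addr_ge0// lerDr.
Qed.

Let powRS a : 0 <= a -> (1 + a) `^ (p - 1) * (1 + a) = (1 + a) `^ p.
Proof. by move=> a0; rewrite mulrC mulr_powRB1// addr_ge0. Qed.

(** If f >= 0 then the test function is at most a + e. If f < 0 then a >= rho and
    minus the test function is at most (1 + b)^p a^(1-p), which turns the growth
    a^(p-1) of f into a constant. *)
Lemma reaction_le (e f a b : R) : 0 < e -> e <= 1 -> 0 <= a -> 0 <= b ->
  `|f| <= cf * (1 + a `^ (p - 1)) -> (f < 0 -> rho <= a) ->
  f * picone_test p e a b <=
    (2 * cf + cf * (1 + rho `^ (1 - p))) * ((1 + a) `^ p + (1 + b) `^ p).
Proof.
move=> e0 e1 a0 b0 fc fr.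
have K0 : 0 <= cf * (1 + rho `^ (1 - p)) by rewrite mulr_ge0 ?(ltW cf0)// addr_ge0// powR_ge0.
have [f0|f0] := leP 0 f.
  apply: (@le_trans _ _ (2 * cf * (1 + a) `^ p)); last first.
    by rewrite ler_pM ?mulr_ge0 ?powR_ge0 ?(ltW cf0)//; rewrite ?lerDl// powR_ge0.
  apply: (@le_trans _ _ (f * (1 + a))).
    by rewrite ler_wpM2l// (le_trans (picone_test_le _ _ _ _))// addrC lerD2r.
  rewrite -powRS// mulrA ler_wpM2r ?addr_ge0//.
  rewrite ger0_norm// in fc; by rewrite (le_trans fc)// -mulrA mulrCA; apply: ler_wpM2l; [exact: ltW|exact: growth_le].
have ra := fr f0; have a00 : 0 < a := lt_le_trans rho0 ra.
apply: (@le_trans _ _ (cf * (1 + rho `^ (1 - p)) * (1 + b) `^ p)); last first.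
  by rewrite ler_pM ?powR_ge0//; rewrite ?lerDr ?powR_ge0// mulr_ge0// ltW.
rewrite -[f]opprK mulNr -mulrN.
apply: (@le_trans _ _ (- f * ((b + e) `^ p * (a + e) `^ (1 - p)))).
  by rewrite ler_wpM2l ?oppr_ge0 ?(ltW f0)// picone_testN_le.
rewrite ltr0_norm// in fc.
apply: (@le_trans _ _ (cf * (1 + a `^ (p - 1)) * ((1 + b) `^ p * a `^ (1 - p)))).
  rewrite ler_pM ?oppr_ge0 ?(ltW f0) ?mulr_ge0 ?powR_ge0// ler_pM ?powR_ge0//.
    by rewrite addrC ge0_ler_powR ?nnegrE ?(ltW p0) ?addr_ge0 ?(ltW e0)// lerD2r.
  by rewrite -(opprB p 1) powR_decr// lerDl ltW.
have -> : cf * (1 + a `^ (p - 1)) * ((1 + b) `^ p * a `^ (1 - p)) =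
    cf * (a `^ (1 - p) + a `^ (p - 1) * a `^ (1 - p)) * (1 + b) `^ p.
  by move: (a `^ (p - 1)) (a `^ (1 - p)) (_ `^ p) => x y z; ring.
rewrite powR_mulN// addrC ler_wpM2r ?powR_ge0// ler_wpM2l ?(ltW cf0)// lerD2l.
by rewrite -(opprB p 1) powR_decr.
Qed.

Lemma reaction_norm_le (L f a b w : R) : 0 <= a -> 0 <= b -> 0 <= L ->
  `|f| <= cf * (1 + a `^ (p - 1)) -> `|w| <= L * (a + b) ->
  `|f * w| <= 4 * cf * L * ((1 + a) `^ p + (1 + b) `^ p).
Proof.
move=> a0 b0 L0 fc wL; rewrite normrM.
apply: (@le_trans _ _ (cf * (2 * (1 + a) `^ (p - 1)) * (L * ((1 + a) + (1 + b))))).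
  rewrite ler_pM//; first by rewrite (le_trans fc)// ler_wpM2l ?growth_le// ltW.
  rewrite (le_trans wL)// ler_wpM2l//; lra.
have : (1 + a) `^ (p - 1) * (1 + a + (1 + b)) <= 2 * ((1 + a) `^ p + (1 + b) `^ p).
  rewrite mulrDr powRS//.
  have := young_powR p1 (addr_ge0 ler01 a0) (addr_ge0 ler01 b0).
  have := powR_ge0 (1 + a) p; have := powR_ge0 (1 + b) p.
  have : 0 <= (1 + a) `^ (p - 1) * (1 + b) by rewrite mulr_ge0 ?powR_ge0 ?addr_ge0.
  move: ((1 + a) `^ (p - 1) * _) (_ `^ p) (_ `^ p) => x y z x0 z0 y0.
  move=> H; have : x <= y + z; last by lra.
  rewrite -(ler_pM2l p0) (le_trans H)// mulrDr lerD//; first by rewrite ler_wpM2r// gerBl.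
  by rewrite ler_peMl// ltW.
move: (_ `^ (p - 1)) (_ `^ p + _) => x y xy.
have cL : 0 <= 2 * cf * L by rewrite !mulr_ge0// ltW.
have := ler_wpM2l cL xy; rewrite (_ : 2 * cf * L * (2 * y) = 4 * cf * L * y); last by ring.
by apply: le_trans; rewrite le_eqVlt; apply/orP; left; apply/eqP; ring.
Qed.

End growth.
End picone_limits.

(** * Finsler-Minkowski norms *)

Section finsler.
Context {R : realType} {n : nat}.
Local Notation V := 'rV[R]_n.
Variables (H : V -> R) (hH : finsler_minkowski_norm H).
Implicit Types (xi eta x y : V).

Lemma finsler0 : H 0 = 0. Proof. exact/(fm_eq0 hH). Qed.

Lemma finslerN x : H (- x) = H x.
Proof. by rewrite -scaleN1r (fm_homogeneous hH) normrN1 mul1r. Qed.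

(** Strict convexity concerns independent vectors; dependent ones are left to
    homogeneity. *)
Lemma finsler_triangle x y : H (x + y) <= H x + H y.
Proof.
have [/(fm_strictly_convex hH)/ltW//|] := boolP (free [:: x; y]).
rewrite free_cons seq1_free span_seq1 negb_and !negbK => /orP[/vlineP[k ->]|/eqP ->]; last first.
  by rewrite addr0 finsler0 addr0.
rewrite -[X in H (_ + X)]scale1r -scalerDl !(fm_homogeneous hH) -[X in _ <= _ + X]mul1r -mulrDl.
by rewrite ler_wpM2r ?(fm_ge0 hH)// (le_trans (ler_normD _ _))// normr1.
Qed.

Lemma dotrV_diff (g : V -> R) x y : differentiable g x -> dotrV (grad g x) y = 'D_y g x.
Proof.
move=> dg; rewrite deriveE// [in RHS](row_sum_delta y) linear_sum /dotrV.
by apply: eq_bigr => i _; rewrite linearZ/= /grad mxE /partial deriveE// mulrC.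
Qed.

Lemma dot_grad_cvg xi eta : xi != 0 ->
  (fun m : nat => m.+1%:R * (H (xi + m.+1%:R^-1 *: eta) - H xi)) @ \oo --> dotrV (grad H xi) eta.
Proof.
move=> xi0; have [dH _] := fm_C1 hH xi0; rewrite dotrV_diff//.
have := diff_derivable (v := eta) dH; rewrite /derivable => /cvg_ex[l cl].
have El : 'D_eta H xi = l by exact: cvg_lim cl.
rewrite El.
have := (cvgr_dnbhsP (fun h => h^-1 *: (H (h *: eta + xi) - H xi)) 0 l).1 cl (fun m => m.+1%:R^-1).
have -> : (fun m : nat => m.+1%:R * (H (xi + m.+1%:R^-1 *: eta) - H xi)) =
   (fun m : nat => (m.+1%:R^-1)^-1 *: (H (m.+1%:R^-1 *: eta + xi) - H xi)).
  by apply/funext => m; rewrite [xi + _]addrC invrK.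
by apply; split=> [m|]; [rewrite gt_eqF|exact: cvg_harmonic].
Qed.

(** The difference quotients are at most H(eta) by the triangle inequality. *)
Lemma dot_grad_le xi eta : xi != 0 -> dotrV (grad H xi) eta <= H eta.
Proof.
move=> xi0; have cg := @dot_grad_cvg xi eta xi0.
rewrite -(cvg_lim _ cg)//; apply: limr_le; first by apply/cvg_ex; exists (dotrV (grad H xi) eta).
apply: nearW => m; rewrite -ler_pdivlMl// lerBlDl.
by rewrite (le_trans (finsler_triangle _ _))// (fm_homogeneous hH) ger0_norm.
Qed.

Lemma dotrVN x y : dotrV x (- y) = - dotrV x y.
Proof. by rewrite /dotrV -sumrN; apply: eq_bigr => i _; rewrite mxE mulrN. Qed.

Lemma dotrVDr x y z : dotrV x (y + z) = dotrV x y + dotrV x z.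
Proof. by rewrite /dotrV -big_split; apply: eq_bigr => i _; rewrite mxE mulrDr. Qed.

Lemma dotrVZr a x y : dotrV x (a *: y) = a * dotrV x y.
Proof. by rewrite /dotrV mulr_sumr; apply: eq_bigr => i _; rewrite mxE mulrCA. Qed.

Lemma dotrVZl a x y : dotrV (a *: x) y = a * dotrV x y.
Proof. by rewrite /dotrV mulr_sumr; apply: eq_bigr => i _; rewrite mxE mulrA. Qed.

Lemma dotrV0l x : dotrV 0 x = 0.
Proof. by rewrite /dotrV big1// => i _; rewrite mxE mul0r. Qed.

Lemma dot_grad_norm_le xi eta : xi != 0 -> `|dotrV (grad H xi) eta| <= H eta.
Proof.
move=> xi0; rewrite ler_norml dot_grad_le// andbT lerNl -dotrVN -[leRHS]finslerN.
exact: dot_grad_le.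
Qed.

(** Euler's identity for a function that is homogeneous of degree 1. *)
Lemma dot_grad_self xi : xi != 0 -> dotrV (grad H xi) xi = H xi.
Proof.
move=> xi0; have := @dot_grad_cvg xi xi xi0.
have -> : (fun m : nat => m.+1%:R * (H (xi + m.+1%:R^-1 *: xi) - H xi)) = (fun=> H xi).
  apply/funext => m; rewrite -[X in H (X + _)]scale1r -scalerDl (fm_homogeneous hH).
  by rewrite ger0_norm ?addr_ge0// mulrDl mul1r addrAC subrr add0r mulVKf.
by move=> c; apply: (cvg_unique _ c) => //; exact: cvg_cst.
Qed.

Variables (p : R) (p1 : 1 < p).

Let p0 : 0 < p. Proof. exact: lt_trans ltr01 p1. Qed.

Let p10 : 0 <= p - 1. Proof. by rewrite subr_ge0 ltW. Qed.

Lemma flux_le xi eta : `|dotrV (finsler_flux p H xi) eta| <= H xi `^ (p - 1) * H eta.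
Proof.
rewrite /finsler_flux; case: eqVneq => [_|xi0].
  by rewrite dotrV0l normr0 mulr_ge0 ?powR_ge0// (fm_ge0 hH).
by rewrite dotrVZl normrM ger0_norm ?powR_ge0// ler_wpM2l ?powR_ge0// dot_grad_norm_le.
Qed.

Lemma flux_self xi : dotrV (finsler_flux p H xi) xi = H xi `^ p.
Proof.
rewrite /finsler_flux; case: eqVneq => [->|xi0]; first by rewrite dotrV0l finsler0 powR0// gt_eqF.
by rewrite dotrVZl dot_grad_self// mulrC mulr_powRB1// (fm_ge0 hH).
Qed.

Lemma flux_young xi eta : `|dotrV (finsler_flux p H xi) eta| <= H xi `^ p + H eta `^ p.
Proof.
apply: le_trans (flux_le _ _) _; rewrite -(ler_pM2l p0).
apply: le_trans (young_powR p1 (fm_ge0 hH _) (fm_ge0 hH _)) _.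
rewrite mulrDr lerD//; first by rewrite ler_wpM2r ?powR_ge0// gerBl.
by rewrite ler_peMl ?powR_ge0// ltW.
Qed.

(** The pairing with xi is H(xi)^p, the one with eta is at most H(xi)^(p-1)
    H(eta), and Young's inequality at X H(xi) and H(eta) absorbs the cross term
    since 0 <= d <= 1. *)
Lemma flux_picone xi eta X d : 0 <= X -> 0 <= d <= 1 ->
  H xi `^ p - H eta `^ p <= dotrV (finsler_flux p H xi)
    ((1 + (p - 1) * X `^ p) *: xi + (- p * X `^ (p - 1) * d) *: eta).
Proof.
move=> X0 /andP[d0 d1]; rewrite dotrVDr !dotrVZr flux_self.
have Hx := fm_ge0 hH xi; have He := fm_ge0 hH eta.
have Y := young_powR p1 (mulr_ge0 X0 Hx) He.
have F := flux_le xi eta.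
have XA : 0 <= X `^ (p - 1) by exact: powR_ge0.
have : p * (X `^ (p - 1) * d) * dotrV (finsler_flux p H xi) eta <=
    (p - 1) * (X * H xi) `^ p + H eta `^ p.
  apply: le_trans Y; rewrite -mulrA ler_wpM2l ?(ltW p0)// powRM//.
  rewrite -!mulrA ler_wpM2l//.
  apply: (@le_trans _ _ (d * (H xi `^ (p - 1) * H eta))).
    by rewrite ler_wpM2l// (le_trans (ler_norm _)).
  by rewrite ler_piMl// mulr_ge0// powR_ge0.
rewrite powRM//.
have -> : - p * X `^ (p - 1) * d * dotrV (finsler_flux p H xi) eta =
    - (p * (X `^ (p - 1) * d) * dotrV (finsler_flux p H xi) eta).
  by rewrite !mulNr !mulrA.
rewrite [(1 + _) * _]mulrDl mul1r -[(p - 1) * _ * _]mulrA.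
by rewrite -[_ + _ - _]addrA lerD2l lerNl opprB lerBlDl.
Qed.

Let closed0 : closed [set (0 : V)]. Proof. by apply: compact_closed => //; exact: compact_set1. Qed.

(** A function that is continuous off the origin is measurable whatever its value
    there; this applies to H, and to its gradient, whose value at 0 is arbitrary. *)
Lemma measurable_off_zero (g : V -> R) : (forall x, x != 0 -> {for x, continuous g}) ->
  measurable_fun setT g.
Proof.
move=> gc; have m0 : measurable [set (0 : V)].
  by apply: closed_measurable_rV; exact: closed0.
have := measurable_funU g m0 (measurableC m0).
rewrite setUCr => H1; apply/H1; split.
  by apply: measurable_fun_set1.
apply: open_continuous_measurable_rV.
  by apply: closed_openC; exact: closed0.
by move=> x; rewrite inE/= => /eqP; exact: gc.
Qed.

Lemma measurable_finsler : measurable_fun setT H.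
Proof. by apply: measurable_off_zero => x /(fm_C1 hH)[/differentiable_continuous]. Qed.

Lemma measurable_flux i : measurable_fun setT (fun xi => finsler_flux p H xi ord0 i).
Proof.
pose g xi := H xi `^ (p - 1) * grad H xi ord0 i * (1 - \1_[set (0 : V)] xi).
have -> : (fun xi => finsler_flux p H xi ord0 i) = g.
  apply/funext => xi; rewrite /g /finsler_flux indicE; case: eqVneq => [->|xi0].
    by rewrite mem_set// subrr mulr0 mxE.
  by rewrite memNset ?subr0 ?mulr1 ?mxE//; exact/eqP.
apply: measurable_funM; first apply: measurable_funM.
- exact: (measurableT_comp (measurable_powR _) measurable_finsler).
- apply: measurable_off_zero => x /(fm_C1 hH)[_ cg].
  exact: (@continuous_comp _ _ _ (grad H) (fun M : V => M ord0 i) x cg (@coord_continuous _ _ _ ord0 i _)).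
- apply: measurable_funB => //; apply: measurable_indic.
  by apply: closed_measurable_rV; exact: closed0.
Qed.

Lemma finsler_le_sum : exists2 C, 0 <= C & forall x, H x <= C * \sum_i `|x ord0 i|.
Proof.
have [C1 [C2 [_ C20 HC]]] := fm_equivalent hH; exists C2; first exact: ltW.
move=> x; apply: le_trans (HC x).2 _; rewrite ler_wpM2l ?(ltW C20)//.
have s0 : 0 <= \sum_i `|x ord0 i| by exact: sumr_ge0.
rewrite /enorm -[leRHS](ger0_norm s0) -sqrtr_sqr ler_wsqrtr// expr2 mulr_suml /dotrV.
apply: ler_sum => i _; rewrite (le_trans (ler_norm _))// normrM ler_wpM2l//.
by rewrite (bigD1 i)//= lerDl sumr_ge0.
Qed.

End finsler.

(** * Integrands that are measurable up to a null set *)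

Section integral_ae.
Context d (T : measurableType d) {R : realType} (mu : {measure set T -> \bar R}).
Import HBNNSimple.

(** The integral of a nonnegative function is a supremum over the simple functions
    below it, and cutting a simple function off on a null set does not change its
    integral. *)
Lemma eq_ae_integral (D : set T) (f g : T -> \bar R) :
  {ae mu, forall x, D x -> f x = g x} ->
  (\int[mu]_(x in D) f x = \int[mu]_(x in D) g x)%E.
Proof.
have key (h k : T -> \bar R) : (forall x, 0 <= h x)%E -> (forall x, 0 <= k x)%E ->
    {ae mu, forall x, h x = k x} -> (\int[mu]_x h x <= \int[mu]_x k x)%E.
  move=> h0 k0 [N [mN N0 hkN]]; rewrite !ge0_integralTE//; apply: ge_ereal_sup => _ [q qh <-].
  pose q' := proj_nnsfun q (measurableC mN).
  have q'E x : q' x = q x * \1_(~` N) x by [].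
  have -> : sintegral mu q = sintegral mu q'.
    rewrite -!integralT_nnsfun; apply: ae_eq_integral => //; try exact/measurable_EFinP.
    exists N; split=> // x /= qx; apply: contra_notP qx => Nx _.
    by rewrite -[mindic _ _ x]/(\1_(~` N) x) indicE mem_set// mulr1.
  apply: ereal_sup_ubound; exists q' => // x; rewrite q'E indicE.
  have [Nx|Nx] := pselect (N x); first by rewrite memNset ?mulr0//=; exact.
  rewrite mem_set// mulr1; have -> : k x = h x; last exact: qh.
  by apply/esym; apply: contra_notP Nx => hk; exact: hkN.
have key2 (h k : T -> \bar R) : (forall x, 0 <= h x)%E -> (forall x, 0 <= k x)%E ->
    {ae mu, forall x, h x = k x} -> (\int[mu]_x h x = \int[mu]_x k x)%E.
  move=> h0 k0 hk; apply/eqP; rewrite eq_le !key//.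
  by apply: filterS hk => x ->.
move=> fg; rewrite integral_mkcond [RHS]integral_mkcond.
have fgD : {ae mu, forall x, (f \_ D) x = (g \_ D) x}.
  apply: filterS fg => x fgx; rewrite !patchE; case: ifPn => // /set_mem; exact: fgx.
rewrite integralE [RHS]integralE; congr (_ - _)%E; apply: key2 => //.
  by apply: filterS fgD => x E; rewrite !funeposE E.
by apply: filterS fgD => x E; rewrite !funenegE E.
Qed.

End integral_ae.

Section superposition.
Context {R : realType} {n : nat}.
Local Notation V := 'rV[R]_n.
Local Notation mu := (@lebesgue_rV R n).

(** Round u down to a multiple t of 1 / (k + 1). For each of the countably many
    values of t the function f(., t) has a Borel version, and continuity in t
    gives the limit. *)
Lemma superposition_measurable (Omega : set V) (f : V -> R -> R) (u : V -> R) :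
  measurable Omega -> caratheodory Omega f -> measurable_fun setT u -> (forall x, 0 <= u x) ->
  exists2 h : V -> R, measurable_fun setT h &
    {ae mu, forall x, Omega x -> f x (u x) = h x}.
Proof.
move=> mO [fm fc] mu_ u0.
(* the grid of values to which u is rounded down *)
pose t (k j : nat) : R := j%:R / k.+1%:R.
have t0 k j : 0 <= t k j by rewrite divr_ge0.
have /choice[h_ hP] : forall kj : nat * nat, exists h : V -> R, measurable_fun setT h /\
    {ae mu, forall x, Omega x -> f x (t kj.1 kj.2) = h x}.
  move=> [k j]; have [h mh fh] := fm _ (t0 k j).
  exists (h \_ Omega); split; first exact/(measurable_restrictT _ mO).
  by apply: filterS fh => x fh Ox; rewrite patchE mem_set// fh.
pose j k x := Num.truncn (k.+1%:R * u x).
pose g k x := h_ (k, j k x) x.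
have mg k : measurable_fun setT (g k).
  move=> _ B mB; rewrite setTI.
  have -> : g k @^-1` B = \bigcup_i ([set x | j k x = i] `&` (h_ (k, i) @^-1` B)).
    apply/seteqP; split=> x /=; first by move=> gB; exists (j k x).
    by move=> [i _ [/= ji hB]]; rewrite /g ji.
  apply: bigcup_measurable => i _; apply: measurableI; last first.
    by rewrite -[X in measurable X]setTI; exact: (hP (k, i)).1.
  have -> : [set x | j k x = i] = (fun x => k.+1%:R * u x) @^-1` `[i%:R, i.+1%:R[%classic.
    apply/seteqP; split=> x /=; rewrite in_itv/=.
      by move=> <-; apply: truncn_itv; rewrite mulr_ge0.
    by move=> ?; apply/truncn_def.
  rewrite -[X in measurable X]setTI; apply: measurable_funM => //; exact: measurable_itv.
have cj k x : `|t k (j k x) - u x| <= k.+1%:R^-1.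
  have /andP[l r] : (j k x)%:R <= k.+1%:R * u x < (j k x).+1%:R by apply: truncn_itv; rewrite mulr_ge0.
  have k0 : 0 < k.+1%:R :> R by [].
  rewrite /t distrC ger0_norm; last by rewrite subr_ge0 ler_pdivrMr// mulrC.
  rewrite lerBlDr -[X in _ <= X + _]mul1r -mulrDl ler_pdivlMr// mulrC addrC natr1 ltW//.
pose G x := limn_esup (fun k => (g k x)%:E).
have mG : measurable_fun setT G.
  by apply: (measurable_fun_limn_esup (f := fun k x => (g k x)%:E)) => k; exact/measurable_EFinP.
exists (fine \o G); first exact: measurableT_comp.
have H : {ae mu, forall x, forall kj, Omega x -> f x (t kj.1 kj.2) = h_ kj x}.
  have : {ae mu, forall x, forall k j, Omega x -> f x (t k j) = h_ (k, j) x}.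
    by apply: ae_foralln => k; apply: ae_foralln => i; exact: (hP (k, i)).2.
  by apply: filterS => x Hx [k i]; exact: Hx.
apply: filterS2 H fc => x Hx fx Ox.
have gE k : g k x = f x (t k (j k x)) by rewrite /g -(Hx (k, j k x)).
have cg : g ^~ x @ \oo --> f x (u x).
  have -> : g ^~ x = (fun k => f x (t k (j k x))) by apply/funext.
  have ct : (fun k => t k (j k x)) @ \oo --> u x by apply: (cvg_of_dist (cj^~ x)); exact: cvg_harmonic.
  have /subspace_continuousP cf := fx Ox.
  have ux : `[0, +oo[%classic (u x) by rewrite /= in_itv/= u0.
  apply: (cvg_comp _ _ _ (cf _ ux)) => A [e /= e0 eA].
  have := ct _ (nbhsx_ballx (u x) e e0); rewrite /nbhs/=; apply: filterS => k /= kA.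
  by apply: eA => //; rewrite /= in_itv/= t0.
rewrite /G /= is_cvg_limn_esupE.
  by rewrite (cvg_lim _ (cvg_EFin _ cg))//; exact: nearW.
by apply/cvg_ex; exists (f x (u x))%:E; apply: cvg_EFin => //; exact: nearW.
Qed.

End superposition.

(** * Fatou's lemma, product null sets and the fractional kernel *)

Section measure_lemmas.
Context {R : realType}.

Lemma fatou_ae d (T : measurableType d) (mu : {measure set T -> \bar R}) (D : set T)
    (f_ : nat -> T -> \bar R) (l : T -> \bar R) (M : \bar R) :
  measurable D -> (forall m, measurable_fun D (f_ m)) ->
  {ae mu, forall x, D x -> forall m, (0 <= f_ m x)%E} ->
  {ae mu, forall x, D x -> f_ ^~ x @ \oo --> l x} ->
  (forall m, (\int[mu]_(x in D) f_ m x <= M)%E) ->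
  (\int[mu]_(x in D) l x <= M)%E.
Proof.
move=> mD mf f0 fl fM.
pose g m x : \bar R := maxe 0%E (f_ m x).
have mg m : measurable_fun D (g m) by apply: measurable_maxe => //; exact: measurable_cst.
have gM m : (\int[mu]_(x in D) g m x <= M)%E.
  have -> : (\int[mu]_(x in D) g m x = \int[mu]_(x in D) f_ m x)%E; last exact: fM.
  apply: (@eq_ae_integral _ _ _ mu D (g m) (f_ m)).
  by apply: filterS f0 => x h Dx; apply/max_idPr; exact: h.
have := @fatou _ _ _ mu D mD g mg (fun m x _ => ltac:(by rewrite le_max lexx)).
have -> : (\int[mu]_(x in D) limn_einf (g ^~ x) = \int[mu]_(x in D) l x)%E.
  apply: (@eq_ae_integral _ _ _ mu D (fun x => limn_einf (g ^~ x)) l); apply: filterS2 f0 fl => x f0 fl Dx.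
  have -> : g ^~ x = f_ ^~ x by apply/funext => m; apply/max_idPr; exact: f0.
  have cl := fl Dx; rewrite is_cvg_limn_einfE; first exact/cvg_lim.
  by apply/cvg_ex; exists (l x).
move=> /le_trans; apply; apply: le_trans (limn_einf_sup _) _.
rewrite limn_esup_lim; apply: lime_le; first exact: is_cvg_esups.
by apply: nearW => k; apply: ge_ereal_sup => _ [j _ <-].
Qed.

Lemma ae_fst d1 d2 (T1 : measurableType d1) (T2 : measurableType d2)
    (m1 : {sigma_finite_measure set T1 -> \bar R}) (m2 : {sigma_finite_measure set T2 -> \bar R})
    (P : T1 -> Prop) : {ae m1, forall x, P x} -> {ae (m1 \x m2)%E, forall z, P z.1}.
Proof.
move=> [N [mN N0 PN]]; exists (N `*` setT); split.
- exact: measurableX.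
- transitivity (m1 N * m2 setT)%E; first exact: product_measure1E.
  by rewrite N0 mul0e.
- by move=> [x y] /= nP; split=> //; exact: PN.
Qed.

Lemma ae_snd d1 d2 (T1 : measurableType d1) (T2 : measurableType d2)
    (m1 : {sigma_finite_measure set T1 -> \bar R}) (m2 : {sigma_finite_measure set T2 -> \bar R})
    (P : T2 -> Prop) : {ae m2, forall x, P x} -> {ae (m1 \x m2)%E, forall z, P z.2}.
Proof.
move=> [N [mN N0 PN]]; exists (setT `*` N); split.
- exact: measurableX.
- transitivity (m1 setT * m2 N)%E; first exact: product_measure1E.
  by rewrite N0 mule0.
- by move=> [x y] /= nP; split=> //; exact: PN.
Qed.

(** In the extended reals a difference of two terms is finite only if both are. *)
Lemma fin_num_integrable d (T : measurableType d) (mu : {measure set T -> \bar R}) (D : set T)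
    (f : T -> \bar R) : measurable D -> measurable_fun D f ->
  (\int[mu]_(x in D) f x)%E \is a fin_num -> mu.-integrable D f.
Proof.
move=> mD mf; rewrite integralE fin_numB => /andP[fp fn].
have ip : mu.-integrable D f^\+%E.
  apply/integrableP; split; first exact: measurable_funepos.
  by under eq_integral do rewrite gee0_abs//; rewrite ltey_eq fp.
have im : mu.-integrable D f^\-%E.
  apply/integrableP; split; first exact: measurable_funeneg.
  by under eq_integral do rewrite gee0_abs//; rewrite ltey_eq fn.
by rewrite (funeposneg f); exact: integrableB.
Qed.

End measure_lemmas.

Section kernel.
Context {R : realType} {n : nat}.
Local Notation V := 'rV[R]_n.

Lemma measurable_frac_kernel (p s : R) : measurable_fun setT (@frac_kernel R n p s).
Proof.
apply: (measurableT_comp (measurable_powR _)).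
apply: (measurableT_comp (continuous_measurable_fun (@sqrt_continuous R))).
rewrite /dotrV; apply: measurable_sum => i.
have m1 : measurable_fun setT (fun z : V * V => (z.1 - z.2) ord0 i).
  under eq_fun do rewrite !mxE.
  apply: measurable_funB.
    apply: (@measurableT_comp _ _ _ _ _ _ (@rV_coord _ R n i)) => //; exact: measurable_rV_coord.
  apply: (@measurableT_comp _ _ _ _ _ _ (@rV_coord _ R n i)) => //; exact: measurable_rV_coord.
exact: measurable_funM.
Qed.

Lemma frac_kernel_ge0 (p s : R) z : 0 <= @frac_kernel R n p s z.
Proof. exact: powR_ge0. Qed.

Lemma frac_kernel_gt0 (p s : R) (z : V * V) : z.1 != z.2 -> 0 < frac_kernel p s z.
Proof.
rewrite -subr_eq0 => z0; apply: powR_gt0.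
have [i zi] : exists i, (z.1 - z.2) ord0 i != 0.
  apply/existsP; apply: contraNT z0; rewrite negb_exists => /forallP h.
  by apply/eqP/rowP => i; rewrite [RHS]mxE; have := h i; rewrite negbK => /eqP.
rewrite sqrtr_gt0 /dotrV (bigD1 i)//= ltr_pwDl//.
  by rewrite -expr2 lt0r sqrf_eq0 zi sqr_ge0.
by apply: sumr_ge0 => j _; rewrite -expr2 sqr_ge0.
Qed.

End kernel.

(** * The weak equation in Borel representatives *)

Section weak_form.
Context {R : realType} {n : nat}.
Local Notation V := 'rV[R]_n.
Local Notation mu := (@lebesgue_rV R n).
Variables (Omega : set V) (p s : R) (H : V -> R).
Hypotheses (mO : measurable Omega) (Ofin : (mu Omega < +oo)%E).
Hypotheses (p1 : 1 < p) (hH : finsler_minkowski_norm H).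
Implicit Types (u v phi h : V -> R).

Let p1' : 1 <= p. Proof. exact: ltW. Qed.

Let p0 : 0 < p. Proof. exact: lt_trans ltr01 p1. Qed.

Definition energy_density u phi (x : V) : R :=
  dotrV (finsler_flux p H (wgrad u x)) (wgrad phi x).

Definition nonlocal_density u phi (z : V * V) : R :=
  signed_pow p (u z.1 - u z.2) * (phi z.1 - phi z.2) * frac_kernel p s z.

Definition weak_equation u h := forall phi, W1p_0 p Omega phi ->
  (\int[mu]_(x in Omega) (energy_density u phi x)%:E +
   \int[mu \x mu]_z (nonlocal_density u phi z)%:E = \int[mu]_(x in Omega) (h x * phi x)%:E)%E.

Lemma measurable_pos u : measurable_fun setT u -> measurable [set x | 0 < u x].
Proof.
move=> mu_; have := mu_ measurableT _ (measurable_itv `]0, +oo[); rewrite setTI.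
by congr measurable; apply/seteqP; split=> x /=; rewrite in_itv/= andbT.
Qed.

Lemma W1p_0_measurable u : W1p_0 p Omega u -> measurable_fun setT u.
Proof. by move=> [/(W1p_wgrad p1')[[]]]. Qed.

(** A solution may be replaced by its positive part, which is everywhere
    nonnegative, and x -> f(x, u(x)) by a Borel version; the equation only sees
    them up to null sets. *)
Lemma borel_weak_solution f u : caratheodory Omega f -> weak_solution Omega p s H f u ->
  exists u' h, [/\ {ae mu, forall x, u x = u' x}, forall x, 0 <= u' x, W1p_0 p Omega u',
    measurable_fun setT h & weak_equation u' h] /\
    {ae mu, forall x, Omega x -> f x (u' x) = h x} /\ (0 < mu [set x | (0 < u' x)%R])%E.
Proof.
move=> cf [Wu eqn u_ge0 u_pos].
have mu_ := W1p_0_measurable Wu.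
pose u' x := Num.max (u x) 0.
have mu' : measurable_fun setT u' by exact: measurable_maxr.
have u'0 x : 0 <= u' x by rewrite le_max lexx orbT.
have uu' : {ae mu, forall x, u x = u' x}.
  apply: filterS2 u_ge0 Wu.2 => x u0 uout; apply/esym/max_idPl.
  by have [/u0//|/uout->] := pselect (Omega x).
have [Wu' gu'] := W1p_0_ae p1' mu' uu' Wu.
have [h mh fh] := superposition_measurable mO cf mu' u'0.
exists u', h; split; first split=> //.
- move=> phi Wphi.
  have E1 : (\int[mu]_(x in Omega) (dotrV (finsler_flux p H (wgrad u x)) (wgrad phi x))%:E =
      \int[mu]_(x in Omega) (energy_density u' phi x)%:E)%E.
    apply: (@eq_ae_integral _ _ _ mu Omega _ (fun x => (energy_density u' phi x)%:E)).
    by apply: filterS gu' => x E _; rewrite /energy_density E.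
  have E2 : (\int[mu]_(x in Omega) (f x (u x) * phi x)%:E = \int[mu]_(x in Omega) (h x * phi x)%:E)%E.
    apply: (@eq_ae_integral _ _ _ mu Omega _ (fun x => (h x * phi x)%:E)).
    by apply: filterS2 uu' fh => x -> E Ox; rewrite E.
  have E3 : (\int[mu \x mu]_z (signed_pow p (u z.1 - u z.2) * (phi z.1 - phi z.2) * frac_kernel p s z)%:E =
      \int[mu \x mu]_z (nonlocal_density u' phi z)%:E)%E.
    apply: (@eq_ae_integral _ _ _ (mu \x mu)%E setT _ (fun z => (nonlocal_density u' phi z)%:E)).
    by apply: filterS2 (ae_fst mu uu') (ae_snd mu uu') => z F1 F2 _; rewrite /nonlocal_density F1 F2.
  exact: (etrans (esym (f_equal2 adde E1 E3)) (etrans (eqn phi Wphi) E2)).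
- split=> //; apply: lt_le_trans u_pos _; apply: le_measure.
  + by rewrite inE; apply: measurableI => //; exact: measurable_pos.
  + by rewrite inE; exact: measurable_pos.
  + by move=> x [_ /= ux]; rewrite /u' lt_max ux.
Qed.

Lemma measurable_wgrad u : W1p_0 p Omega u -> measurable_fun setT (wgrad u).
Proof.
move=> [/(W1p_wgrad p1')[_ LG _] _].
by apply: measurable_fun_rV => i; exact: (LG i).1.
Qed.

Lemma Lp_sum_norm (G : V -> V) (r : seq 'I_n) : (forall i, Lp mu p (fun x => G x ord0 i)) ->
  Lp mu p (fun x => \sum_(i <- r) `|G x ord0 i|).
Proof.
move=> LG; elim: r => [|i r IH].
  under eq_fun do rewrite big_nil; split=> //=.
  rewrite normr0 powR0 ?gt_eqF//; exact: integrable0.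
under eq_fun do rewrite big_cons.
apply: (Lp_dominated p1' (ler01 : (0 : R) <= 1) _ (LG i) IH).
  by apply: measurable_funD; [apply: measurableT_comp => //; exact: (LG i).1|exact: IH.1].
by apply: aeW => x; rewrite mul1r (le_trans (ler_normD _ _))// normr_id.
Qed.

Lemma integrable_finsler_wgrad u : W1p_0 p Omega u ->
  mu.-integrable setT (EFin \o (fun x => H (wgrad u x) `^ p)).
Proof.
move=> Wu; have [_ LG _] := W1p_wgrad p1' Wu.1.
have LS := Lp_sum_norm (index_enum 'I_n) LG.
have [C C0 HC] := finsler_le_sum hH.
have [_] : Lp mu p (fun x => H (wgrad u x)).
  apply: (Lp_dominated p1' C0 _ LS LS).
    exact: (measurableT_comp (measurable_finsler hH) (measurable_wgrad Wu)).
  apply: aeW => x; rewrite ger0_norm ?(fm_ge0 hH)// (le_trans (HC _))// ler_wpM2l//.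
  by rewrite (le_trans (ler_norm _))// lerDl.
by congr (is_true (integrable _ _ _)); apply/funext => x; rewrite /= ger0_norm ?(fm_ge0 hH).
Qed.

Lemma measurable_energy u phi : W1p_0 p Omega u -> W1p_0 p Omega phi ->
  measurable_fun setT (energy_density u phi).
Proof.
move=> Wu Wphi; rewrite /energy_density /dotrV; apply: measurable_sum => i.
apply: measurable_funM.
  exact: (measurableT_comp (measurable_flux hH p i) (measurable_wgrad Wu)).
by have [_ LG _] := W1p_wgrad p1' Wphi.1; exact: (LG i).1.
Qed.

Lemma integrable_energy u phi : W1p_0 p Omega u -> W1p_0 p Omega phi ->
  mu.-integrable Omega (EFin \o energy_density u phi).
Proof.
move=> Wu Wphi.
have i1 := integrableD measurableT (integrable_finsler_wgrad Wu) (integrable_finsler_wgrad Wphi).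
apply: (ae_le_integrable mO _ (integrableS measurableT mO (@subsetT _ _) i1)).
  by apply: measurable_funTS; exact: measurable_energy.
by apply: aeW => x _; exact: (flux_young hH p1).
Qed.

Lemma measurable_nonlocal u phi : measurable_fun setT u -> measurable_fun setT phi ->
  measurable_fun setT (nonlocal_density u phi).
Proof.
move=> mu_ mphi; apply: measurable_funM; last exact: measurable_frac_kernel.
have md (g : V -> R) : measurable_fun setT g -> measurable_fun setT (fun z : V * V => g z.1 - g z.2).
  move=> mg; apply: measurable_funB.
    exact: (measurableT_comp mg measurable_fst).
  exact: (measurableT_comp mg measurable_snd).
apply: measurable_funM; last exact: md.
have mspow : measurable_fun setT (@signed_pow R p).
  apply: measurable_funM => //.
  exact: (measurable_norm_powR (p - 2) (@measurable_id _ _ setT)).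
exact: (measurableT_comp mspow (md _ mu_)).
Qed.

Lemma picone_test_W1p_0 u v e : 0 < e -> (forall x, 0 <= u x) -> (forall x, 0 <= v x) ->
  W1p_0 p Omega u -> W1p_0 p Omega v ->
  let phi x := picone_test p e (u x) (v x) in
  [/\ W1p_0 p Omega phi,
    {ae mu, forall x, wgrad phi x =
       (1 + (p - 1) * picone_ratio e (u x) (v x) `^ p) *: wgrad u x +
       (- p * picone_ratio e (u x) (v x) `^ (p - 1) * dtrunc e (v x)) *: wgrad v x} &
    exists2 L, 0 <= L & forall x, `|phi x| <= L * (u x + v x)].
Proof.
move=> e0 u0 v0 Wu Wv phi.
have [L L0 [lip bd]] := picone_test_bounds p1 e0.
have mu_ := W1p_0_measurable Wu; have mv := W1p_0_measurable Wv.
have mden : measurable_fun setT (fun x => 1 + e * v x) by apply: measurable_funD => //; exact: measurable_funM.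
have mpow (r : R) (g : V -> R) : measurable_fun setT g -> measurable_fun setT (fun x => g x `^ r).
  by move=> mg; exact: (measurableT_comp (measurable_powR r) mg).
have mtr : measurable_fun setT (fun x => trunc e (v x)).
  by apply: measurable_funM => //; exact: mpow.
have mte : measurable_fun setT (fun x => trunc e (v x) + e) by exact: measurable_funD.
have mue : measurable_fun setT (fun x => u x + e) by exact: measurable_funD.
have mphi : measurable_fun setT phi.
  by apply: measurable_funB => //; apply: measurable_funM; exact: mpow.
have mrat : measurable_fun setT (fun x => picone_ratio e (u x) (v x)).
  have -> : (fun x => picone_ratio e (u x) (v x)) = (fun x => (trunc e (v x) + e) * (u x + e) `^ (-1)).
    by apply/funext => x; rewrite /picone_ratio powR_inv1// addr_ge0// ltW.
  by apply: measurable_funM => //; exact: mpow.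
have mq1 : measurable_fun setT (fun x => 1 + (p - 1) * picone_ratio e (u x) (v x) `^ p).
  by apply: measurable_funD => //; apply: measurable_funM => //; exact: mpow.
have mq2 : measurable_fun setT (fun x => - p * picone_ratio e (u x) (v x) `^ (p - 1) * dtrunc e (v x)).
  apply: measurable_funM; first by apply: measurable_funM => //; exact: mpow.
  apply: measurable_funB; first exact: mpow.
  by apply: measurable_funM; [exact: measurable_funM|exact: mpow].
have phiL x : `|phi x| <= L * (`|u x| + `|v x|).
  have := lip (u x) (v x) 0 0 (u0 x) (v0 x) (lexx _) (lexx _).
  by rewrite picone_test00// !subr0.
have [W g] := W1p_0_chain p1' L0 Wu Wv mphi mq1 mq2 (fun x => (bd _ _ (u0 x) (v0 x)).1)
  (fun x => (bd _ _ (u0 x) (v0 x)).2) phiL (fun x y => lip _ _ _ _ (u0 x) (v0 x) (u0 y) (v0 y))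
  (fun x y a b ra rb => rate_picone_test e0 (u0 x) (v0 x) ra rb).
split=> //; exists L => // x; have := phiL x.
by rewrite (ger0_norm (u0 x)) (ger0_norm (v0 x)).
Qed.

End weak_form.

(** * Comparison of two solutions *)

(** The sum factors as (fa / a^(p-1) - fb / b^(p-1)) (a^p - b^p), a product of
    factors of opposite signs. *)
Lemma picone_sign (R : realType) (p a b fa fb : R) : 1 < p -> 0 < a -> 0 < b ->
  (a < b -> fb / b `^ (p - 1) < fa / a `^ (p - 1)) ->
  (b < a -> fa / a `^ (p - 1) < fb / b `^ (p - 1)) ->
  fa * (a - b `^ p * a `^ (1 - p)) + fb * (b - a `^ p * b `^ (1 - p)) <= 0 /\
  (fa * (a - b `^ p * a `^ (1 - p)) + fb * (b - a `^ p * b `^ (1 - p)) = 0 -> a = b).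
Proof.
move=> p1 a0 b0 ab ba; have p0 : 0 < p := lt_trans ltr01 p1.
have V (x : R) : x `^ (1 - p) = (x `^ (p - 1))^-1 by rewrite -(opprB p 1) powRN.
have E (x : R) : 0 < x -> x = x `^ p * x `^ (1 - p).
  by move=> x0; rewrite -powRD ?(gt_eqF x0) ?implybT// addrC subrK powRr1// ltW.
have -> : fa * (a - b `^ p * a `^ (1 - p)) + fb * (b - a `^ p * b `^ (1 - p)) =
    (fa / a `^ (p - 1) - fb / b `^ (p - 1)) * (a `^ p - b `^ p).
  have -> : a - b `^ p * a `^ (1 - p) = (a `^ p - b `^ p) * a `^ (1 - p) by rewrite mulrBl -E.
  have -> : b - a `^ p * b `^ (1 - p) = (b `^ p - a `^ p) * b `^ (1 - p) by rewrite mulrBl -E.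
  rewrite -!V.
  move: (a `^ p) (b `^ p) (a `^ (1 - p)) (b `^ (1 - p)) => x y z w; ring.
have [lab|lba|->] := ltgtP a b; last by rewrite !subrr mulr0.
  have q0 : a `^ p - b `^ p < 0 by rewrite subr_lt0 gt0_ltr_powR// nnegrE ltW.
  have r0 : 0 < fa / a `^ (p - 1) - fb / b `^ (p - 1) by rewrite subr_gt0 ab.
  have := pmulr_rlt0 (a `^ p - b `^ p) r0; rewrite q0 => d0.
  by split; [exact: ltW|move=> dE; move: d0; rewrite dE ltxx].
have q0 : 0 < a `^ p - b `^ p by rewrite subr_gt0 gt0_ltr_powR// nnegrE ltW.
have r0 : fa / a `^ (p - 1) - fb / b `^ (p - 1) < 0 by rewrite subr_lt0 ba.
have := pmulr_llt0 (fa / a `^ (p - 1) - fb / b `^ (p - 1)) q0; rewrite r0 => d0.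
by split; [exact: ltW|move=> dE; move: d0; rewrite dE ltxx].
Qed.

Lemma ge0_at0 (R : realType) (F : R -> R) (rho : R) : 0 < rho ->
  {within `[0, +oo[, continuous F} -> (forall t, 0 < t -> t < rho -> 0 < F t) -> 0 <= F 0.
Proof.
move=> rho0 /subspace_continuousP cF Fpos.
have z0 : `[0, +oo[%classic (0 : R) by rewrite /= in_itv/= lexx.
pose t (k : nat) : R := k.+1%:R^-1 * (rho / 2).
have t0 k : 0 < t k by rewrite mulr_gt0 ?divr_gt0.
have tr k : t k < rho.
  rewrite /t; apply: (@le_lt_trans _ _ (rho / 2)); last by lra.
  by rewrite ler_piMl ?divr_ge0 ?(ltW rho0)// invf_le1// ler1n.
have ct : t @ \oo --> 0.
  by rewrite -[X in _ --> X](mul0r (rho / 2)); apply: cvgM; [exact: cvg_harmonic|exact: cvg_cst].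
have c : (fun k => F (t k)) @ \oo --> F 0.
  apply: (cvg_comp _ _ _ (cF _ z0)) => A [e /= e0 eA].
  have := ct _ (nbhsx_ballx (0 : R) e e0); rewrite /nbhs/=; apply: filterS => k /= kA.
  by apply: eA => //; rewrite /= in_itv/= ltW.
rewrite -(cvg_lim _ c)//; apply: limr_ge; first by apply/cvg_ex; exists (F 0).
by apply: nearW => k; apply/ltW/Fpos.
Qed.

Section comparison.
Context {R : realType} {n : nat}.
Local Notation V := 'rV[R]_n.
Local Notation mu := (@lebesgue_rV R n).
Variables (Omega : set V) (p s : R) (H : V -> R).
Hypotheses (mO : measurable Omega) (Ofin : (mu Omega < +oo)%E).
Hypotheses (p1 : 1 < p) (hH : finsler_minkowski_norm H).
Variables (cf rho : R) (cf0 : 0 < cf) (rho0 : 0 < rho).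

Let p1' : 1 <= p. Proof. exact: ltW. Qed.

Let p0 : 0 < p. Proof. exact: lt_trans ltr01 p1. Qed.

(** What the uniqueness argument uses of a solution u, with h a Borel version of
    f(x, u(x)). *)
Record reaction_pair (u h : V -> R) : Prop := {
  rp_ge0 : forall x, 0 <= u x;
  rp_sobolev : W1p_0 p Omega u;
  rp_measurable : measurable_fun setT h;
  rp_growth : {ae mu, forall x, Omega x -> `|h x| <= cf * (1 + u x `^ (p - 1))};
  rp_negative : {ae mu, forall x, Omega x -> h x < 0 -> rho <= u x};
  rp_equation : weak_equation Omega p s H u h
}.

Definition majorant (u v : V -> R) (x : V) : R :=
  2 * (2 * cf + cf * (1 + rho `^ (1 - p))) * ((1 + u x) `^ p + (1 + v x) `^ p).

Lemma majorant_ge0 u v x : 0 <= majorant u v x.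
Proof.
have ? := ltW cf0.
by rewrite /majorant mulr_ge0 ?addr_ge0 ?powR_ge0// mulr_ge0// addr_ge0 ?mulr_ge0// addr_ge0 ?powR_ge0.
Qed.

Lemma integrable_powS u : W1p_0 p Omega u -> (forall x, 0 <= u x) ->
  mu.-integrable Omega (EFin \o (fun x => (1 + u x) `^ p)).
Proof.
move=> Wu u0; have [Lu _ _] := W1p_wgrad p1' Wu.1.
have i1 : mu.-integrable Omega (EFin \o cst (1 : R)).
  apply/integrableP; split; first exact/measurable_EFinP.
  by rewrite /= normr1 integral_cst// mul1e.
have i2 := integrableS measurableT mO (@subsetT _ _) Lu.2.
have i3 := integrableZl mO (2 `^ p) (integrableD mO i1 i2).
apply: (ae_le_integrable mO _ i3).
  apply: measurable_funTS; apply: (measurableT_comp (measurable_powR _)).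
  by apply: measurable_funD => //; exact: Lu.1.
apply: aeW => x _ /=; rewrite ger0_norm ?powR_ge0// (ger0_norm (u0 x)).
by have := powRD_le (ltW p0) ler01 (u0 x); rewrite powR1.
Qed.

Lemma integrable_majorant u v : W1p_0 p Omega u -> W1p_0 p Omega v ->
  (forall x, 0 <= u x) -> (forall x, 0 <= v x) ->
  mu.-integrable Omega (EFin \o majorant u v).
Proof.
move=> Wu Wv u0 v0.
exact: (integrableZl mO _ (integrableD mO (integrable_powS Wu u0) (integrable_powS Wv v0))).
Qed.

Lemma integrable_reaction u v h e : 0 < e -> reaction_pair u h ->
  W1p_0 p Omega v -> (forall x, 0 <= v x) ->
  mu.-integrable Omega (EFin \o (fun x => h x * picone_test p e (u x) (v x))).
Proof.
move=> e0 [u0 Wu mh gr _ _] Wv v0.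
have [Wphi _ [L L0 phiL]] := picone_test_W1p_0 p1 e0 u0 v0 Wu Wv.
have iG := integrableZl mO (4 * cf * L) (integrableD mO (integrable_powS Wu u0) (integrable_powS Wv v0)).
apply: (ae_le_integrable mO _ iG).
  by apply: measurable_funTS; apply: measurable_funM => //; exact: W1p_0_measurable Wphi.
by apply: filterS gr => x grx Ox; exact: (reaction_norm_le p1 cf0 (u0 x) (v0 x) L0 (grx Ox) (phiL x)).
Qed.

(** In the weak equation the other two terms are finite, hence so is this one. *)
Lemma integrable_nonlocal u h phi : W1p_0 p Omega u -> W1p_0 p Omega phi ->
  weak_equation Omega p s H u h -> mu.-integrable Omega (EFin \o (fun x => h x * phi x)) ->
  (mu \x mu)%E.-integrable setT (EFin \o nonlocal_density p s u phi).
Proof.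
move=> Wu Wphi equ ih.
apply: fin_num_integrable => //.
  apply/measurable_EFinP; apply: measurable_nonlocal; [exact: W1p_0_measurable Wu|exact: W1p_0_measurable Wphi].
have := equ phi Wphi.
have := integrable_fin_num mO (integrable_energy mO p1 hH Wu Wphi).
have := integrable_fin_num mO ih.
rewrite /comp; move: (\int[mu]_(x in Omega) _)%E (\int[mu]_(x in Omega) _)%E => b a.
by move: b a => [b| |] [a| |] // _ _; case: (\int[_]_z _)%E.
Qed.

Section pair.
Variables (u v hu hv : V -> R).
Hypotheses (Pu : reaction_pair u hu) (Pv : reaction_pair v hv).

Let u0 := rp_ge0 Pu.
Let v0 := rp_ge0 Pv.
Let Wu := rp_sobolev Pu.
Let Wv := rp_sobolev Pv.

Definition reaction_sum e x : R :=
  hu x * picone_test p e (u x) (v x) + hv x * picone_test p e (v x) (u x).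

Definition nonlocal_sum e z : R :=
  nonlocal_density p s u (fun x => picone_test p e (u x) (v x)) z +
  nonlocal_density p s v (fun x => picone_test p e (v x) (u x)) z.

Lemma nonlocal_sum_ge0 e z : 0 < e -> 0 <= nonlocal_sum e z.
Proof.
move=> e0; rewrite /nonlocal_sum /nonlocal_density -mulrDl mulr_ge0 ?frac_kernel_ge0//.
have := nonlocal_picone p1 e0 (u0 z.1) (v0 z.1) (u0 z.2) (v0 z.2).
have := nonlocal_picone p1 e0 (v0 z.1) (u0 z.1) (v0 z.2) (u0 z.2).
move: (signed_pow _ _ * _) (signed_pow _ _ * _) (_ `^ p) (_ `^ p) => a b c d; lra.
Qed.

Lemma integrable_reaction_sum e : 0 < e -> mu.-integrable Omega (EFin \o reaction_sum e).
Proof.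
by move=> e0; exact: (integrableD mO (integrable_reaction e0 Pu Wv v0) (integrable_reaction e0 Pv Wu u0)).
Qed.

(** Adding the two tested equations, the Finsler terms are nonnegative by the
    local Picone inequality and can be dropped. *)
Lemma nonlocal_sum_le e : 0 < e ->
  (\int[mu \x mu]_z (nonlocal_sum e z)%:E <= \int[mu]_(x in Omega) (reaction_sum e x)%:E)%E.
Proof.
move=> e0.
have [Wphi gphi _] := picone_test_W1p_0 p1 e0 u0 v0 Wu Wv.
have [Wchi gchi _] := picone_test_W1p_0 p1 e0 v0 u0 Wv Wu.
set phi := fun x => picone_test p e (u x) (v x) in Wphi gphi.
set chi := fun x => picone_test p e (v x) (u x) in Wchi gchi.
have ihu := integrable_reaction e0 Pu Wv v0; have ihv := integrable_reaction e0 Pv Wu u0.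
have inu := integrable_nonlocal Wu Wphi (rp_equation Pu) ihu.
have inv := integrable_nonlocal Wv Wchi (rp_equation Pv) ihv.
have ieu := integrable_energy mO p1 hH Wu Wphi; have iev := integrable_energy mO p1 hH Wv Wchi.
have eqn : (\int[mu]_(x in Omega) (reaction_sum e x)%:E =
    (\int[mu]_(x in Omega) (energy_density p H u phi x)%:E + \int[mu \x mu]_z (nonlocal_density p s u phi z)%:E) +
    (\int[mu]_(x in Omega) (energy_density p H v chi x)%:E + \int[mu \x mu]_z (nonlocal_density p s v chi z)%:E))%E.
  have E1 := rp_equation Pu Wphi; have E2 := rp_equation Pv Wchi.
  exact: (etrans (integralD_EFin mO ihu ihv) (esym (f_equal2 adde E1 E2))).
have eqN : (\int[mu \x mu]_z (nonlocal_sum e z)%:E =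
    \int[mu \x mu]_z (nonlocal_density p s u phi z)%:E + \int[mu \x mu]_z (nonlocal_density p s v chi z)%:E)%E.
  exact: (integralD_EFin measurableT inu inv).
have A0 : (0 <= \int[mu]_(x in Omega) (energy_density p H u phi x)%:E +
    \int[mu]_(x in Omega) (energy_density p H v chi x)%:E)%E.
  have <- := integralD_EFin mO ieu iev.
  apply: ae_integral_ge0 => //.
    by apply: measurable_funTS; apply: measurable_funD;
      [exact: (measurable_energy p1 hH Wu Wphi)|exact: (measurable_energy p1 hH Wv Wchi)].
  apply: filterS2 gphi gchi => x Ep Ec _.
  rewrite /energy_density Ep Ec.
  have X0 a b : 0 <= a -> 0 <= b -> 0 <= picone_ratio e a b.
    by move=> a0 b0; rewrite divr_ge0// addr_ge0 ?trunc_ge0// ltW.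
  have := lerD (flux_picone hH p1 (wgrad u x) (wgrad v x) (X0 _ _ (u0 x) (v0 x)) (dtrunc_bound e0 (v0 x)))
    (flux_picone hH p1 (wgrad v x) (wgrad u x) (X0 _ _ (v0 x) (u0 x)) (dtrunc_bound e0 (u0 x))).
  by rewrite addrA subrK subrr.
by rewrite eqn eqN addeACA; exact: leeDr.
Qed.

Lemma reaction_sum_le e : 0 < e -> e <= 1 ->
  {ae mu, forall x, Omega x -> reaction_sum e x <= majorant u v x}.
Proof.
move=> e0 e1; apply: filterS2 (filterI (rp_growth Pu) (rp_negative Pu)) (filterI (rp_growth Pv) (rp_negative Pv)).
move=> x [gu nu] [gv nv] Ox.
have := reaction_le p1 cf0 rho0 e0 e1 (u0 x) (v0 x) (gu Ox) (nu Ox).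
have := reaction_le p1 cf0 rho0 e0 e1 (v0 x) (u0 x) (gv Ox) (nv Ox).
rewrite /reaction_sum /majorant.
move: (hu x * _) (hv x * _) ((1 + u x) `^ p) ((1 + v x) `^ p) (2 * cf + _) => a b c d k H1 H2.
have -> : 2 * k * (c + d) = k * (c + d) + k * (d + c) by ring.
exact: lerD.
Qed.

Local Notation ep := (fun m : nat => m.+1%:R^-1 : R).

Let ep0 m : 0 < ep m. Proof. by rewrite invr_gt0. Qed.

Let ep1 m : ep m <= 1. Proof. by rewrite invf_le1 ?ler1n. Qed.

Let iG := integrable_majorant Wu Wv u0 v0.

Lemma reaction_integral_le m :
  (\int[mu]_(x in Omega) (reaction_sum (ep m) x)%:E <= \int[mu]_(x in Omega) (majorant u v x)%:E)%E.
Proof.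
have ig := integrable_reaction_sum (ep0 m).
have := ae_le_Rintegral mO ig iG (reaction_sum_le (ep0 m) (ep1 m)).
by rewrite /Rintegral -lee_fin !fineK//; exact: integrable_fin_num.
Qed.

Lemma nonlocal_sum_cvgy z : u z.1 = 0 -> 0 < v z.1 -> 0 < u z.2 ->
  (fun m => (nonlocal_sum (ep m) z)%:E) @ \oo --> +oo%E.
Proof.
move=> ux vx uy; have k0 : 0 < frac_kernel p s z.
  by apply: frac_kernel_gt0; apply: contraTneq uy => <-; rewrite ux ltxx.
apply/cvgeyPge => A.
(* the term of v is bounded below independently of m by the discrete Picone
   inequality; the term of u diverges *)
pose c := `|v z.1 - v z.2| `^ p - `|u z.1 - u z.2| `^ p.
have := nonlocal_diverge p1 (A / frac_kernel p s z - c) uy vx (v0 z.2).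
apply: filterS => m Hm; rewrite lee_fin /nonlocal_sum /nonlocal_density -mulrDl.
rewrite -ler_pdivrMr//.
have := nonlocal_picone p1 (ep0 m) (v0 z.1) (u0 z.1) (v0 z.2) (u0 z.2).
rewrite -/c; move: Hm; rewrite -ux.
move: (signed_pow _ _ * _) (signed_pow _ _ * _) (A / _) c => a b d e; lra.
Qed.

(** On the product of {u = 0 < v} and {u > 0} the nonnegative fractional densities
    tend to infinity while their integrals stay bounded; so the product is null,
    and its second factor is not. *)
Lemma null_zero_set : (0 < mu [set x | (0 < u x)%R])%E ->
  {ae mu, forall x, u x = 0 -> v x = 0}.
Proof.
move=> upos.
have mu_ := W1p_0_measurable p1 Wu; have mv := W1p_0_measurable p1 Wv.
pose P := [set x | 0 < u x]; pose Z := ~` P `&` [set x | 0 < v x].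
have mP : measurable P by exact: measurable_pos.
have mZ : measurable Z by apply: measurableI; [exact: measurableC|exact: measurable_pos].
have uZ x : Z x -> u x = 0 by move=> [/negP]; rewrite -leNgt => ux _; apply/eqP; rewrite eq_le ux u0.
have mB : measurable (Z `*` P) by exact: measurableX.
have mnl e : 0 < e -> measurable_fun setT (nonlocal_sum e).
  move=> e0; have [Wphi _ _] := picone_test_W1p_0 p1 e0 u0 v0 Wu Wv.
  have [Wchi _ _] := picone_test_W1p_0 p1 e0 v0 u0 Wv Wu.
  by apply: measurable_funD; apply: measurable_nonlocal => //;
    [exact: (W1p_0_measurable p1 Wphi)|exact: (W1p_0_measurable p1 Wchi)].
have : (\int[mu \x mu]_(z in Z `*` P) (cst +oo z) <= \int[mu]_(x in Omega) (majorant u v x)%:E)%E.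
  apply: (@fatou_ae _ _ _ (mu \x mu)%E (Z `*` P) (fun m z => (nonlocal_sum (ep m) z)%:E) (cst +oo%E)) => //.
  - by move=> m; apply/measurable_EFinP; apply: measurable_funTS; exact: mnl.
  - by apply: aeW => z _ m; rewrite lee_fin nonlocal_sum_ge0.
  - by apply: aeW => z [/= Zz Pz]; apply: nonlocal_sum_cvgy => //; [exact: uZ|case: Zz].
  - move=> m; apply: le_trans (reaction_integral_le m); apply: le_trans (nonlocal_sum_le (ep0 m)).
    apply: ge0_subset_integral => //; first by apply/measurable_EFinP; exact: mnl.
    by move=> z _; rewrite lee_fin nonlocal_sum_ge0.
rewrite integral_cst// => BM.
have Z0 : mu Z = 0%E.
  apply/eqP; rewrite eq_le measure_ge0 andbT leNgt; apply/negP => Zpos.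
  have B0 : (0 < (mu \x mu)%E (Z `*` P))%E.
    have -> : (mu \x mu)%E (Z `*` P) = (mu Z * mu P)%E by exact: product_measure1E.
    exact: mule_gt0.
  by move: BM; rewrite gt0_mulye// leye_eq; have := integrable_fin_num mO iG; rewrite /comp => /fin_numPlt/andP[_] /lt_eqF ->.
exists Z; split=> // x /= /not_implyP[ux vx]; split=> /=.
  by rewrite /P /= ux ltxx.
by rewrite lt0r v0 andbT; exact/eqP.
Qed.

End pair.

Section uniqueness.
Variables (u v hu hv : V -> R).
Hypotheses (Pu : reaction_pair u hu) (Pv : reaction_pair v hv).

Let u0 := rp_ge0 Pu.
Let v0 := rp_ge0 Pv.
Let Wu := rp_sobolev Pu.
Let Wv := rp_sobolev Pv.

(** The limit of the reaction terms as the regularization disappears. *)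
Definition picone_deficit x : R :=
  hu x * (u x - v x `^ p * u x `^ (1 - p)) + hv x * (v x - u x `^ p * v x `^ (1 - p)).

(** Fatou's lemma for the majorant minus the reaction: since the reactions have
    nonnegative integrals, the positive part of minus the limit has integral at
    most 0. *)
Lemma picone_deficit_ae0 : (0 < mu [set x | (0 < u x)%R])%E -> (0 < mu [set x | (0 < v x)%R])%E ->
  {ae mu, forall x, Omega x -> 0 < u x -> 0 < v x -> picone_deficit x <= 0} ->
  {ae mu, forall x, Omega x -> picone_deficit x = 0}.
Proof.
move=> upos vpos dneg.
have zu := null_zero_set Pu Pv upos; have zv := null_zero_set Pv Pu vpos.
have mu_ := W1p_0_measurable p1 Wu; have mv := W1p_0_measurable p1 Wv.
have d00 x : u x = 0 -> v x = 0 -> picone_deficit x = 0.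
  by move=> ux vx; rewrite /picone_deficit ux vx powR0 ?gt_eqF// !mul0r subrr !mulr0 addr0.
have dichotomy : {ae mu, forall x, (u x = 0 /\ v x = 0) \/ (0 < u x /\ 0 < v x)}.
  apply: filterS2 zu zv => x zu zv; have [ux|ux] := eqVneq (u x) 0; first by left; split=> //; exact: zu.
  right; rewrite !lt0r ux u0 v0 !andbT; split=> //=.
  by apply: contra_neq ux => vx; exact: zv.
have dle : {ae mu, forall x, Omega x -> picone_deficit x <= 0}.
  by apply: filterS2 dichotomy dneg => x [[ux vx] _ _|[ux vx] + Ox]; [rewrite d00|exact].
(* equal to minus the deficit almost everywhere, and nonnegative everywhere *)
pose q x := Num.max 0 (- picone_deficit x).
have mpow (r : R) (g : V -> R) : measurable_fun setT g -> measurable_fun setT (fun x => g x `^ r).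
  by move=> mg; exact: (measurableT_comp (measurable_powR r) mg).
have md : measurable_fun setT picone_deficit.
  apply: measurable_funD; apply: measurable_funM; try exact: (rp_measurable Pu); try exact: (rp_measurable Pv);
  by apply: measurable_funB => //; apply: measurable_funM; exact: mpow.
have mq : measurable_fun setT q by apply: measurable_maxr => //; exact: measurableT_comp.
have q0 x : 0 <= q x by rewrite le_max lexx.
have iG := integrable_majorant Wu Wv u0 v0.
have Gfin := integrable_fin_num mO iG.
have ep0 m : 0 < m.+1%:R^-1 :> R by rewrite invr_gt0.
have ep1 m : m.+1%:R^-1 <= 1 :> R by rewrite invf_le1 ?ler1n.
have key : (\int[mu]_(x in Omega) ((majorant u v x)%:E + (q x)%:E) <= \int[mu]_(x in Omega) (majorant u v x)%:E)%E.
  apply: (@fatou_ae _ _ _ mu Omega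
    (fun m x => (majorant u v x - reaction_sum u v hu hv m.+1%:R^-1 x)%:E)) => //.
  - move=> m; have := integrableB mO iG (integrable_reaction_sum Pu Pv (ep0 m)).
    by move=> /integrableP[].
  - have : {ae mu, forall x, forall m, Omega x -> reaction_sum u v hu hv m.+1%:R^-1 x <= majorant u v x}.
      by apply: ae_foralln => m; have X := reaction_sum_le Pu Pv (ep0 m) (ep1 m); exact: X.
    by apply: filterS => x le_ Ox m; rewrite lee_fin subr_ge0 le_.
  - apply: filterS2 dichotomy dle => x dx dle Ox.
    rewrite -EFinD; apply: cvg_EFin; first exact: nearW.
    have -> : q x = - picone_deficit x by rewrite /q; apply/max_idPr; rewrite oppr_ge0 dle.
    apply: cvgB; first exact: cvg_cst.
    case: dx => [[ux vx]|[ux vx]].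
      rewrite d00// /reaction_sum ux vx.
      rewrite (_ : (fun _ => _) = (fun=> 0)); first exact: cvg_cst.
      by apply/funext => m; rewrite picone_test00// !mulr0 addr0.
    by apply: cvgD; apply: cvgM; try exact: cvg_cst; exact: picone_test_cvg.
  - move=> m; have ig := integrable_reaction_sum Pu Pv (ep0 m).
    have -> : (\int[mu]_(x in Omega) (majorant u v x - reaction_sum u v hu hv m.+1%:R^-1 x)%:E =
        \int[mu]_(x in Omega) (majorant u v x)%:E - \int[mu]_(x in Omega) (reaction_sum u v hu hv m.+1%:R^-1 x)%:E)%E.
      exact: integralB_EFin.
    rewrite -[leRHS]sube0; apply: leeB => //.
    apply: le_trans (nonlocal_sum_le Pu Pv (ep0 m)); apply: integral_ge0 => z _.
    by rewrite lee_fin; exact: (nonlocal_sum_ge0 Pu Pv).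
have q_int : (\int[mu]_(x in Omega) (q x)%:E = 0)%E.
  move: key; rewrite ge0_integralD//.
  - move=> le0; apply/eqP; rewrite eq_le [X in _ && X]integral_ge0 ?andbT; last by move=> x _; rewrite lee_fin.
    by rewrite -(leeD2lE _ _ Gfin) /comp adde0.
  - by move=> x _; rewrite lee_fin majorant_ge0.
  - by have /integrableP[] := iG.
  - by move=> x _; rewrite lee_fin.
  - by apply/measurable_EFinP; exact: measurable_funTS.
have : ae_eq mu Omega (EFin \o q) (cst 0%E).
  apply/(ae_eq_integral_abs mu mO); first by apply/measurable_EFinP; exact: measurable_funTS.
  by rewrite -q_int; apply: eq_integral => x _; rewrite /= ger0_norm.
apply: filterS2 dle => x dle qx Ox; apply/eqP; rewrite eq_le dle//=.
have /= [] := qx Ox; rewrite /q => /max_idPl; rewrite oppr_le0//.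
Qed.

End uniqueness.
End comparison.

Theorem theorem2p6 (R : realType) (N : nat) (hN : (2 <= N)%N)
    (Omega : set 'rV[R]_N) (hOmega : bounded_C1_domain Omega)
    (p s : R) (hp : 1 < p) (hs0 : 0 < s) (hs1 : s < 1)
    (H : 'rV[R]_N -> R) (hH : finsler_minkowski_norm H)
    (* only the values f x t with x in Omega and t >= 0 matter *)
    (f : 'rV[R]_N -> R -> R)
    (f1 : caratheodory Omega f)
    (f2 : forall t : R, 0 <= t -> Linfty Omega (f ^~ t))
    (f3 : exists2 cp : R, 0 < cp &
       {ae @lebesgue_rV R N, forall x, Omega x ->
          forall t : R, 0 <= t -> `|f x t| <= cp * (1 + t `^ (p - 1))})
    (f4 : {ae @lebesgue_rV R N, forall x, Omega x ->
       forall t1 t2 : R, 0 < t1 -> t1 < t2 ->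
         f x t2 / t2 `^ (p - 1) < f x t1 / t1 `^ (p - 1)})
    (f5 : exists2 rho : R, 0 < rho &
       {ae @lebesgue_rV R N, forall x, Omega x ->
          forall t : R, 0 < t -> t < rho -> 0 < f x t}) :
  forall u v : 'rV[R]_N -> R,
    weak_solution Omega p s H f u -> weak_solution Omega p s H f v ->
    {ae @lebesgue_rV R N, forall x, u x = v x}.
Proof.
move=> u v su sv.
have [_ oO _ bO _] := hOmega.
have mO : measurable Omega by exact: open_measurable_rV.
have Ofin : (lebesgue_rV N Omega < +oo)%E.
  have [r [r0 Or]] := bounded_sub_box bO.
  apply: le_lt_trans (box_lt_pinfty (const_mx (- r)) (const_mx r)).
  apply: le_measure; rewrite ?inE//; first exact: measurable_box.
  by move=> x Ox; apply/cubeP; exact: Or.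
have [cp cp0 fcp] := f3; have [rho rho0 frho] := f5.
have pair w h : (forall x, 0 <= w x) -> W1p_0 p Omega w -> measurable_fun setT h ->
    weak_equation Omega p s H w h -> {ae @lebesgue_rV R N, forall x, Omega x -> f x (w x) = h x} ->
    reaction_pair Omega p s H cp rho w h.
  move=> w0 Ww mh eqw fh; split=> //.
    by apply: filterS2 fh fcp => x fh fx Ox; rewrite -fh//; exact: fx.
  apply: filterS3 fh frho f1.2 => x fh fx fc Ox; rewrite -fh// leNgt; apply: contraTN => wr.
  rewrite -leNgt; have [->|wx] := eqVneq (w x) 0; first exact: ge0_at0 rho0 (fc Ox) (fx Ox).
  by apply/ltW/fx => //; rewrite lt0r wx w0.
have [u' [hu [[uu' u0 Wu mhu equ] [fu upos]]]] := borel_weak_solution mO hp f1 su.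
have [v' [hv [[vv' v0 Wv mhv eqv] [fv vpos]]]] := borel_weak_solution mO hp f1 sv.
have Pu := pair _ _ u0 Wu mhu equ fu; have Pv := pair _ _ v0 Wv mhv eqv fv.
have sign : {ae @lebesgue_rV R N, forall x, Omega x -> 0 < u' x -> 0 < v' x ->
    picone_deficit p u' v' hu hv x <= 0 /\ (picone_deficit p u' v' hu hv x = 0 -> u' x = v' x)}.
  apply: filterS3 f4 fu fv => x f4x fux fvx Ox ux vx.
  by apply: picone_sign => //; rewrite -fux// -fvx//; exact: f4x.
have d0 : {ae @lebesgue_rV R N, forall x, Omega x -> picone_deficit p u' v' hu hv x = 0}.
  apply: (picone_deficit_ae0 mO Ofin hp hH cp0 rho0 Pu Pv upos vpos).
  by apply: filterS sign => x sx Ox ux vx; exact: (sx Ox ux vx).1.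
have zu := null_zero_set mO Ofin hp hH cp0 rho0 Pu Pv upos.
have zv := null_zero_set mO Ofin hp hH cp0 rho0 Pv Pu vpos.
have inside : {ae @lebesgue_rV R N, forall x, Omega x -> u' x = v' x}.
  apply: filterS2 (filterI sign d0) (filterI zu zv) => x [sx dx] [zux zvx] Ox.
  have [ux|ux] := eqVneq (u' x) 0; first by rewrite ux zux.
  have [vx|vx] := eqVneq (v' x) 0; first by rewrite vx zvx.
  by apply: (sx Ox _ _).2; rewrite ?lt0r ?ux ?vx ?u0 ?v0// dx.
apply: filterS3 (filterI uu' vv') inside (filterI Wu.2 Wv.2) => x [-> ->] ins [uo vo].
by have [/ins//|Ox] := pselect (Omega x); rewrite uo// vo.
Qed.
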